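(* Let $\kappa,\iota\in\mathbb R\setminus\{0\}$ be fixed constants and consider the time-periodic Schrödinger equation on $\mathbb R$ $$\mathrm i\,\partial_tu=\frac12H_0u+W(t,x,-\mathrm i\partial_x)u,\qquad u(0)\in\mathcal H^s,$$ where $$W(t,x,-\mathrm i\partial_x)=\frac\kappa2\Big(-\cos^2(t)\,x^2-\cos(t)\sin(t)\,(x\cdot\mathrm i\partial_x+\mathrm i\partial_x\cdot x)+\sin^2(t)\,\partial_x^2\Big)+2\mathrm i\,\iota\cos(t)\,\partial_x .$$ For $s\ge0$ and non-vanishing $u(0)\in\mathcal H^s$, there are two constants $c,C>0$, depending on $s$ and $u(0)$, such that the solution fulfills $$c\,|\kappa\iota|^st^{2s}\le\|u(t)\|_s\le C\left(1+|\kappa\iota|^st^{2s}\right),\qquad\forall\,t\ge0.$$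
   Context: $H_0=-\partial_x^2+x^2$ on $L^2(\mathbb R)$. For $s\ge0$, $\mathcal H^s:=\{\psi\in L^2(\mathbb R):H_0^{s/2}\psi\in L^2(\mathbb R)\}$ with norm $\|\psi\|_s:=\|H_0^{s/2}\psi\|_{L^2}$. The product $x\cdot\mathrm i\partial_x+\mathrm i\partial_x\cdot x$ is a composition of operators: $u\mapsto \mathrm i x\,\partial_xu+\mathrm i\,\partial_x(xu)$. *)

(* Defs.v *)
From mathcomp Require Import all_boot all_order all_algebra.
From mathcomp Require Import complex.
From mathcomp Require Import all_classical all_reals all_analysis.
From mathcomp Require Import ring.

Set Implicit Arguments.
Unset Strict Implicit.
Unset Printing Implicit Defensive.

Import Order.TTheory GRing.Theory Num.Theory.
Import numFieldNormedType.Exports.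
Import Normc.

Local Open Scope classical_set_scope.
Local Open Scope ring_scope.
Local Open Scope complex_scope.

Section L2.
Context {R : realType}.
Local Notation mu := (@lebesgue_measure R).
Implicit Types f g : R -> R[i].

Definition L2enorm f : \bar R := Lnorm mu 2%:E (fun x => (normc (f x))%:E).

(* Elements of L^2(R) are represented by functions; equality in L^2(R) is
   equality almost everywhere. *)
Definition L2 f : Prop :=
  [/\ measurable_fun setT (fun x => complex.Re (f x)),
      measurable_fun setT (fun x => complex.Im (f x)) &
      (L2enorm f < +oo)%E].

Definition L2norm f : R := fine (L2enorm f).

Definition cintegral f : R[i] :=
  Rintegral mu setT (fun x => complex.Re (f x)) +i*
  Rintegral mu setT (fun x => complex.Im (f x)).

(* The L^2 scalar product of f with phi; phi being real, nothing is conjugated. *)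
Definition pairing f (phi : R -> R) : R[i] :=
  cintegral (fun x => f x * (phi x)%:C).

End L2.

(* The differential operators, as compositions of abstract operators X
   (multiplication by x) and D (the derivative d/dx), so that they make sense
   both on functions and on distributions. *)
Definition H0 (V : zmodType) (X D : V -> V) (u : V) : V :=
  - D (D u) + X (X u).

Section Hamiltonian.
Context {R : realType} {V : lmodType R[i]}.
Variables (kappa iota : R) (X D : V -> V).

Definition Wop (t : R) (u : V) : V :=
  (kappa / 2)%:C *:
    (- ((cos t ^+ 2)%:C *: X (X u))
     - (cos t * sin t)%:C *: (X ('i *: D u) + 'i *: D (X u))
     + (sin t ^+ 2)%:C *: D (D u))
  + (2 * 'i * (iota * cos t)%:C) *: D u.

Definition hamiltonian (t : R) (u : V) : V :=
  (2^-1)%:C *: H0 X D u + Wop t u.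

End Hamiltonian.

Section Hermite.
Context {R : realType}.

Definition mulX (phi : R -> R) : R -> R := fun x => x * phi x.

Fixpoint hermite_poly (n : nat) : {poly R} :=
  if n is m.+1 then 2%:P * 'X * hermite_poly m - deriv (hermite_poly m) else 1.

(* The L^2-normalised Hermite functions: an orthonormal basis of L^2(R) which
   diagonalises H0, see H0_hermite below. *)
Definition hermite (n : nat) : R -> R := fun x =>
  (hermite_poly n).[x] * expR (- (x ^+ 2 / 2))
  / Num.sqrt (2 ^+ n * n`!%:R * Num.sqrt pi).

Lemma hermite_polyS n : hermite_poly n.+1 =
  2%:P * 'X * hermite_poly n - deriv (hermite_poly n).
Proof. by []. Qed.

Lemma deriv_hermite_poly n :
  deriv (hermite_poly n.+1) = (2 * n.+1%:R)%:P * hermite_poly n.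
Proof.
elim: n => [|n IH].
  by rewrite hermite_polyS derivB !derivM derivX !derivC; ring.
rewrite hermite_polyS derivB IH !derivM derivX !derivC IH hermite_polyS.
rewrite -[in RHS]natr1 !polyCM polyCD; ring.
Qed.

Lemma derive_gauss (p : {poly R}) (c : R) :
  derive1 (fun x : R => p.[x] * expR (- (x ^+ 2 / 2)) / c) =
  (fun x : R => (deriv p - 'X * p).[x] * expR (- (x ^+ 2 / 2)) / c).
Proof.
apply/funext => x; rewrite derive1E.
have de : is_derive x 1 (fun y : R => expR (- (y ^+ 2 / 2)))
    (expR (- (x ^+ 2 / 2)) * - x).
  have dq : is_derive x 1 (fun y : R => - (y ^+ 2 / 2)) (- x).
    have -> : (fun y : R => - (y ^+ 2 / 2)) = horner ((- 2^-1) *: 'X^2).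
      by apply/funext => y; rewrite hornerZ hornerXn; field.
    apply: is_derive_eq; rewrite derivZ derivXn.
    by rewrite hornerZ hornerMn hornerXn /= expr1; field.
  exact: (is_derive1_comp (is_derive_expR _) dq).
have -> : (fun y : R => p.[y] * expR (- (y ^+ 2 / 2)) / c) =
    c^-1 *: (horner p * (fun y : R => expR (- (y ^+ 2 / 2)))).
  by apply/funext => y; rewrite !fctE /= /GRing.scale /= mulrC.
rewrite derive_val /GRing.scale /= hornerD hornerN hornerM hornerX; ring.
Qed.

Lemma H0_hermite n :
  H0 mulX (@derive1 R R^o) (hermite n) = (2 * n%:R + 1) *: hermite n.
Proof.
rewrite /H0 /hermite !derive_gauss; apply/funext => x.
have ode : deriv (deriv (hermite_poly n)) =
    2%:P * 'X * deriv (hermite_poly n) - (2 * n%:R)%:P * hermite_poly n.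
  case: n => [|n]; first by rewrite /= -polyC1 !derivC; ring.
  rewrite deriv_hermite_poly derivM derivC hermite_polyS; ring.
rewrite !fctE /mulX derivB derivM derivX ode !hornerE /GRing.scale /=.
ring.
Qed.

End Hermite.

Section Sobolev.
Context {R : realType}.
Implicit Types (a s : R) (psi g : R -> R[i]).

Definition spectral_sum a psi (N : nat) : R -> R[i] := fun x =>
  \sum_(n < N) ((2 * n%:R + 1) `^ a)%:C * pairing psi (hermite n)
               * (hermite n x)%:C.

(* Functional calculus: psi is in the domain of H0^a and H0^a psi = g. *)
Definition is_H0pow a psi g : Prop :=
  L2 g /\
  L2enorm (fun x => spectral_sum a psi N x - g x) @[N --> \oo] --> (0 : \bar R).

(* A representative of H0^a psi when psi is in the domain of H0^a; the default
   value 0 is irrelevant otherwise. *)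
Definition H0pow a psi : R -> R[i] := xget (fun=> 0) [set g | is_H0pow a psi g].

Definition Hs s psi : Prop := L2 psi /\ exists g, is_H0pow (s / 2) psi g.

Definition Hnorm s psi : R := L2norm (H0pow (s / 2) psi).

End Sobolev.

Section Distributions.
Context {R : realType}.

Definition schwartz (phi : R -> R) : Prop :=
  (forall n x, derivable (derive1n n phi) x 1) /\
  (forall k n, exists M, forall x, `|x ^+ k * derive1n n phi x| <= M).

(* Complex-valued tempered distributions act on real-valued Schwartz functions,
   which determines them by complex linearity. *)
Definition tempered : Type := (R -> R) -> R[i]^o.

Definition Xdist (T : tempered) : tempered := fun phi => T (mulX phi).

Definition Ddist (T : tempered) : tempered := fun phi => - T (derive1 phi).

Definition regular_dist (f : R -> R[i]) : tempered := pairing f.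

Definition is_cderive (f : R -> R[i]) (t : R) (d : R[i]) : Prop :=
  is_derive t 1 (fun r => complex.Re (f r)) (complex.Re d) /\
  is_derive t 1 (fun r => complex.Im (f r)) (complex.Im d).

(* u is continuous from [0, +oo[ to L^2(R), and
   i d/dt u = (1/2) H0 u + W(t) u
   holds in the sense of tempered distributions at every t > 0. *)
Definition solution (kappa iota : R) (u0 : R -> R[i]) (u : R -> R -> R[i])
  : Prop :=
  [/\ forall t, 0 <= t -> L2 (u t),
      forall t0, 0 <= t0 ->
        L2enorm (fun x => u t x - u t0 x)
          @[t --> within [set t | 0 <= t] (nbhs t0)]
          --> (0 : \bar R),
      {ae (@lebesgue_measure R), forall x, u 0 x = u0 x} &
      forall t phi, 0 < t -> schwartz phi ->
        exists d : R[i],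
          is_cderive (fun r => regular_dist (u r) phi) t d /\
          'i * d = hamiltonian kappa iota Xdist Ddist t (regular_dist (u t)) phi].

End Distributions.

(* Main.v *)
(* The idea is to solve the equation explicitly.  With h_n the Hermite functions,
   the coefficients of the solution are
     <u(t), h_n> = exp (- i (n + 1/2) t) int u0(y) exp (i th(t, y)) h_n(y - g(t)) dy,
   where th(t, y) = kappa t y^2 / 2 + be(t) y + ga(t), g grows linearly and
   be(t) behaves like - kappa iota t^2 / 2.  Up to the harmonic rotation, the
   solution is u0 translated by g(t) and modulated with a momentum of size t^2, so
   its s-norm is of order t^(2s).

   Uniqueness: the difference of two solutions has coefficients that solve a
   pentadiagonal system; a logarithmic cutoff in n controls the flux of mass to
   infinity, so that this difference vanishes.

   Upper bound: multiplication by 2n+1 on the coefficients is x^2 - d^2/dx^2, and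
   conjugating it by the flow costs (1+t)^4; iterating gives all even integer
   exponents, and comparing tails of coefficient sequences interpolates to s.

   Lower bound: as the momentum is of order t^2, half of the mass of u(t) sits on
   levels n above a small multiple of t^4.

   Completeness of the Hermite functions: a function orthogonal to all of them is
   orthogonal to all Gaussians narrower than h_0, with any center, hence to h_0
   times the indicator of any ball, which is a limit of combinations of these. *)
From mathcomp Require Import all_boot all_order all_algebra.
From mathcomp Require Import complex.
From mathcomp Require Import all_classical all_reals all_analysis.
From mathcomp Require Import measurable_realfun ring lra.
Require Import Defs.

Set Implicit Arguments.
Unset Strict Implicit.
Unset Printing Implicit Defensive.

Import Order.TTheory GRing.Theory Num.Theory.
Import numFieldNormedType.Exports.
Import Normc.

Local Open Scope classical_set_scope.
Local Open Scope ring_scope.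
Local Open Scope complex_scope.

(** * Square-integrable real functions *)

(** The origin of the rates: the quadratic part of [W] is [- kappa / 2] times the square of
    [cos t x + i sin t d/dx], an operator that the harmonic rotation carries to [x]. In the rotating
    frame this part is therefore the fixed potential [- kappa x ^ 2 / 2], while the first-order part
    acquires the coefficient [2 iota cos t ^ 2], whose mean [iota] produces a steady drift. The
    position grows like [iota t], the force is proportional to the position, and the momentum grows
    like [kappa iota t ^ 2 / 2]. No second derivative survives, which is why the flow is explicit.

    The data are only square-integrable, so [x u] and [u'] need not be functions in L2. All
    operators are therefore moved to the Hermite functions: time derivatives fall on a smooth
    kernel, and [x] and [d/dx] become [opX] and [opD] acting on an index. The same lack of
    regularity rules out a direct energy identity for uniqueness. The mass exchanged near level [n]
    is only known to be [O(n)], which is the rate that the divergence of the harmonic series can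
    still absorb. *)

Section RealL2.
Context {R : realType}.
Local Notation mu := (@lebesgue_measure R).
Implicit Types f g h : R -> R.

Definition integ f : Prop := mu.-integrable setT (EFin \o f).
Definition int f : R := Rintegral mu setT f.

Definition sqi f : Prop := measurable_fun setT f /\ integ (fun x => f x * f x).
Definition ip f g : R := int (fun x => f x * g x).

Lemma integ_meas f : integ f -> measurable_fun setT f.
Proof. by move=> /integrableP[/measurable_EFinP]. Qed.

Lemma integD f g : integ f -> integ g -> integ (fun x => f x + g x).
Proof. by move=> F G; have := integrableD measurableT F G. Qed.

Lemma integN f : integ f -> integ (fun x => - f x).
Proof. by move=> F; have := integrableN F. Qed.

Lemma integB f g : integ f -> integ g -> integ (fun x => f x - g x).
Proof. by move=> F /integN G; exact: integD. Qed.

Lemma integZ c f : integ f -> integ (fun x => c * f x).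
Proof. by move=> F; have := integrableZl measurableT c F. Qed.

Lemma integ0 : integ (fun=> 0).
Proof. exact: (integrable0 mu). Qed.

Lemma integ_sum (I : Type) (r : seq I) (F : I -> R -> R) :
  (forall i, integ (F i)) -> integ (fun x => \sum_(i <- r) F i x).
Proof.
move=> H; elim: r => [|i r IH].
  by under eq_fun do rewrite big_nil; exact: integ0.
by under eq_fun do rewrite big_cons; exact: integD.
Qed.

Lemma integ_le f g : measurable_fun setT f -> (forall x, `|f x| <= g x) ->
  integ g -> integ f.
Proof.
move=> mf fg ig; apply: (le_integrable measurableT _ _ ig).
  exact/measurable_EFinP.
by move=> x _ /=; rewrite lee_fin (le_trans (fg x)) ?ler_norm.
Qed.

Lemma integ_norm f : integ f -> integ (fun x => `|f x|).
Proof. by move=> F; have := integrable_norm F. Qed.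

Lemma intD f g : integ f -> integ g ->
  int (fun x => f x + g x) = int f + int g.
Proof. by move=> F G; rewrite /int RintegralD. Qed.

Lemma intZ c f : integ f -> int (fun x => c * f x) = c * int f.
Proof. by move=> F; rewrite /int RintegralZl. Qed.

Lemma intN f : integ f -> int (fun x => - f x) = - int f.
Proof.
move=> F; rewrite -mulN1r -intZ //; congr int.
by apply/funext => x; rewrite mulN1r.
Qed.

Lemma intB f g : integ f -> integ g ->
  int (fun x => f x - g x) = int f - int g.
Proof. by move=> F G; rewrite intD ?intN //; exact: integN. Qed.

Lemma int0 : int (fun=> 0) = 0.
Proof. by rewrite /int Rintegral_cst // mul0r. Qed.

Lemma int_sum (I : Type) (r : seq I) (F : I -> R -> R) :
  (forall i, integ (F i)) ->
  int (fun x => \sum_(i <- r) F i x) = \sum_(i <- r) int (F i).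
Proof.
move=> H; elim: r => [|i r IH].
  by under eq_fun do rewrite big_nil; rewrite big_nil int0.
under eq_fun do rewrite big_cons.
by rewrite big_cons intD ?IH //; exact: integ_sum.
Qed.

Lemma int_ge0 f : (forall x, 0 <= f x) -> 0 <= int f.
Proof. by move=> f0; apply: Rintegral_ge0. Qed.

Lemma EFin_int f : integ f -> (int f)%:E = (\int[mu]_x (f x)%:E)%E.
Proof.
by move=> F; rewrite /int /Rintegral fineK //; apply: integrable_fin_num.
Qed.

Lemma int_eq0_ae f : integ f -> (forall x, 0 <= f x) -> int f = 0 ->
  {ae mu, forall x, f x = 0}.
Proof.
move=> F f0 i0.
have : (\int[mu]_x `|(f x)%:E| = 0)%E.
  under eq_integral => x _ do rewrite gee0_abs ?lee_fin //.
  by rewrite -EFin_int // i0.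
move/(ae_eq_integral_abs mu measurableT).
have mf : measurable_fun setT (fun x => (f x)%:E).
  by apply/measurable_EFinP; exact: integ_meas.
by move=> /(_ mf); apply: filterS => x /(_ I) [].
Qed.

Lemma int_ae_eq f g : integ f -> measurable_fun setT g ->
  {ae mu, forall x, f x = g x} -> int f = int g.
Proof.
move=> F mg fg; rewrite /int /Rintegral; congr fine.
apply: ae_eq_integral => //.
- by apply/measurable_EFinP; exact: integ_meas.
- exact/measurable_EFinP.
case: fg => N [mN N0 sN]; exists N; split => //.
by move=> x h; apply: sN => e; apply: h => _; rewrite /= e.
Qed.

Lemma int_dct_ae (F : nat -> R -> R) f g :
  (forall n, measurable_fun setT (F n)) -> measurable_fun setT f ->
  {ae mu, forall x, F n x @[n --> \oo] --> f x} -> integ g ->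
  (forall n x, `|F n x| <= g x) ->
  integ f /\ int (F n) @[n --> \oo] --> int f.
Proof.
move=> mF mf Ff ig Fg.
have H1 n : measurable_fun setT (fun x => (F n x)%:E) by apply/measurable_EFinP.
have H2 : measurable_fun setT (fun x => (f x)%:E) by apply/measurable_EFinP.
have H3 : {ae mu, forall x, setT x -> (F n x)%:E @[n --> \oo] --> (f x)%:E}.
  case: Ff => N [mN N0 sN]; exists N; split => // x H; apply: sN => C.
  by apply: H => _; apply: cvg_EFin; [exact: nearW|exact: C].
have H4 : {ae mu, forall x n, setT x -> (`|(F n x)%:E| <= (g x)%:E)%E}.
  by apply: aeW => x n _; rewrite lee_fin.
have [If _ C] := @dominated_convergence _ _ R mu setT measurableT _ _ _ H1 H2 H3 ig H4.
split; first exact: If.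
apply: fine_cvg; rewrite EFin_int; [exact: C|exact: If].
Qed.

Lemma int_dct (F : nat -> R -> R) f g :
  (forall n, measurable_fun setT (F n)) -> measurable_fun setT f ->
  (forall x, F n x @[n --> \oo] --> f x) -> integ g ->
  (forall n x, `|F n x| <= g x) ->
  integ f /\ int (F n) @[n --> \oo] --> int f.
Proof. by move=> mF mf Ff; apply: int_dct_ae => //; exact: aeW. Qed.

Lemma int_fatou (F : nat -> R -> R) f M :
  (forall n, integ (F n)) -> measurable_fun setT f ->
  (forall n x, 0 <= F n x) -> (forall x, 0 <= f x) ->
  {ae mu, forall x, F n x @[n --> \oo] --> f x} ->
  (\forall n \near \oo, int (F n) <= M) -> integ f /\ int f <= M.
Proof.
move=> iF mf F0 f0 Ff FM.
have mF n : measurable_fun setT (fun x => (F n x)%:E).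
  by apply/measurable_EFinP; exact: integ_meas.
have E : (\int[mu]_x (f x)%:E <= M%:E)%E.
  have -> : (\int[mu]_x (f x)%:E =
      \int[mu]_x (limn_einf (fun n => (F n x)%:E)))%E.
    apply: ae_eq_integral => //; first exact/measurable_EFinP.
    - rewrite /limn_einf; apply: measurableT_comp => //.
      apply: (@measurable_fun_limn_esup _ _ R setT (fun n x => (- (F n x)%:E)%E)).
      by move=> n; apply: measurableT_comp.
    case: Ff => N [mN N0 sN]; exists N; split => // x h; apply: sN => C.
    apply: h => _; rewrite is_cvg_limn_einfE.
      by apply/esym/cvg_lim => //; apply: cvg_EFin; [exact: nearW|exact: C].
    apply/cvg_ex; exists (f x)%:E.
    by apply: cvg_EFin; [exact: nearW|exact: C].
  apply: (le_trans (fatou mu measurableT mF _)) => [n x _|].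
    by rewrite lee_fin.
  rewrite limn_einf_lim; apply: lime_le.
    exact: is_cvg_einfs.
  near=> n.
  apply: (@le_trans _ _ (int (F n))%:E).
    rewrite EFin_int //; apply: ereal_inf_lbound => /=.
    by exists n => //=.
  by rewrite lee_fin; near: n.
have If : integ f.
  apply/integrableP; split; first exact/measurable_EFinP.
  under eq_integral => x _ do rewrite gee0_abs ?lee_fin //.
  exact: (le_lt_trans E (ltry _)).
by split => //; rewrite -lee_fin EFin_int.
Unshelve. all: by end_near. Qed.

(** The sum of all [F n] is integrable by monotone convergence, hence finite almost everywhere, and
    it dominates each term. *)
Lemma integ_pos_sum_ae (F : nat -> R -> R) M :
  (forall n, integ (F n)) -> (forall n x, 0 <= F n x) ->
  (forall n, \sum_(i < n) int (F i) <= M) ->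
  {ae mu, forall x, exists B, forall n, F n x <= B}.
Proof.
move=> iF F0 FM.
have mF n : measurable_fun setT (fun x => (F n x)%:E).
  by apply/measurable_EFinP; exact: integ_meas.
pose H x := (\sum_(n <oo) (F n x)%:E)%E.
have H0 x : (0 <= H x)%E by apply: nneseries_ge0 => n _ _; rewrite lee_fin.
have mH : measurable_fun setT H.
  by apply: ge0_emeasurable_sum => [n x _ _|n _] //; rewrite lee_fin.
have iH : mu.-integrable setT H.
  apply/integrableP; split => //.
  under eq_integral => x _ do rewrite gee0_abs //.
  rewrite integral_nneseries //; last by move=> n x _; rewrite lee_fin.
  apply: (@le_lt_trans _ _ M%:E); last exact: ltry.
  apply: lime_le.
    by apply: is_cvg_nneseries => n _ _; apply: integral_ge0 => x _; rewrite lee_fin.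
  apply: nearW => n.
  rewrite big_mkord; under eq_bigr => i _ do rewrite -EFin_int //.
  by rewrite sumEFin lee_fin.
have := integrable_ae measurableT iH.
case=> N [mN N0 sN]; exists N; split => // x h; apply: sN => C.
apply: h; exists (fine (H x)) => n.
rewrite -lee_fin fineK; last exact: C.
apply: (le_trans _ (nneseries_lim_ge n.+1 _)); last first.
  by move=> k _ _; rewrite lee_fin.
rewrite big_nat_recr //= leeDr //.
by apply: sume_ge0 => i _; rewrite lee_fin.
Qed.

Lemma sqi_meas f : sqi f -> measurable_fun setT f. Proof. by case. Qed.

Lemma sqi_ipi f g : sqi f -> sqi g -> integ (fun x => f x * g x).
Proof.
move=> [mf F] [mg G]; apply: (integ_le _ _ (integD F G)).
  exact: measurable_funM.
by move=> x; rewrite ler_norml; apply/andP; split; nra.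
Qed.

Lemma ipC f g : ip f g = ip g f.
Proof. by rewrite /ip; congr int; apply/funext => x; rewrite mulrC. Qed.

Lemma sqiD f g : sqi f -> sqi g -> sqi (fun x => f x + g x).
Proof.
move=> sf sg; split; first by apply: measurable_funD; exact: sqi_meas.
have -> : (fun x => (f x + g x) * (f x + g x)) =
  (fun x => f x * f x + f x * g x + (g x * f x + g x * g x)).
  by apply/funext => x; ring.
by apply: integD; apply: integD; exact: sqi_ipi.
Qed.

Lemma sqiZ c f : sqi f -> sqi (fun x => c * f x).
Proof.
move=> sf; split; first by apply: measurable_funM => //; exact: sqi_meas.
have -> : (fun x => (c * f x) * (c * f x)) =
  (fun x => (c * c) * (f x * f x)) by apply/funext => x; ring.
by apply: integZ; exact: sqi_ipi.
Qed.

Lemma sqiN f : sqi f -> sqi (fun x => - f x).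
Proof. by move=> /(sqiZ (-1)); under eq_fun do rewrite mulN1r. Qed.

Lemma sqiB f g : sqi f -> sqi g -> sqi (fun x => f x - g x).
Proof. by move=> sf /sqiN; exact: sqiD. Qed.

Lemma sqi0 : sqi (fun=> 0).
Proof. by split => //; under eq_fun do rewrite mul0r; exact: integ0. Qed.

Lemma sqi_sum (I : Type) (r : seq I) (F : I -> R -> R) :
  (forall i, sqi (F i)) -> sqi (fun x => \sum_(i <- r) F i x).
Proof.
move=> H; elim: r => [|i r IH].
  by under eq_fun do rewrite big_nil; exact: sqi0.
by under eq_fun do rewrite big_cons; exact: sqiD.
Qed.

Lemma sqi_le f g : measurable_fun setT f -> (forall x, `|f x| <= `|g x|) ->
  sqi g -> sqi f.
Proof.
move=> mf fg [_ G]; split => //; apply: integ_le G.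
  exact: measurable_funM.
move=> x; rewrite -[leRHS]ger0_norm; last by rewrite -expr2 sqr_ge0.
by rewrite !normrM ler_pM.
Qed.

Lemma ipDl f g h : sqi f -> sqi g -> sqi h ->
  ip (fun x => f x + g x) h = ip f h + ip g h.
Proof.
move=> sf sg sh; rewrite /ip -intD; try exact: sqi_ipi.
by congr int; apply/funext => x; rewrite mulrDl.
Qed.

Lemma ipZl c f h : sqi f -> sqi h -> ip (fun x => c * f x) h = c * ip f h.
Proof.
move=> sf sh; rewrite /ip -intZ; last exact: sqi_ipi.
by congr int; apply/funext => x; rewrite mulrA.
Qed.

Lemma ipNl f h : sqi f -> sqi h -> ip (fun x => - f x) h = - ip f h.
Proof.
move=> sf sh; rewrite -mulN1r -ipZl //; congr ip.
by apply/funext => x; rewrite mulN1r.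
Qed.

Lemma ipBl f g h : sqi f -> sqi g -> sqi h ->
  ip (fun x => f x - g x) h = ip f h - ip g h.
Proof. by move=> sf sg sh; rewrite ipDl ?ipNl //; exact: sqiN. Qed.

Lemma ip_suml (I : Type) (r : seq I) (F : I -> R -> R) h :
  (forall i, sqi (F i)) -> sqi h ->
  ip (fun x => \sum_(i <- r) F i x) h = \sum_(i <- r) ip (F i) h.
Proof.
move=> H sh; rewrite /ip -int_sum; last by move=> i; exact: sqi_ipi.
by congr int; apply/funext => x; rewrite mulr_suml.
Qed.

Lemma ip_ge0 f : 0 <= ip f f.
Proof. by apply: int_ge0 => x; rewrite -expr2 sqr_ge0. Qed.

Lemma ip_sqB f g : sqi f -> sqi g ->
  ip (fun x => f x - g x) (fun x => f x - g x) = ip f f - 2 * ip f g + ip g g.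
Proof.
move=> sf sg; have sd := sqiB sf sg.
rewrite ipBl // (ipC f (fun x => _)) (ipC g (fun x => _)) !ipBl // (ipC g f).
by ring.
Qed.

Lemma ip_sqD f g : sqi f -> sqi g ->
  ip (fun x => f x + g x) (fun x => f x + g x) = ip f f + 2 * ip f g + ip g g.
Proof.
move=> sf sg; have sd := sqiD sf sg.
rewrite ipDl // (ipC f (fun x => _)) (ipC g (fun x => _)) !ipDl // (ipC g f).
by ring.
Qed.

Lemma ip_CS f g : sqi f -> sqi g -> (ip f g) ^+ 2 <= ip f f * ip g g.
Proof.
move=> sf sg.
have H c : 0 <= ip f f - 2 * (c * ip f g) + c ^+ 2 * ip g g.
  have sc := sqiZ c sg.
  have := ip_ge0 (fun x => f x - c * g x).
  rewrite ip_sqB // [ip f (fun x => c * g x)]ipC ipZl // (ipC g f).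
  by rewrite ipZl // [ip g (fun x => c * g x)]ipC ipZl //; lra.
have := ip_ge0 g; rewrite le_eqVlt => /orP[/eqP g0|g0].
  have [->|fg0] := eqVneq (ip f g) 0.
    by rewrite expr0n /= mulr_ge0 // ip_ge0.
  (* Here the quadratic in [c] of [H] is affine, and this [c] gives it the value [- ip f f - 2]. *)
  have := H ((ip f f + 1) / ip f g); rewrite -g0.
  by rewrite -(mulrA _ _^-1) mulVf //; have := ip_ge0 f; lra.
have := H (ip f g / ip g g).
have -> : (ip f g / ip g g) ^+ 2 * ip g g = ip f g / ip g g * ip f g.
  by rewrite expr2 -mulrA [_ / _ * ip g g]mulrAC -(mulrA _ (ip g g)) divff ?gt_eqF ?mulr1.
have -> : ip f g / ip g g * ip f g = (ip f g) ^+ 2 / ip g g by ring.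
move=> H1; have : (ip f g) ^+ 2 / ip g g <= ip f f by lra.
by rewrite ler_pdivrMr.
Qed.

Lemma ip_ae_eq f g h : sqi f -> sqi h -> measurable_fun setT g ->
  {ae mu, forall x, f x = g x} -> ip f h = ip g h.
Proof.
move=> sf sh mg fg; apply: int_ae_eq; first exact: sqi_ipi.
  by apply: measurable_funM => //; exact: sqi_meas.
case: fg => N [mN N0 sN]; exists N; split => //.
by move=> x H; apply: sN => e; apply: H => /=; rewrite e.
Qed.

Lemma ip_eq0_ae f : sqi f -> ip f f = 0 -> {ae mu, forall x, f x = 0}.
Proof.
move=> sf f0.
have [] := @int_eq0_ae (fun x => f x * f x).
- exact: sqi_ipi.
- by move=> x; rewrite -expr2 sqr_ge0.
- exact: f0.
move=> N [mN N0 sN]; exists N; split => //.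
move=> x H; apply: sN => /= e; apply: H => /=.
by apply/eqP; move/eqP: e; rewrite mulf_eq0 orbb.
Qed.

End RealL2.

(** * Completeness of the space of square-integrable functions *)

Section RieszFischer.
Context {R : realType}.
Local Notation mu := (@lebesgue_measure R).
Implicit Types f g h : R -> R.

(** The weight [2 ^ n] forces increments of size [2 ^ (- n / 2)], which are summable. A bound of
    this form is what [integ_pos_sum_ae] provides at almost every point. *)
Lemma geo_cauchy_cvg (u : nat -> R) (B : R) :
  (forall n, 2 ^+ n * (u n.+1 - u n) ^+ 2 <= B) -> cvgn u.
Proof.
move=> H.
pose q : R := Num.sqrt (2^-1).
have q0 : 0 <= q by exact: sqrtr_ge0.
have q2 : q ^+ 2 = 2^-1 by rewrite sqr_sqrtr.
have q1 : q < 1.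
  by rewrite -(@ltr_pXn2r _ 2) ?nnegrE ?ler01 ?expr1n // q2 invf_lt1 // ltr1n.
have B0 : 0 <= B.
  by apply: (le_trans _ (H 0%N)); rewrite mulr_ge0 ?sqr_ge0 ?exprn_ge0.
have D n : `|u n.+1 - u n| <= geometric (Num.sqrt B) q n.
  rewrite /geometric /= -(@ler_pXn2r _ 2) ?nnegrE ?mulr_ge0 ?exprn_ge0 ?sqrtr_ge0 //.
  rewrite real_normK ?num_real // exprMn sqr_sqrtr // -exprM mulnC exprM q2.
  by rewrite exprVn ler_pdivlMr ?exprn_gt0 // mulrC.
have C : cvgn (series (fun n => u n.+1 - u n)).
  apply: normed_cvg; apply: (@series_le_cvg _ _ (geometric (Num.sqrt B) q)) => //.
  - by move=> n /=; exact: normr_ge0.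
  - by move=> n; rewrite /geometric /= mulr_ge0 ?exprn_ge0 ?sqrtr_ge0.
  - by apply: is_cvg_geometric_series; rewrite ger0_norm.
have -> : u = (fun n => u 0%N + series (fun n => u n.+1 - u n) n).
  apply/funext => n; rewrite /series /= telescope_sumr //; ring.
by apply: is_cvgD => //; exact: is_cvg_cst.
Qed.

Lemma riesz_fischer (S : nat -> R -> R) :
  (forall n, sqi (S n)) ->
  (forall e, 0 < e -> exists N, forall n m, (N <= n)%N -> (N <= m)%N ->
    ip (fun x => S n x - S m x) (fun x => S n x - S m x) <= e) ->
  exists g, sqi g /\
    ip (fun x => S n x - g x) (fun x => S n x - g x) @[n --> \oo] --> 0.
Proof.
move=> sS cS.
(* The rate [4 ^ - j] for squared norms leaves [2 ^ - j] after the weight [2 ^ j] of [D] below, so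
   the integrals of the [D j] are summable. *)
have [k kP] : exists k : nat -> nat, forall j n m, (k j <= n)%N -> (k j <= m)%N ->
    ip (fun x => S n x - S m x) (fun x => S n x - S m x) <= (4 ^+ j)^-1.
  have H j : {N | forall n m, (N <= n)%N -> (N <= m)%N ->
      ip (fun x => S n x - S m x) (fun x => S n x - S m x) <= (4 ^+ j)^-1}.
    by apply/cid/cS; rewrite invr_gt0 exprn_gt0.
  by exists (fun j => sval (H j)) => j; case: (H j).
(* The running maximum meets all earlier thresholds at once: [k i <= l j] as soon as [i <= j]. *)
pose l j := (\max_(i < j.+1) k i)%N.
have lk i j : (i <= j)%N -> (k i <= l j)%N.
  by rewrite -ltnS => ij; exact: (@leq_bigmax _ (fun i : 'I_j.+1 => k i) (Ordinal ij)).
pose D j x := 2 ^+ j * (S (l j.+1) x - S (l j) x) ^+ 2.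
have iD j : integ (D j).
  apply: integZ; under eq_fun do rewrite expr2.
  by apply: sqi_ipi; apply: sqiB.
have D0 j x : 0 <= D j x by rewrite mulr_ge0 ?sqr_ge0 ?exprn_ge0.
have DB j : int (D j) <= (2 ^+ j)^-1.
  rewrite intZ; last first.
    under eq_fun do rewrite expr2.
    by apply: sqi_ipi; apply: sqiB.
  have := kP j (l j.+1) (l j) (lk _ _ (leqnSn j)) (lk _ _ (leqnn j)).
  rewrite /ip; under [X in int X]eq_fun do rewrite -expr2.
  move=> H; rewrite -ler_pdivlMl ?exprn_gt0 //.
  apply: (le_trans H); rewrite -invfM -exprMn.
  by have -> : 2 * 2 = 4 :> R by ring.
have := integ_pos_sum_ae iD D0 (M := 2) => /(_ _)[].
  move=> n; apply: (@le_trans _ _ (\sum_(i < n) (2 ^+ i)^-1)).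
    by apply: ler_sum => i _; exact: DB.
  have -> : \sum_(i < n) (2 ^+ i)^-1 = 2 - 2 * (2 ^+ n)^-1 :> R.
    elim: n => [|n IH]; first by rewrite big_ord0 expr0 invr1 mulr1 subrr.
    rewrite big_ord_recr /= IH exprS invfM; field.
    by rewrite expf_neq0.
  by rewrite lerBlDr lerDl mulr_ge0 // invr_ge0 exprn_ge0.
move=> N [mN N0 sN].
(* An upper limit is measurable without any convergence; almost everywhere it is the limit. *)
pose g x := fine (limn_esup (fun j => (S (l j) x)%:E)).
have mS n : measurable_fun setT (S n) by exact: sqi_meas.
have mg : measurable_fun setT g.
  apply: measurableT_comp => //.
  apply: (@measurable_fun_limn_esup _ _ R setT (fun j x => (S (l j) x)%:E)).
  by move=> j; apply/measurable_EFinP.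
have Sg : {ae mu, forall x, S (l j) x @[j --> \oo] --> g x}.
  exists N; split => // x H; apply: sN => -[B HB]; apply: H.
  have C := geo_cauchy_cvg HB.
  rewrite /= /g is_cvg_limn_esupE.
    have E : (S (l j) x)%:E @[j --> \oo] --> (limn (fun j => S (l j) x))%:E.
      by apply: cvg_EFin; [exact: nearW|exact: C].
    by rewrite (cvg_lim _ E).
  apply/cvg_ex; exists (limn (fun j => S (l j) x))%:E.
  by apply: cvg_EFin; [exact: nearW|exact: C].
(* Fatou along the subsequence: the Cauchy bound survives the limit, and the integrability of the
   square comes with it. *)
have key i n : (l i <= n)%N ->
    integ (fun x => (S n x - g x) * (S n x - g x)) /\
    ip (fun x => S n x - g x) (fun x => S n x - g x) <= (4 ^+ i)^-1.
  move=> ln; apply: (@int_fatou _ (fun j x => (S n x - S (l j) x) * (S n x - S (l j) x))).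
  - by move=> j; apply: sqi_ipi; apply: sqiB.
  - by apply: measurable_funM; apply: measurable_funB.
  - by move=> j x; rewrite -expr2 sqr_ge0.
  - by move=> x; rewrite -expr2 sqr_ge0.
  - case: Sg => N' [mN' N'0 sN']; exists N'; split => // x H; apply: sN' => C.
    by apply: H; apply: cvgM; apply: cvgB => //; exact: cvg_cst.
  - exists i => // j /= ij; apply: kP; first exact: leq_trans (lk i i (leqnn i)) ln.
    exact: lk.
have sg : sqi g.
  have [I0 _] := key 0%N (l 0%N) (leqnn _).
  have : sqi (fun x => S (l 0%N) x - g x).
    by split => //; exact: measurable_funB.
  move/(sqiB (sS (l 0%N))); under eq_fun do rewrite subKr.
  by [].
exists g; split => //.
apply/cvgrPdist_le => e e0.
have C : (4^-1 : R) ^+ i @[i --> \oo] --> 0.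
  by apply: cvg_expr; rewrite ger0_norm ?invr_ge0 // invf_lt1 // ltr1n.
have [i _ iP] := (@cvgrPdist_le _ _ _ _ _ _ _).1 C e e0.
exists (l i) => // n /= ln; rewrite sub0r normrN ger0_norm ?ip_ge0 //.
apply: (le_trans (key i n ln).2); have := iP i (leqnn i).
by rewrite sub0r normrN -exprVn; apply: le_trans; exact: ler_norm.
Qed.
End RieszFischer.

(** * Hermite functions *)

Section Decay.
Context {R : realType}.
Local Notation mu := (@lebesgue_measure R).
Implicit Types (f g h F : R -> R) (p q : {poly R}).

Lemma integ_oneDsqrV : integ (fun x : R => (oneDsqr x)^-1).
Proof.
have mV : measurable_fun setT (fun x : R => (oneDsqr x)^-1).
  exact: (continuous_measurable_fun continuous_oneDsqrV).
have V0 (x : R) : 0 <= (oneDsqr x)^-1.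
  by rewrite invr_ge0 (le_trans ler01) // oneDsqr_ge1.
apply/integrableP; split; first exact/measurable_EFinP.
under eq_integral => x _ do rewrite gee0_abs ?lee_fin //.
rewrite ge0_symfun_integralT //=.
- rewrite (_ : [set x | _] = `[0, +oo[%classic); last first.
    by apply/seteqP; split => x/=; rewrite in_itv/= andbT.
  by rewrite integral0y_oneDsqr -EFinM ltry.
- exact: continuous_oneDsqrV.
- by move=> x /=; rewrite /oneDsqr sqrrN.
Qed.

(** Decay of order [1 / (1 + x ^ 2)] is enough for integrability, square-integrability and vanishing
    boundary terms, and it is kept by products. *)
Definition dec h : Prop := measurable_fun setT h /\
  exists C, forall x, `|h x| * (1 + x ^+ 2) <= C.

Lemma oneD_gt0 (x : R) : 0 < 1 + x ^+ 2.
Proof. by rewrite ltr_pwDl // sqr_ge0. Qed.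

Lemma dec_integ h : dec h -> integ h.
Proof.
move=> [mh [C hC]]; apply: (integ_le mh _ (integZ C integ_oneDsqrV)) => x.
by rewrite ler_pdivlMr ?oneD_gt0 // hC.
Qed.

Lemma dec_bounded h : dec h -> exists C, forall x, `|h x| <= C.
Proof.
move=> [_ [C hC]]; exists C => x; apply: le_trans (hC x).
by rewrite ler_peMr // lerDl sqr_ge0.
Qed.

Lemma dec_bM f h B : measurable_fun setT f -> (forall x, `|f x| <= B) ->
  dec h -> dec (fun x => f x * h x).
Proof.
move=> mf fB [mh [C hC]]; split; first exact: measurable_funM.
exists (B * C) => x; rewrite normrM -mulrA ler_pM // mulr_ge0 //.
exact/ltW/oneD_gt0.
Qed.

Lemma dec_M f h : dec f -> dec h -> dec (fun x => f x * h x).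
Proof.
by move=> [mf df]; have [B fB] := dec_bounded (conj mf df); exact: dec_bM fB.
Qed.

Lemma dec_sqi h : dec h -> sqi h.
Proof. by move=> dh; split; [case: dh|exact/dec_integ/dec_M]. Qed.

Lemma decZ c h : dec h -> dec (fun x => c * h x).
Proof. by apply: (@dec_bM (fun=> c) h `|c|). Qed.

(** Fundamental theorem of calculus on growing intervals, whose boundary values vanish by decay.
    Every integration by parts below is this lemma applied to a product. *)
Lemma int_derive0 F f : continuous f -> (forall x : R, is_derive x 1 F (f x)) ->
  dec F -> integ f -> int f = 0.
Proof.
move=> cf dF [mF [C FC]] If.
pose fn n x := f x * \1_(`[- n.+1%:R, n.+1%:R]%classic) x.
have mf : measurable_fun setT f by exact: integ_meas.
have m1 n : measurable_fun setT (\1_(`[- n.+1%:R, n.+1%:R]%classic) : R -> R).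
  exact: measurable_indic.
have [_] : integ f /\ int (fn n) @[n --> \oo] --> int f.
  apply: (@int_dct _ fn f (fun x => `|f x|)) => //.
  - by move=> n; apply: measurable_funM.
  - move=> x; apply/cvgrPdist_le => e e0; near=> n.
    rewrite /fn indicE mem_set ?mulr1 ?subrr ?normr0 ?ltW //=.
    rewrite in_itv /=; apply/andP.
    have : `|x| <= n.+1%:R.
      apply: (@le_trans _ _ n%:R); last by rewrite ler_nat.
      by near: n; exact: nbhs_infty_ger.
    by rewrite ler_norml => /andP.
  - exact: integ_norm.
  - move=> n x; rewrite /fn normrM ler_piMr // indicE.
    by case: (_ \in _); rewrite ?normr1 ?normr0.
have En n : int (fn n) = F n.+1%:R - F (- n.+1%:R).
  have lt : - n.+1%:R < n.+1%:R :> R by rewrite -subr_gt0 opprK -natrD ltr0n.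
  have cF : continuous F.
    move=> x; apply: differentiable_continuous; apply/derivable1_diffP.
    by have [] := dF x.
  have H1 : {within `[- n.+1%:R, n.+1%:R], continuous f}.
    by apply: continuous_subspaceT => x; exact: cf.
  have H2 : derivable_oo_LRcontinuous F (- n.+1%:R) n.+1%:R.
    split.
    - by move=> x _; have [] := dF x.
    - exact: cvg_at_right_filter (cF _).
    - exact: cvg_at_left_filter (cF _).
  have H3 : {in `]- n.+1%:R, n.+1%:R[, F^`()%classic =1 f}.
    by move=> x _; rewrite derive1E; have [_ ->] := dF x.
  have H := continuous_FTC2 lt H1 H2 H3.
  have -> : int (fn n) = Rintegral mu `[- n.+1%:R, n.+1%:R] f.
    rewrite (Rintegral_mkcond mu `[- n.+1%:R, n.+1%:R] f) /int; congr Rintegral.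
    apply/funext => x; rewrite /fn patchE indicE.
    by case: (_ \in _); rewrite ?mulr1 ?mulr0.
  by rewrite /Rintegral H -EFinB.
have F0 : int (fn n) @[n --> \oo] --> (0 : R).
  rewrite (_ : (fun n => _) = (fun n => F n.+1%:R - F (- n.+1%:R))); last first.
    by apply/funext => n; rewrite En.
  have C0 : 0 <= C by apply: (le_trans _ (FC 0)); rewrite mulr_ge0 // ltW ?oneD_gt0.
  have B (y : R) n : n.+1%:R <= `|y| -> `|F y| <= C * n.+1%:R^-1.
    move=> ny; rewrite ler_pdivlMr //; apply: (le_trans _ (FC y)).
    rewrite ler_wpM2l // (le_trans ny) //.
    by have := sqr_ge0 (`|y| - 1); rewrite -(real_normK (num_real y)); nra.
  apply/cvgr0Pnorm_le => e e0; near=> n.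
  apply: (@le_trans _ _ (C * n.+1%:R^-1 + C * n.+1%:R^-1)).
    apply: (le_trans (ler_normB _ _)); apply: lerD; apply: B.
      exact: ler_norm.
    by rewrite normrN ler_norm.
  rewrite -mulrDl ler_pdivrMr // mulrC -ler_pdivrMr //.
  apply: (@le_trans _ _ n%:R); last by rewrite ler_nat.
  by near: n; exact: nbhs_infty_ger.
by move=> H; apply: (cvg_unique _ H F0).
Unshelve. all: by end_near. Qed.

End Decay.

(** * Polynomials times Gaussians *)

Section PolyGauss.
Context {R : realType}.
Local Notation mu := (@lebesgue_measure R).
Implicit Types (f h F : R -> R) (p q : {poly R}) (b c d g x : R).

Lemma poly_expR_bound p : exists C k, [/\ 0 <= C, 0 <= k &
  forall x, `|p.[x]| <= C * expR (k * `|x|)].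
Proof.
elim/poly_ind: p => [|p c [C [k [C0 k0 H]]]].
  by exists 0, 0; split => // x; rewrite horner0 normr0 mul0r.
exists (C + `|c|), (k + 1); split; rewrite ?addr_ge0 // => x.
rewrite !hornerE mulrDl; apply: (le_trans (ler_normD _ _)); apply: lerD.
  rewrite normrM mulrDl mul1r expRD mulrA ler_pM //.
  by apply: (le_trans _ (expR_ge1Dx _)); rewrite lerDr.
by rewrite ler_peMr // -expR0 ler_expR mulr_ge0 ?addr_ge0.
Qed.

Lemma poly_gauss_bound p b d : 0 < b -> exists C, 0 <= C /\
  forall x, `|p.[x]| * expR (- b * x ^+ 2 + d * `|x|) <= C.
Proof.
move=> b0; have [C [k [C0 k0 H]]] := poly_expR_bound p.
(* The exponent is the maximum over [r] of [(k + d) r - b r ^ 2]. *)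
exists (C * expR ((k + d) ^+ 2 / (4 * b))); split.
  by rewrite mulr_ge0 // expR_ge0.
move=> x; apply: (@le_trans _ _ (C * expR (k * `|x|) * expR (- b * x ^+ 2 + d * `|x|))).
  by rewrite ler_wpM2r // expR_ge0.
rewrite -mulrA ler_wpM2l // -expRD ler_expR.
rewrite -(real_normK (num_real x)) ler_pdivlMr ?mulr_gt0 //.
by have := sqr_ge0 (2 * b * `|x| - (k + d)); nra.
Qed.

Lemma continuous_poly_gauss p b d g :
  continuous (fun x : R => p.[x - g] * expR (- b * (x - g) ^+ 2 + d * (x - g))).
Proof.
move=> x; apply: cvgM.
  apply: (@cvg_comp _ _ _ (fun x => x - g) (fun x => p.[x])).
    by apply: cvgB; [exact: cvg_id|exact: cvg_cst].
  exact: continuous_horner.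
apply: (@cvg_comp _ _ _ (fun x => - b * (x - g) ^+ 2 + d * (x - g)) expR); last first.
  exact: continuous_expR.
pose q : {poly R} := (- b)%:P * ('X - g%:P) ^+ 2 + d%:P * ('X - g%:P).
have -> : (fun x => - b * (x - g) ^+ 2 + d * (x - g)) = (fun x => q.[x]).
  by apply/funext => y; rewrite /q !hornerE.
have -> : - b * (x - g) ^+ 2 + d * (x - g) = q.[x] by rewrite /q !hornerE.
exact: continuous_horner.
Qed.

Lemma dec_poly_gauss p b d g : 0 < b ->
  dec (fun x => p.[x - g] * expR (- b * (x - g) ^+ 2 + d * (x - g))).
Proof.
move=> b0; split.
  apply: continuous_measurable_fun; exact: continuous_poly_gauss.
have [C [C0 HC]] := poly_gauss_bound (p * (1 + ('X + g%:P) ^+ 2)) `|d| b0.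
exists C => x; have := HC (x - g).
rewrite !hornerE subrK normrM [`|1 + _|]ger0_norm; last exact/ltW/oneD_gt0.
apply: le_trans; rewrite normrM -!mulrA ler_wpM2l // mulrC ler_wpM2l //.
  exact/ltW/oneD_gt0.
rewrite ger0_norm ?expR_ge0 // ler_expR lerD2l -normrM.
exact: ler_norm.
Qed.

(** The centre [g] is kept free because the flow translates the Hermite basis. For fixed [g] the
    family is stable under differentiation and under multiplication by [x - g]. *)
Definition gpoly g p : R -> R := fun x => p.[x - g] * expR (- (x - g) ^+ 2 / 2).

Lemma gpolyE g p : gpoly g p =
  fun x => p.[x - g] * expR (- 2^-1 * (x - g) ^+ 2 + 0 * (x - g)).
Proof. by apply/funext => x; rewrite /gpoly; congr (_ * expR _); field. Qed.

Lemma continuous_gpoly g p : continuous (gpoly g p).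
Proof. by rewrite gpolyE; exact: continuous_poly_gauss. Qed.

Lemma dec_gpoly g p : dec (gpoly g p).
Proof. by rewrite gpolyE; apply: dec_poly_gauss; rewrite invr_gt0. Qed.

Lemma sqi_gpoly g p : sqi (gpoly g p).
Proof. exact/dec_sqi/dec_gpoly. Qed.

Lemma is_derive_gpoly g p x : is_derive x 1 (gpoly g p) (gpoly g (deriv p - 'X * p) x).
Proof.
have d1 : is_derive x 1 (fun y : R => y - g) 1.
  by apply: is_derive_eq; rewrite subr0.
have dp : is_derive x 1 (fun y => p.[y - g]) ((deriv p).[x - g]).
  have -> : (fun y => p.[y - g]) = horner (p \Po ('X - g%:P)).
    by apply/funext => y; rewrite horner_comp !hornerE.
  apply: is_derive_eq.
  by rewrite deriv_comp !hornerE horner_comp !hornerE derivB derivX derivC subr0 hornerC mulr1.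
have de : is_derive x 1 (fun y => expR (- (y - g) ^+ 2 / 2))
    (expR (- (x - g) ^+ 2 / 2) * - (x - g)).
  have dq : is_derive x 1 (fun y : R => - (y - g) ^+ 2 / 2) (- (x - g)).
    have -> : (fun y => - (y - g) ^+ 2 / 2) = horner (- 2^-1 *: ('X - g%:P) ^+ 2).
      by apply/funext => y; rewrite hornerZ horner_exp hornerXsubC; field.
    apply: is_derive_eq.
    by rewrite derivZ expr2 derivM derivB derivX derivC !hornerE; field.
  exact: (is_derive1_comp (is_derive_expR _) dq).
rewrite /gpoly; apply: is_derive_eq.
by rewrite /GRing.scale /= hornerD hornerN hornerM hornerX; ring.
Qed.

Lemma gpolyD g p q x : gpoly g (p + q) x = gpoly g p x + gpoly g q x.
Proof. by rewrite /gpoly hornerD mulrDl. Qed.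
Lemma gpolyZ g c p x : gpoly g (c *: p) x = c * gpoly g p x.
Proof. by rewrite /gpoly hornerZ mulrA. Qed.

End PolyGauss.

(** * Ladder relations and orthonormality *)

Section HermiteBasis.
Context {R : realType}.
Local Notation mu := (@lebesgue_measure R).
Implicit Types (p q : {poly R}) (g x : R) (n m : nat).

(** Off-diagonal entries of [x] and [d/dx] in the Hermite basis, as [mulX_hg] and [is_derive_hg]
    show. *)
Definition Bc n : R := Num.sqrt (n%:R / 2).

Lemma Bc0 : Bc 0 = 0. Proof. by rewrite /Bc mul0r sqrtr0. Qed.
Lemma Bc_ge0 n : 0 <= Bc n. Proof. exact: sqrtr_ge0. Qed.
Lemma Bc_sq n : Bc n ^+ 2 = n%:R / 2.
Proof. by rewrite sqr_sqrtr // divr_ge0. Qed.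
Lemma BcS_gt0 n : 0 < Bc n.+1.
Proof. by rewrite sqrtr_gt0 divr_gt0. Qed.

Definition hnc n : R := Num.sqrt (2 ^+ n * n`!%:R * Num.sqrt pi).

Lemma hnc_gt0 n : 0 < hnc n.
Proof.
by rewrite sqrtr_gt0 !mulr_gt0 ?exprn_gt0 ?ltr0n ?fact_gt0 // sqrtr_gt0 pi_gt0.
Qed.

Lemma hncS n : hnc n.+1 = hnc n * (2 * Bc n.+1).
Proof.
have -> : 2 * Bc n.+1 = Num.sqrt (2 * n.+1%:R).
  rewrite -[2 * Bc _]ger0_norm ?mulr_ge0 ?Bc_ge0 // -sqrtr_sqr exprMn Bc_sq.
  by congr Num.sqrt; field.
rewrite /hnc -sqrtrM; last by rewrite !mulr_ge0 ?exprn_ge0 ?sqrtr_ge0.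
by congr Num.sqrt; rewrite factS natrM exprS; ring.
Qed.

Definition hpoly n : {poly R} := (hnc n)^-1 *: hermite_poly n.

Lemma mulX_hpoly n :
  'X * hpoly n = Bc n.+1 *: hpoly n.+1 + Bc n *: hpoly n.-1.
Proof.
have h0 := lt0r_neq0 (hnc_gt0 n); have b0 := lt0r_neq0 (BcS_gt0 n).
have E : Bc n.+1 *: hpoly n.+1 = (2 * hnc n)^-1 *: hermite_poly n.+1.
  by rewrite /hpoly scalerA hncS; congr (_ *: _); field; rewrite h0.
rewrite E hermite_polyS /hpoly -!scalerAr.
have -> : Bc n *: ((hnc n.-1)^-1 *: hermite_poly n.-1) =
    (2 * hnc n)^-1 *: deriv (hermite_poly n).
  case: n h0 {b0 E} => [|n] h0; first by rewrite Bc0 scale0r /= -polyC1 derivC scaler0.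
  rewrite deriv_hermite_poly mul_polyC !scalerA; congr (_ *: _) => /=.
  have := lt0r_neq0 (hnc_gt0 n); have b0 := lt0r_neq0 (BcS_gt0 n) => h1.
  have -> : n.+1%:R = 2 * Bc n.+1 ^+ 2 by rewrite Bc_sq; field.
  by rewrite hncS; field; rewrite h1 b0.
rewrite -scalerDr subrK -mulrA mul_polyC scalerA; congr (_ *: _).
by field.
Qed.

(** The left-hand side is the polynomial factor of the derivative of [gpoly g (hpoly n)]. *)
Lemma deriv_hpoly n :
  deriv (hpoly n) - 'X * hpoly n = Bc n *: hpoly n.-1 - Bc n.+1 *: hpoly n.+1.
Proof.
have -> : deriv (hpoly n) = (2 * Bc n) *: hpoly n.-1.
  case: n => [|n]; first by rewrite Bc0 mulr0 scale0r /hpoly /= derivZ -polyC1 derivC scaler0.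
  rewrite /hpoly derivZ deriv_hermite_poly mul_polyC !scalerA; congr (_ *: _) => /=.
  have := lt0r_neq0 (hnc_gt0 n); have b0 := lt0r_neq0 (BcS_gt0 n) => h1.
  have -> : n.+1%:R = 2 * Bc n.+1 ^+ 2 by rewrite Bc_sq; field.
  by rewrite hncS; field; rewrite h1 b0.
rewrite mulX_hpoly mulr_natl mulr2n scalerDl; ring.
Qed.

Definition hg g n : R -> R := gpoly g (hpoly n).

Lemma hermiteE g n x : hermite n (x - g) = hg g n x.
Proof. by rewrite /hg /gpoly /hermite /hpoly hornerZ mulNr -/(hnc n); ring. Qed.

Lemma hermite_hg0 n : hermite n = hg 0 n.
Proof. by apply/funext => x; rewrite -hermiteE subr0. Qed.

Lemma mulX_hg g n x :
  (x - g) * hg g n x = Bc n.+1 * hg g n.+1 x + Bc n * hg g n.-1 x.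
Proof.
transitivity (gpoly g ('X * hpoly n) x).
  by rewrite /hg /gpoly hornerM hornerX mulrA.
by rewrite mulX_hpoly gpolyD (gpolyZ _ (Bc n.+1)) (gpolyZ _ (Bc n)).
Qed.

Lemma is_derive_hg g n x :
  is_derive x 1 (hg g n) (Bc n * hg g n.-1 x - Bc n.+1 * hg g n.+1 x).
Proof.
have := is_derive_gpoly g (hpoly n) x.
by rewrite deriv_hpoly gpolyD -scaleNr (gpolyZ _ (Bc n)) (gpolyZ _ (- Bc n.+1)) mulNr.
Qed.

Lemma sqi_hg g n : sqi (hg g n). Proof. exact: sqi_gpoly. Qed.
Lemma dec_hg g n : dec (hg g n). Proof. exact: dec_gpoly. Qed.

(** The weight [exp (- x ^ 2)] is the one carried by a product of two [gpoly]; scalar products thus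
    reduce to algebra on polynomials. *)
Definition gint g p : R := int (fun x => p.[x - g] * expR (- (x - g) ^+ 2)).

Lemma gintE g p : (fun x => p.[x - g] * expR (- (x - g) ^+ 2)) =
  (fun x => p.[x - g] * expR (- 1 * (x - g) ^+ 2 + 0 * (x - g))).
Proof. by apply/funext => x; congr (_ * expR _); ring. Qed.

Lemma gint_dec g p : dec (fun x => p.[x - g] * expR (- (x - g) ^+ 2)).
Proof. by rewrite gintE; exact: dec_poly_gauss. Qed.

Lemma gintD g p q : gint g (p + q) = gint g p + gint g q.
Proof.
rewrite /gint -intD; try exact/dec_integ/gint_dec.
by congr int; apply/funext => x; rewrite hornerD mulrDl.
Qed.

Lemma gintZ g c p : gint g (c *: p) = c * gint g p.
Proof.
rewrite /gint -intZ; last exact/dec_integ/gint_dec.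
by congr int; apply/funext => x; rewrite hornerZ mulrA.
Qed.

Lemma gpolyM g p q x : gpoly g p x * gpoly g q x = (p * q).[x - g] * expR (- (x - g) ^+ 2).
Proof.
by rewrite /gpoly hornerM mulrACA -expRD; congr (_ * expR _); field.
Qed.

Lemma gint_deriv g p : gint g (deriv p - 2%:P * 'X * p) = 0.
Proof.
apply: (@int_derive0 _ (fun x => gpoly g p x * gpoly g 1 x)).
- by rewrite gintE; exact: continuous_poly_gauss.
- move=> x; have d1 := is_derive_gpoly g p x.
  have d2 := is_derive_gpoly g 1 x.
  apply: is_derive_eq; rewrite /GRing.scale /= !gpolyM addrC.
  rewrite -mulrDl -hornerD; congr (_.[_] * _).
  by rewrite -polyC1 derivC; ring.
- under eq_fun do rewrite gpolyM; exact: gint_dec.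
- exact/dec_integ/gint_dec.
Qed.

(** For this weight, raising a Hermite polynomial is adjoint to differentiation. Iterating gives
    both the orthogonality and the norms. *)
Lemma gint_hermite g n p :
  gint g (hermite_poly n.+1 * p) = gint g (hermite_poly n * deriv p).
Proof.
have := gint_deriv g (hermite_poly n * p).
have -> : deriv (hermite_poly n * p) - 2%:P * 'X * (hermite_poly n * p) =
   (hermite_poly n * deriv p) + (- 1) *: (hermite_poly n.+1 * p).
  by rewrite hermite_polyS derivM scaleN1r; ring.
by rewrite gintD gintZ mulN1r => /eqP; rewrite subr_eq0 => /eqP.
Qed.

Lemma gint1 g : gint g 1 = Num.sqrt pi.
Proof.
(* Variance 1/2: the normal density is then [exp (- (x - g) ^ 2) / sqrt pi]. *)
pose s : R := Num.sqrt (2^-1).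
have s2 : s ^+ 2 = 2^-1 by rewrite sqr_sqrtr.
have s0 : s != 0 by rewrite gt_eqF // sqrtr_gt0.
have sp0 : 0 < Num.sqrt (pi : R) by rewrite sqrtr_gt0 pi_gt0.
have E : (fun x => normal_pdf g s x) =
    (fun x => (Num.sqrt pi)^-1 * ((1 : {poly R}).[x - g] * expR (- (x - g) ^+ 2))).
  apply/funext => x; rewrite normal_pdfE // /normal_peak /normal_fun s2.
  have -> : 2^-1 * pi *+ 2 = pi :> R by rewrite -mulr_natr; field.
  have -> : 2^-1 *+ 2 = 1 :> R by rewrite -mulr_natr; field.
  by rewrite divr1 hornerC mul1r.
have : int (fun x => normal_pdf g s x) = 1.
  by rewrite /int /Rintegral integral_normal_pdf.
rewrite E intZ; last exact/dec_integ/gint_dec.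
by move=> H; rewrite /gint -[RHS]mulr1 -H mulrA mulfV ?mul1r // gt_eqF.
Qed.

Lemma gint_hermiteM g n m :
  gint g (hermite_poly n * hermite_poly m) = (n == m)%:R * hnc n ^+ 2.
Proof.
elim: n m => [|n IH] m.
  case: m => [|m].
    by rewrite mul1r gint1 eqxx mul1r sqr_sqrtr ?expr0 ?fact0 ?mul1r.
  by rewrite mulrC gint_hermite /= -polyC1 derivC mulr0 mul0r -(scale0r 0) gintZ mul0r.
case: m => [|m].
  by rewrite gint_hermite /= -polyC1 derivC mulr0 mul0r -(scale0r 0) gintZ mul0r.
rewrite gint_hermite deriv_hermite_poly mul_polyC -scalerAr gintZ IH eqSS.
case: (n =P m) => [<-|_]; last by rewrite !mul0r mulr0.
by rewrite !mul1r hncS !exprMn Bc_sq; field.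
Qed.

Lemma hg_orthonormal g n m : ip (hg g n) (hg g m) = (n == m)%:R.
Proof.
have -> : ip (hg g n) (hg g m) = gint g (hpoly n * hpoly m).
  by rewrite /ip /gint; congr int; apply/funext => x; rewrite gpolyM.
rewrite /hpoly -scalerAl -scalerAr scalerA gintZ gint_hermiteM.
case: (n =P m) => [<-|_]; last by rewrite mul0r mulr0.
by have := lt0r_neq0 (hnc_gt0 n) => h; field.
Qed.

End HermiteBasis.

(** * Completeness of the Hermite functions *)

Section Completeness.
Context {R : realType}.
Local Notation mu := (@lebesgue_measure R).
Implicit Types (f w q : R -> R) (p : {poly R}) (g a b c d r x : R).

(* Expanding the exponential in moments; dominated by [|w| exp |q|]. *)
Lemma int_exp_series w q : measurable_fun setT w -> measurable_fun setT q ->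
  integ (fun x => `|w x| * expR `|q x|) ->
  (forall m, int (fun x => w x * q x ^+ m) = 0) ->
  int (fun x => w x * expR (q x)) = 0.
Proof.
move=> mw mq Iw H.
have iwq m : integ (fun x => w x * q x ^+ m).
  apply: (integ_le _ _ (integZ (m`!%:R) Iw)).
    by apply: measurable_funM => //; exact: measurable_funX.
  move=> x; rewrite normrM normrX mulrCA ler_wpM2l //.
  have := exp_coeff_ge0 m (normr_ge0 (q x)).
  have : exp_coeff `|q x| m <= expR `|q x|.
    apply: (le_trans _ (nondecreasing_cvgn_le _ _ m.+1)); last 2 first.
    - apply/nondecreasing_seqP => n; rewrite seriesSr lerDl.
      exact: exp_coeff_ge0.
    - exact: is_cvg_series_exp_coeff.
    rewrite seriesSr lerDr; apply: sumr_ge0 => i _; exact: exp_coeff_ge0.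
  by rewrite /exp_coeff /= ler_pdivrMr ?ltr0n ?fact_gt0 // mulrC.
pose F n x := w x * series (exp_coeff (q x)) n.
have mF n : measurable_fun setT (F n).
  apply: measurable_funM => //.
  rewrite /series /=; apply: measurable_sum => i.
  by apply: measurable_funM => //; exact: measurable_funX.
have mE : measurable_fun setT (fun x => w x * expR (q x)).
  by apply: measurable_funM => //; exact: measurableT_comp.
have [_] : integ (fun x => w x * expR (q x)) /\
    int (F n) @[n --> \oo] --> int (fun x => w x * expR (q x)).
  apply: int_dct Iw _ => //.
  - move=> x; apply: cvgM; first exact: cvg_cst.
    exact: is_cvg_series_exp_coeff.
  - move=> n x; rewrite /F normrM ler_wpM2l //.
    apply: (le_trans (ler_norm_sum _ _ _)).
    rewrite (_ : \sum_(0 <= i < n) _ = [normed series (exp_coeff (q x))] n) //.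
    rewrite normed_series_exp_coeff.
    apply: nondecreasing_cvgn_le; last exact: is_cvg_series_exp_coeff.
    apply/nondecreasing_seqP => k; rewrite seriesSr lerDl.
    exact: exp_coeff_ge0.
have -> : (fun n => int (F n)) = (fun=> 0).
  apply/funext => n; rewrite /F /series /=.
  transitivity (\sum_(0 <= i < n) int (fun x => (i`!%:R)^-1 * (w x * q x ^+ i))).
    rewrite -int_sum; last by move=> i; exact: integZ.
    congr int; apply/funext => x; rewrite mulr_sumr; apply: eq_bigr => i _.
    by rewrite /exp_coeff /= mulrCA mulrC mulrCA mulrA mulrC mulrCA.
  by rewrite big1 // => i _; rewrite intZ // H mulr0.
by move/cvg_lim => <- //; rewrite lim_cst.
Qed.

Section Orthogonal.
Variables (f : R -> R) (g : R).
Hypothesis sf : sqi f.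

Definition ortho_gauss b := forall p,
  int (fun x => f x * (p.[x - g] * expR (- b * (x - g) ^+ 2))) = 0.

Lemma sqi_poly_gauss p b d : 0 < b ->
  sqi (fun x => p.[x - g] * expR (- b * (x - g) ^+ 2 + d * (x - g))).
Proof. by move=> b0; exact/dec_sqi/dec_poly_gauss. Qed.

(** The extra exponential is expanded in powers of [Q]; each power is absorbed into the polynomial,
    so that all moments vanish by [Ob]. The rate [b - c > 0] that remains provides the domination
    required by [int_exp_series]. *)
Lemma ortho_gauss_shift b c d p : ortho_gauss b -> 0 <= c -> c < b ->
  int (fun x => f x * (p.[x - g] *
    expR (- (b + c) * (x - g) ^+ 2 + d * (x - g)))) = 0.
Proof.
move=> Ob c0 cb.
pose w x := f x * (p.[x - g] * expR (- b * (x - g) ^+ 2)).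
pose Q := (- c)%:P * 'X ^+ 2 + d%:P * 'X : {poly R}.
have QE y : Q.[y] = - c * y ^+ 2 + d * y.
  by rewrite hornerD (hornerM (- c)%:P) (hornerM d%:P) !hornerC hornerX hornerXn.
have mf := sqi_meas sf.
have mw : measurable_fun setT w.
  apply: measurable_funM => //; apply: continuous_measurable_fun.
  have := @continuous_poly_gauss R p b 0 g.
  by under eq_fun do rewrite mul0r addr0.
have mQ : measurable_fun setT (fun x => Q.[x - g]).
  apply: continuous_measurable_fun => x.
  apply: (@cvg_comp _ _ _ (fun x => x - g) (fun x => Q.[x])).
    by apply: cvgB; [exact: cvg_id|exact: cvg_cst].
  exact: continuous_horner.
have := @int_exp_series w (fun x => Q.[x - g]) mw mQ.
have -> : (fun x => w x * expR Q.[x - g]) = (fun x => f x * (p.[x - g] *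
    expR (- (b + c) * (x - g) ^+ 2 + d * (x - g)))).
  apply/funext => x; rewrite /w -!mulrA -expRD; congr (_ * (_ * expR _)).
  by rewrite QE; ring.
apply.
- have bc0 : 0 < b - c by rewrite subr_gt0.
  (* The sign of [d (x - g)] is unknown: [exp |d (x - g)|] is dominated by the sum of the
     exponentials for [d] and for [- d]. *)
  apply: (@integ_le _ _ (fun x => `|f x| *
    (`|p.[x - g] * expR (- (b - c) * (x - g) ^+ 2 + d * (x - g))| +
     `|p.[x - g] * expR (- (b - c) * (x - g) ^+ 2 + (- d) * (x - g))|))).
  + apply: measurable_funM; apply: measurableT_comp => //.
    by apply: measurableT_comp => //; exact: measurableT_comp.
  + move=> x; rewrite ger0_norm ?mulr_ge0 ?expR_ge0 // /w.
    rewrite normrM -mulrA ler_wpM2l // !normrM -mulrDr -mulrA ler_wpM2l //.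
    rewrite !(ger0_norm (expR_ge0 _)) -expRD.
    set y := x - g.
    have [h|h] := leP 0 (d * y).
      apply: (@le_trans _ _ (expR (- (b - c) * y ^+ 2 + d * y))); last first.
        by rewrite lerDl expR_ge0.
      rewrite ler_expR; apply: (@le_trans _ _ (- b * y ^+ 2 + (c * y ^+ 2 + d * y))).
        rewrite lerD2l; apply: (le_trans _ (_ : `|- c * y ^+ 2| + `|d * y| <= _)).
          by rewrite QE; exact: ler_normD.
        by rewrite (ger0_norm h) mulNr normrN ger0_norm // mulr_ge0 ?sqr_ge0.
      by rewrite le_eqVlt; apply/orP; left; apply/eqP; ring.
    apply: (@le_trans _ _ (expR (- (b - c) * y ^+ 2 + - d * y))); last first.
      by rewrite lerDr expR_ge0.
    rewrite ler_expR; apply: (@le_trans _ _ (- b * y ^+ 2 + (c * y ^+ 2 - d * y))).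
      rewrite lerD2l; apply: (le_trans _ (_ : `|- c * y ^+ 2| + `|d * y| <= _)).
        by rewrite QE; exact: ler_normD.
      by rewrite (ltr0_norm h) mulNr normrN ger0_norm // mulr_ge0 ?sqr_ge0.
    by rewrite le_eqVlt; apply/orP; left; apply/eqP; ring.
  + under eq_fun do rewrite mulrDr -!normrM.
    by apply: integD; apply/integ_norm/sqi_ipi => //; exact: sqi_poly_gauss.
- move=> m; rewrite -[RHS](Ob (p * Q ^+ m)); congr int; apply/funext => x.
  by rewrite /w hornerM horner_exp; ring.
Qed.

(* The exponential series of exp (- c y ^ 2) is absolutely integrable against
   the weight exp (- b y ^ 2) only when c < b: b has to be increased in steps. *)
Lemma ortho_gauss_all : ortho_gauss 2^-1 -> forall b, 2^-1 <= b -> ortho_gauss b.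
Proof.
move=> O1 b b1.
have step b' c : ortho_gauss b' -> 0 <= c -> c < b' -> ortho_gauss (b' + c).
  move=> O c0 cb p; have := ortho_gauss_shift 0 p O c0 cb.
  by under [X in int X]eq_fun do rewrite mul0r addr0.
(* The rate never drops below 1/2, so increments of at most 1/4 always satisfy [c < b']. *)
suff H n b' : 2^-1 <= b' -> b' <= 2^-1 + n%:R / 4 -> ortho_gauss b'.
  pose n := (Num.truncn (4 * b)).+1.
  apply: (H n) => //; rewrite -[leLHS]add0r lerD // ler_pdivlMr // mulrC.
  by apply/ltW; rewrite truncnS_gt.
elim: n b' => [|n IH] b' h1 h2.
  have -> : b' = 2^-1 by apply/eqP; rewrite eq_le h1 andbT; lra.
  exact: O1.
have [h3|h3] := leP b' (2^-1 + 1 / 4).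
  have -> : b' = 2^-1 + (b' - 2^-1) by ring.
  by apply: step => //; lra.
have -> : b' = (b' - 1 / 4) + 1 / 4 by ring.
apply: step; [|lra|lra].
by apply: IH; [lra|move: h2; rewrite -natr1; lra].
Qed.

Lemma ortho_exp : ortho_gauss 2^-1 -> forall b d, 2^-1 <= b ->
  int (fun x => f x * expR (- b * (x - g) ^+ 2 + d * (x - g))) = 0.
Proof.
move=> O1 b d b1.
have b0 : 0 < b by apply: lt_le_trans b1; rewrite invr_gt0.
have := ortho_gauss_shift d 1 (ortho_gauss_all O1 b1) (lexx 0) b0.
by under [X in int X]eq_fun do rewrite hornerC mul1r addr0.
Qed.

(** Multiplication by [exp (- C (x - a) ^ 2)] only changes [b], [d] and a constant factor. The
    weights of [ortho_exp] are thus stable under it, and the power is expanded one factor at a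
    time. *)
Lemma ortho_exp_pow (C a : R) K : ortho_gauss 2^-1 -> 0 <= C -> forall b d, 2^-1 <= b ->
  int (fun x => f x * expR (- b * (x - g) ^+ 2 + d * (x - g)) *
     (1 - expR (- C * (x - a) ^+ 2)) ^+ K) = 0.
Proof.
move=> O1 C0.
have mE : continuous (fun x : R => 1 - expR (- C * (x - a) ^+ 2)).
  move=> x; apply: cvgB; first exact: cvg_cst.
  have := @continuous_poly_gauss R 1 C 0 a.
  under eq_fun do rewrite hornerC mul1r mul0r addr0.
  exact.
have E1 x : `|1 - expR (- C * (x - a) ^+ 2)| <= 1.
  rewrite ger0_norm; first by rewrite lerBlDr lerDl expR_ge0.
  by rewrite subr_ge0 -expR0 ler_expR mulNr oppr_le0 mulr_ge0 ?sqr_ge0.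
have I b d k : 2^-1 <= b -> integ (fun x => f x * expR (- b * (x - g) ^+ 2 + d * (x - g)) *
     (1 - expR (- C * (x - a) ^+ 2)) ^+ k).
  move=> b1; have b0 : 0 < b by apply: lt_le_trans b1; rewrite invr_gt0.
  apply: (@integ_le _ _ (fun x => `|f x * (1.[x - g] * expR (- b * (x - g) ^+ 2 + d * (x - g)))|)).
  - apply: measurable_funM; last first.
      by apply: measurable_funX; exact: continuous_measurable_fun.
    have := integ_meas (sqi_ipi sf (sqi_poly_gauss 1 d b0)).
    by under eq_fun do rewrite hornerC mul1r.
  - move=> x; rewrite hornerC mul1r normrM ler_piMr // normrX.
    exact: exprn_ile1.
  - by apply: integ_norm; apply: sqi_ipi => //; exact: sqi_poly_gauss.
elim: K => [|K IH] b d b1.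
  by under eq_fun do rewrite expr0 mulr1; exact: ortho_exp.
(* From [- C (x - a) ^ 2 = - C (x - g) ^ 2 + 2 C (a - g) (x - g) - C (a - g) ^ 2]. *)
pose d' := d + 2 * C * (a - g).
have -> : (fun x => f x * expR (- b * (x - g) ^+ 2 + d * (x - g)) *
     (1 - expR (- C * (x - a) ^+ 2)) ^+ K.+1) =
  (fun x => f x * expR (- b * (x - g) ^+ 2 + d * (x - g)) *
     (1 - expR (- C * (x - a) ^+ 2)) ^+ K -
   expR (- C * (a - g) ^+ 2) * (f x * expR (- (b + C) * (x - g) ^+ 2 + d' * (x - g)) *
     (1 - expR (- C * (x - a) ^+ 2)) ^+ K)).
  apply/funext => x.
  have -> : expR (- C * (a - g) ^+ 2) * (f x * expR (- (b + C) * (x - g) ^+ 2 + d' * (x - g)) *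
     (1 - expR (- C * (x - a) ^+ 2)) ^+ K) =
     f x * (expR (- C * (a - g) ^+ 2) * expR (- (b + C) * (x - g) ^+ 2 + d' * (x - g))) *
     (1 - expR (- C * (x - a) ^+ 2)) ^+ K by ring.
  rewrite -expRD.
  have -> : - C * (a - g) ^+ 2 + (- (b + C) * (x - g) ^+ 2 + d' * (x - g)) =
    (- b * (x - g) ^+ 2 + d * (x - g)) + (- C * (x - a) ^+ 2).
    by rewrite /d'; ring.
  rewrite (expRD (- b * (x - g) ^+ 2 + d * (x - g))) (exprS _ K).
  move: (expR (- b * (x - g) ^+ 2 + d * (x - g))) (expR (- C * (x - a) ^+ 2)) => u v.
  by move: ((1 - v) ^+ K) => z; ring.
have bC : 2^-1 <= b + C by rewrite (le_trans b1) // lerDl.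
by rewrite intB ?intZ ?IH ?mulr0 ?subrr //; [exact: I|exact: I|exact/integZ/I].
Qed.

Lemma bernoulli_sub (u : R) n : 0 <= u <= 1 -> 1 - n%:R * u <= (1 - u) ^+ n.
Proof.
move=> /andP[u0 u1]; elim: n => [|n IH]; first by rewrite mul0r subr0 expr0.
rewrite exprS -natr1; apply: (@le_trans _ _ ((1 - u) * (1 - n%:R * u))); last first.
  by rewrite ler_wpM2l // subr_ge0.
by have := mulr_ge0 (ler0n R n) (mulr_ge0 u0 u0); nra.
Qed.

(** The number of factors times the size of the exponential: it explodes or vanishes according to
    the sign of [ln 2 - t], whence the threshold in the two limits below. *)
Lemma pow2_expR (t : R) m :
  (2 ^ m)%:R * expR (- t * m%:R) = expR (m%:R * (ln 2 - t)).
Proof.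
rewrite mulrBr expRD expRM_natl lnK ?posrE // -natrX; congr (_ * expR _).
by rewrite mulNr mulrC.
Qed.

(** By [1 - v <= exp (- v)] the power is at most [exp (- exp (m (ln 2 - t)))], hence at most
    [exp (- m (ln 2 - t))]. *)
Lemma cvg_pow_one_sub_lt (t : R) : 0 <= t -> t < ln 2 ->
  (1 - expR (- t * m%:R)) ^+ (2 ^ m) @[m --> \oo] --> 0.
Proof.
move=> t0 t2.
have q1 : expR (- (ln 2 - t)) < 1 by rewrite expR_lt1 oppr_lt0 subr_gt0.
have C : expR (- (ln 2 - t)) ^+ m @[m --> \oo] --> 0.
  by apply: cvg_expr; rewrite ger0_norm ?expR_ge0.
apply: (squeeze_cvgr _ (cvg_cst 0) C); apply: nearW => m.
have e0 : 0 <= 1 - expR (- t * m%:R).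
  by rewrite subr_ge0 -expR0 ler_expR mulNr oppr_le0 mulr_ge0.
rewrite exprn_ge0 //=.
apply: (@le_trans _ _ (expR (- expR (- t * m%:R)) ^+ (2 ^ m))).
  rewrite lerXn2r ?nnegrE ?expR_ge0 //.
  by apply: (le_trans _ (expR_ge1Dx _)).
rewrite -!expRM_natl ler_expR !mulrN lerN2 pow2_expR.
by apply: (le_trans _ (expR_ge1Dx _)); rewrite lerDr.
Qed.

(** Bernoulli's inequality bounds the power from below by [1 - exp (m (ln 2 - t))]. *)
Lemma cvg_pow_one_sub_gt (t : R) : ln 2 < t ->
  (1 - expR (- t * m%:R)) ^+ (2 ^ m) @[m --> \oo] --> (1 : R).
Proof.
move=> t2.
have q1 : expR (ln 2 - t) < 1 by rewrite expR_lt1 subr_lt0.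
have C : 1 - expR (ln 2 - t) ^+ m @[m --> \oo] --> (1 - 0 : R).
  apply: cvgB; first exact: cvg_cst.
  by apply: cvg_expr; rewrite ger0_norm ?expR_ge0.
rewrite subr0 in C; apply: (squeeze_cvgr _ C); last exact: cvg_cst.
apply: nearW => m.
have t0 : 0 <= t by apply/ltW/(lt_trans _ t2); rewrite ln_gt0 // ltr1n.
have e1 : expR (- t * m%:R) <= 1.
  by rewrite -expR0 ler_expR mulNr oppr_le0 mulr_ge0.
apply/andP; split; last first.
  by rewrite exprn_ile1 // ?subr_ge0 // lerBlDr lerDl expR_ge0.
apply: (le_trans _ (bernoulli_sub _ _)); last by rewrite expR_ge0.
by rewrite lerD2l lerN2 pow2_expR expRM_natl.
Qed.

(* For c r ^ 2 = ln 2, (1 - exp (- c m (x - a) ^ 2)) ^ (2 ^ m) tends to the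
   indicator of |x - a| > r as m goes to infinity. *)
Lemma ortho_ball a r : ortho_gauss 2^-1 -> 0 < r ->
  int (fun x => f x * expR (- 2^-1 * (x - g) ^+ 2) * \1_(ball a r) x) = 0.
Proof.
move=> O1 r0; pose W x := f x * expR (- 2^-1 * (x - g) ^+ 2).
have EW : W = (fun x => f x * (1.[x - g] * expR (- 2^-1 * (x - g) ^+ 2 + 0 * (x - g)))).
  by apply/funext => x; rewrite hornerC mul1r mul0r addr0.
have IW : integ W.
  by rewrite EW; apply: sqi_ipi => //; apply: sqi_poly_gauss; rewrite invr_gt0.
have W0 : int W = 0.
  rewrite EW; under eq_fun do rewrite hornerC mul1r.
  exact: ortho_exp.
pose c := ln 2 / r ^+ 2.
have ln20 : 0 < ln 2 :> R by rewrite ln_gt0 // ltr1n.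
have c0 : 0 < c by rewrite divr_gt0 // exprn_gt0.
pose F m x := W x * (1 - expR (- (c * m%:R) * (x - a) ^+ 2)) ^+ (2 ^ m).
have F0 m : int (F m) = 0.
  have cm : 0 <= c * m%:R by rewrite mulr_ge0 // ltW.
  rewrite -[RHS](ortho_exp_pow a (2 ^ m) O1 cm 0 (lexx _)).
  by congr int; apply/funext => x; rewrite mul0r addr0.
have mW := integ_meas IW.
have mb : measurable_fun setT (\1_(ball a r) : R -> R).
  by apply: measurable_indic; exact: measurable_ball.
have [_] : integ (fun x => W x * (1 - \1_(ball a r) x)) /\
    int (F m) @[m --> \oo] --> int (fun x => W x * (1 - \1_(ball a r) x)).
  apply: (@int_dct_ae _ F _ (fun x => `|W x|)).
  - move=> m; apply: measurable_funM => //; apply: measurable_funX.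
    apply: continuous_measurable_fun => x; apply: cvgB; first exact: cvg_cst.
    have := @continuous_poly_gauss R 1 (c * m%:R) 0 a.
    under eq_fun do rewrite hornerC mul1r mul0r addr0.
    exact.
  - by apply: measurable_funM => //; apply: measurable_funB.
  (* At these two points the exponent is exactly at the threshold [ln 2], which neither limit
     covers. *)
  - exists [set a - r; a + r]; split.
    + by apply: measurableU; exact: measurable_set1.
    + apply/eqP; rewrite -measure_le0; apply: (le_trans (measureU2 _ _ _)) => //.
      have /= := @lebesgue_measure_set1 R (a - r).
      have /= := @lebesgue_measure_set1 R (a + r).
      by move=> /= -> ->; rewrite adde0.
    + move=> x /= H; apply: contrapT => /not_orP[xm xp]; apply: H.
      apply: cvgM; first exact: cvg_cst.
      have Et m : expR (- (c * m%:R) * (x - a) ^+ 2) = expR (- (c * (x - a) ^+ 2) * m%:R).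
        by congr expR; ring.
      under eq_fun do rewrite Et.
      have xr : `|x - a| != r.
        apply/eqP => e; move: (e); rewrite -e => _.
        have [h|h] := leP 0 (x - a).
          by apply: xp; rewrite -e ger0_norm //; ring.
        by apply: xm; rewrite -e ltr0_norm //; ring.
      have cr : c * r ^+ 2 = ln 2 by rewrite divfK // expf_neq0 // gt_eqF.
      have [h|h] := ltP (`|x - a|) r.
        rewrite indicE mem_set /=; last by rewrite /ball /= distrC.
        rewrite subrr; apply: cvg_pow_one_sub_lt.
          by rewrite mulr_ge0 ?sqr_ge0 // ltW.
        by rewrite -cr ltr_pM2l // -(real_normK (num_real (x - a))) ltrXn2r // ltW.
      rewrite indicE memNset /=; last by rewrite /ball /= distrC; apply/negP; rewrite -leNgt.
      rewrite subr0; apply: cvg_pow_one_sub_gt.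
      have {}h : r < `|x - a| by rewrite lt_neqAle eq_sym xr.
      by rewrite -cr ltr_pM2l // -(real_normK (num_real (x - a))) ltrXn2r // ltW.
  - exact: integ_norm.
  - move=> m x; rewrite /F normrM ler_piMr // normrX exprn_ile1 //.
    have e1 : expR (- (c * m%:R) * (x - a) ^+ 2) <= 1.
      by rewrite -expR0 ler_expR mulNr oppr_le0 mulr_ge0 ?sqr_ge0 // mulr_ge0 // ltW.
    by rewrite ger0_norm ?subr_ge0 // lerBlDr lerDl expR_ge0.
rewrite (_ : (fun n => int (F n)) = (fun=> 0)); last by apply/funext => n; exact: F0.
move/cvg_lim => L.
have {L} : int (fun x => W x * (1 - \1_(ball a r) x)) = 0.
  by rewrite -L // lim_cst.
have -> : (fun x => W x * (1 - \1_(ball a r) x)) = (fun x => W x - W x * \1_(ball a r) x).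
  by apply/funext => x; rewrite mulrBr mulr1.
rewrite intB // ?W0 ?sub0r; first by move=> /eqP; rewrite oppr_eq0 => /eqP.
apply: integ_le (integ_norm IW); first exact: measurable_funM.
by move=> x; rewrite normrM ler_piMr // indicE; case: (_ \in _); rewrite ?normr1 ?normr0.
Qed.

(** When the mean of [W] over a ball vanishes, the mean of [|W - W x|] is at least [|W x|]; at a
    Lebesgue point the latter mean tends to 0. *)
Lemma lebesgue_pt_ball0 (W : R -> R) (x : R) : integ W ->
  (forall r, 0 < r -> int (fun y => W y * \1_(ball x r) y) = 0) ->
  lebesgue_pt W x -> W x = 0.
Proof.
move=> IW H L.
have D r : 0 < r -> (`|W x|%:E <= davg W x r)%E.
  move=> r0; have mB : measurable (ball x r) by exact: measurable_ball.
  have mb : mu (ball x r) = (r *+ 2)%:E by rewrite lebesgue_measure_ball // ltW.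
  have IB : mu.-integrable (ball x r) (fun y => (W y)%:E).
    apply: (@integrableS _ _ _ mu setT (ball x r) _ measurableT mB _ IW).
    exact: subsetT.
  have IC : mu.-integrable (ball x r) (fun=> (W x)%:E).
    by apply/integrableP; split => //; rewrite integral_cst //= mb -EFinM ltry.
  have B0 : (\int[mu]_(y in ball x r) (W y)%:E = 0)%E.
    rewrite integral_mkcond -[RHS](_ : 0%:E = _) // -(H r r0).
    rewrite EFin_int.
      apply: eq_integral => y _; rewrite patchE indicE.
      by case: (_ \in _); rewrite ?mulr1 ?mulr0.
    apply: integ_le (integ_norm IW).
      apply: measurable_funM; first exact: integ_meas IW.
      exact: measurable_indic.
    by move=> y; rewrite normrM ler_piMr // indicE; case: (_ \in _); rewrite ?normr1 ?normr0.
  rewrite /davg /iavg mb.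
  have -> : `|W x|%:E = ((r *+ 2)%:E^-1 * `| \int[mu]_(y in ball x r) ((W y)%:E - (W x)%:E) |)%E.
    rewrite integralB // B0 sub0e abseN integral_cst //= mb.
    rewrite -EFinM /= normrM (ger0_norm (x := r *+ 2)) ?mulrn_wge0 ?ltW //.
    rewrite inver gt_eqF ?mulrn_wgt0 // -EFinM; congr EFin.
    by rewrite mulrCA mulVf ?mulr1 // gt_eqF // mulrn_wgt0.
  rewrite lee_wpmul2l //.
    by rewrite inve_ge0 lee_fin mulrn_wge0 // ltW.
  apply: le_abse_integral => //.
  by apply: emeasurable_funB; [exact: measurable_int IB|exact: measurable_int IC].
apply/eqP; rewrite -normr_le0 -lee_fin.
apply: (cvge_ge _ L); near=> r; apply: D.
by near: r; exact: nbhs_right_gt.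
Unshelve. all: by end_near. Qed.

Lemma ortho_eq0 : ortho_gauss 2^-1 -> {ae mu, forall x, f x = 0}.
Proof.
move=> O1; pose W x := f x * expR (- 2^-1 * (x - g) ^+ 2).
have IW : integ W.
  have -> : W = (fun x => f x * (1.[x - g] * expR (- 2^-1 * (x - g) ^+ 2 + 0 * (x - g)))).
    by apply/funext => x; rewrite hornerC mul1r mul0r addr0.
  by apply: sqi_ipi => //; apply: sqi_poly_gauss; rewrite invr_gt0.
have lW : locally_integrable setT W.
  by apply: open_integrable_locally => //; exact: openT.
case: (lebesgue_differentiation lW) => N [mN N0 sN]; exists N; split => // x H.
apply: sN => L; apply: H => /=.
suff : W x = 0.
  by move/eqP; rewrite mulf_eq0 [X in _ || X]gt_eqF ?expR_gt0 // orbF => /eqP.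
by apply: lebesgue_pt_ball0 L => // r r0; exact: ortho_ball.
Qed.

(** Multiplication by [x - g] only mixes neighbouring indices, so orthogonality to all [hg g n]
    passes to every polynomial multiple. The case [n = 0], where [hpoly 0] is constant, gives all
    polynomials times the Gaussian. *)
Lemma hg_ortho_gauss : (forall n, ip f (hg g n) = 0) -> ortho_gauss 2^-1.
Proof.
move=> H.
have key p : forall n, ip f (gpoly g (p * hpoly n)) = 0.
  elim/poly_ind: p => [|p c IH] n.
    rewrite mul0r /ip -[RHS](@int0 R); congr int; apply/funext => x.
    by rewrite /gpoly hornerC mul0r mulr0.
  rewrite mulrDl -mulrA mulX_hpoly mulrDr -(scalerAr (Bc n.+1)) -(scalerAr (Bc n)) mul_polyC ipC.
  have -> : gpoly g (Bc n.+1 *: (p * hpoly n.+1) + Bc n *: (p * hpoly n.-1) + c *: hpoly n) =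
    (fun x => Bc n.+1 * gpoly g (p * hpoly n.+1) x + Bc n * gpoly g (p * hpoly n.-1) x +
      c * hg g n x).
    by apply/funext => x; rewrite !gpolyD (gpolyZ _ (Bc n.+1)) (gpolyZ _ (Bc n)) (gpolyZ _ c).
  have s1 (q : {poly R}) : sqi (gpoly g q) by exact: sqi_gpoly.
  have s2 c' (q : {poly R}) : sqi (fun x => c' * gpoly g q x) by exact: sqiZ.
  rewrite ipDl //; first last.
  - exact: (sqiZ _ (sqi_hg g n)).
  - exact: sqiD.
  rewrite ipDl // !ipZl //; last exact: sqi_hg.
  by rewrite !(ipC _ f) !IH H !mulr0 !addr0.
move=> p; rewrite -[RHS](key (hnc 0 *: p) 0%N) /ip; congr int.
have -> : hnc 0 *: p * hpoly 0 = p.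
  by rewrite /hpoly /= alg_polyC mulrC mul_polyC scalerA mulVf ?scale1r // gt_eqF ?hnc_gt0.
by apply/funext => x; rewrite /gpoly; congr (_ * (_ * expR _)); field.
Qed.

Lemma hg_complete : (forall n, ip f (hg g n) = 0) -> {ae mu, forall x, f x = 0}.
Proof. by move/hg_ortho_gauss/ortho_eq0. Qed.

End Orthogonal.
End Completeness.

(** * Expansion in the Hermite basis *)

Section Expansion.
Context {R : realType}.
Local Notation mu := (@lebesgue_measure R).
Implicit Types (f h : R -> R) (c : nat -> R) (g : R) (n N : nat).

Definition hsum g c N : R -> R := fun x => \sum_(i < N) c i * hg g i x.

Lemma sqi_hsum g c N : sqi (hsum g c N).
Proof. by apply: sqi_sum => i; exact/sqiZ/sqi_hg. Qed.

Lemma ip_hsum g c N f : sqi f ->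
  ip (hsum g c N) f = \sum_(i < N) c i * ip (hg g i) f.
Proof.
move=> sf; rewrite ip_suml //; last by move=> i; exact/sqiZ/sqi_hg.
by apply: eq_bigr => i _; rewrite ipZl //; exact: sqi_hg.
Qed.

Lemma ip_hsum_hg g c N n :
  ip (hsum g c N) (hg g n) = if (n < N)%N then c n else 0.
Proof.
rewrite ip_hsum; last exact: sqi_hg.
under eq_bigr do rewrite hg_orthonormal.
case: ltnP => [nN|nN].
  rewrite (bigD1 (Ordinal nN)) //= eqxx mulr1 big1 ?addr0 // => i.
  by rewrite -val_eqE /= => /negbTE ->; rewrite mulr0.
rewrite big1 // => i _; rewrite (_ : (i == n :> nat) = false) ?mulr0 //.
by apply/negbTE; rewrite neq_ltn (leq_trans (ltn_ord i)).
Qed.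

Lemma ip_hsum_sq g c N : ip (hsum g c N) (hsum g c N) = \sum_(i < N) c i ^+ 2.
Proof.
rewrite ip_hsum; last exact: sqi_hsum.
by apply: eq_bigr => i _; rewrite ipC ip_hsum_hg ltn_ord expr2.
Qed.

Lemma ip_sub_hsum g f N : sqi f ->
  ip (fun x => f x - hsum g (fun n => ip f (hg g n)) N x)
     (fun x => f x - hsum g (fun n => ip f (hg g n)) N x) =
  ip f f - \sum_(i < N) ip f (hg g i) ^+ 2.
Proof.
move=> sf; rewrite ip_sqB //; last exact: sqi_hsum.
rewrite ip_hsum_sq (ipC f (hsum _ _ _)) ip_hsum //.
under eq_bigr do rewrite (ipC (hg _ _)) -expr2.
by ring.
Qed.

Lemma hg_bessel g f N : sqi f -> \sum_(i < N) ip f (hg g i) ^+ 2 <= ip f f.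
Proof. by move=> sf; rewrite -subr_ge0 -ip_sub_hsum //; exact: ip_ge0. Qed.

Lemma sum_bounded_cauchy c (M : R) : (forall N, \sum_(i < N) c i ^+ 2 <= M ) ->
  forall e : R, 0 < e -> exists N, forall n m, (N <= n)%N -> (N <= m)%N ->
  `|\sum_(i < n) c i ^+ 2 - \sum_(i < m) c i ^+ 2| <= e.
Proof.
move=> cM e e0.
have /cvg_ex[L] : cvgn (fun n => \sum_(i < n) c i ^+ 2).
  apply: nondecreasing_is_cvgn.
    by apply/nondecreasing_seqP => n; rewrite big_ord_recr /= lerDl sqr_ge0.
  by exists M => _ [n _ <-].
move/cvgrPdist_le => /(_ (e / 2)); case; first by rewrite divr_gt0.
move=> N _ NP; exists N => n m nN mN.
have -> : \sum_(i < n) c i ^+ 2 - \sum_(i < m) c i ^+ 2 =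
  (L - \sum_(i < m) c i ^+ 2) - (L - \sum_(i < n) c i ^+ 2) by ring.
apply: (le_trans (ler_normB _ _)); rewrite [leRHS](splitr e).
by apply: lerD; apply: NP.
Qed.

Lemma hsumB_sq g c n m :
  ip (fun x => hsum g c n x - hsum g c m x) (fun x => hsum g c n x - hsum g c m x) =
  `|\sum_(i < n) c i ^+ 2 - \sum_(i < m) c i ^+ 2|.
Proof.
wlog nm : n m / (n <= m)%N.
  move=> H; case: (leqP n m) => nm; first exact: H.
  rewrite distrC -H; last exact: ltnW.
  by rewrite /ip; congr int; apply/funext => x; ring.
rewrite ip_sqB; try exact: sqi_hsum.
have -> : ip (hsum g c n) (hsum g c m) = \sum_(i < n) c i ^+ 2.
  rewrite ip_hsum; last exact: sqi_hsum.
  by apply: eq_bigr => i _; rewrite ipC ip_hsum_hg (leq_trans (ltn_ord i) nm) expr2.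
rewrite !ip_hsum_sq distrC ger0_norm; first by ring.
rewrite subr_ge0 -(subnKC nm) big_split_ord /= lerDl.
by apply: sumr_ge0 => i _; exact: sqr_ge0.
Qed.

Lemma hexp_exists g c (M : R) : (forall N, \sum_(i < N) c i ^+ 2 <= M ) ->
  exists h, [/\ sqi h, forall n, ip h (hg g n) = c n &
    ip (fun x => hsum g c N x - h x) (fun x => hsum g c N x - h x) @[N --> \oo] --> 0].
Proof.
move=> cM.
have [||h [sh Ch]] := @riesz_fischer _ (hsum g c).
- by move=> n; exact: sqi_hsum.
- move=> e e0; have [N NP] := sum_bounded_cauchy cM e0.
  by exists N => n m nN mN; rewrite hsumB_sq NP.
exists h; split => // n.
apply/eqP; rewrite eq_sym -subr_eq0 -sqrf_eq0; apply/eqP.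
apply/le_anti; rewrite sqr_ge0 andbT.
(* Cauchy-Schwarz: the error on one coefficient is at most the distance from the partial sum to [h],
   and for [n < N] the partial sum already has the coefficient [c n]. *)
apply: (cvgr_to_ge Ch); near=> N.
have nN : (n < N)%N by near: N; exact: nbhs_infty_gt.
have := ip_CS (sqiB (sqi_hsum g c N) sh) (sqi_hg g n).
by rewrite hg_orthonormal eqxx mulr1 ipBl //; [rewrite ip_hsum_hg nN|exact: sqi_hsum|exact: sqi_hg].
Unshelve. all: by end_near. Qed.

Lemma hexp_unique g f h : sqi f -> sqi h ->
  (forall n, ip f (hg g n) = ip h (hg g n)) -> {ae mu, forall x, f x = h x}.
Proof.
move=> sf sh E.
have := @hg_complete R (fun x => f x - h x) g (sqiB sf sh).
case=> [n|N [mN N0 sN]]; first by rewrite ipBl ?E ?subrr //; exact: sqi_hg.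
exists N; split => // x H; apply: sN => /= e; apply: H => /=.
by apply/eqP; rewrite -subr_eq0; apply/eqP.
Qed.

(** The partial sums converge to some [h] by [hexp_exists], and completeness identifies [h] with
    [f]. *)
Lemma hg_cvg g f : sqi f ->
  ip (fun x => f x - hsum g (fun n => ip f (hg g n)) N x)
     (fun x => f x - hsum g (fun n => ip f (hg g n)) N x) @[N --> \oo] --> 0.
Proof.
move=> sf; have [h [sh Eh Ch]] := @hexp_exists g (fun n => ip f (hg g n)) _ (fun N => hg_bessel g N sf).
have fh : {ae mu, forall x, f x = h x} by apply: (@hexp_unique g f h sf sh) => n; rewrite Eh.
apply: cvg_trans Ch; apply: near_eq_cvg; apply: nearW => N.
set S := hsum _ _ _; have sS : sqi S by exact: sqi_hsum.
transitivity (ip (fun x => f x - S x) (fun x => f x - S x)).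
  rewrite !ip_sqB //.
  have -> : ip h h = ip f f.
    rewrite -(@ip_ae_eq _ f h h) //; last exact: sqi_meas.
    by rewrite ipC -(@ip_ae_eq _ f h f) //; exact: sqi_meas.
  have -> : ip S h = ip f S by rewrite ipC -(@ip_ae_eq _ f h S) //; exact: sqi_meas.
  by ring.
by [].
Qed.

Lemma hg_parseval g f : sqi f ->
  \sum_(i < N) ip f (hg g i) ^+ 2 @[N --> \oo] --> ip f f.
Proof.
move=> sf.
have : ip f f - (ip f f - \sum_(i < N) ip f (hg g i) ^+ 2) @[N --> \oo] --> ip f f - 0.
  apply: cvgB; first exact: cvg_cst.
  by under eq_fun do rewrite -ip_sub_hsum //; exact: hg_cvg.
by rewrite subr0; under eq_fun do rewrite subKr.
Qed.

(** Polarisation of [hg_parseval]. *)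
Lemma hg_parseval2 g f h : sqi f -> sqi h ->
  \sum_(i < N) ip f (hg g i) * ip h (hg g i) @[N --> \oo] --> ip f h.
Proof.
move=> sf sh.
have := hg_parseval g (sqiD sf sh).
have := hg_parseval g sf; have := hg_parseval g sh => Ph Pf Pfh.
have : 2^-1 * (\sum_(i < N) ip (fun x => f x + h x) (hg g i) ^+ 2 -
    (\sum_(i < N) ip f (hg g i) ^+ 2 + \sum_(i < N) ip h (hg g i) ^+ 2)) @[N --> \oo] -->
    2^-1 * (ip (fun x => f x + h x) (fun x => f x + h x) - (ip f f + ip h h)).
  by apply: cvgM; [exact: cvg_cst|apply: cvgB => //; exact: cvgD].
rewrite ip_sqD //.
have -> : 2^-1 * (ip f f + 2 * ip f h + ip h h - (ip f f + ip h h)) = ip f h by field.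
apply: cvg_trans; apply: near_eq_cvg; apply: nearW => N /=.
rewrite -big_split -sumrB mulr_sumr /=; apply: eq_bigr => i _.
by rewrite ipDl //; [field|exact: sqi_hg].
Qed.

End Expansion.

(** * Sobolev norms in terms of Hermite coefficients *)

Section ComplexL2.
Context {R : realType}.
Local Notation mu := (@lebesgue_measure R).
Implicit Types (psi : R -> R[i]) (phi : R -> R) (z : R[i]) (a s : R).

Lemma cvgD0 (T : Type) (F : set_system T) {FF : Filter F} (u v : T -> R) :
  u t @[t --> F] --> 0 -> v t @[t --> F] --> 0 -> u t + v t @[t --> F] --> (0 : R).
Proof. by move=> U V; rewrite -(addr0 0); exact: cvgD. Qed.

Definition re psi : R -> R := fun x => complex.Re (psi x).
Definition im psi : R -> R := fun x => complex.Im (psi x).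
Definition sqn z : R := complex.Re z ^+ 2 + complex.Im z ^+ 2.
Definition nrm2 psi : R := ip (re psi) (re psi) + ip (im psi) (im psi).
Definition csqi psi : Prop := sqi (re psi) /\ sqi (im psi).

Lemma sqn_ge0 z : 0 <= sqn z. Proof. by rewrite addr_ge0 ?sqr_ge0. Qed.

Lemma sqn_normc z : sqn z = normc z ^+ 2.
Proof. by case: z => x y; rewrite /sqn /= sqr_sqrtr // addr_ge0 ?sqr_ge0. Qed.

Lemma nrm2_ge0 psi : 0 <= nrm2 psi. Proof. by rewrite addr_ge0 ?ip_ge0. Qed.

Lemma normr_powR2 (x : R) : `|x| `^ 2 = x ^+ 2.
Proof. by rewrite powR_mulrn // real_normK // num_real. Qed.

Lemma L2enorm_int psi : L2enorm psi = ((\int[mu]_x (sqn (psi x))%:E) `^ 2^-1)%E.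
Proof.
rewrite /L2enorm unlock /=; congr (_ `^ _)%E.
by apply: eq_integral => x _; rewrite normr_powR2 sqn_normc.
Qed.

Lemma L2_csqi psi : L2 psi <-> csqi psi.
Proof.
split=> [[mr mi h]|[[mr ir] [mi ii]]].
  have ms : measurable_fun setT (fun x => sqn (psi x)).
    by apply: measurable_funD; apply: measurable_funX.
  have I : integ (fun x => sqn (psi x)).
    apply/integrableP; split; first exact/measurable_EFinP.
    under eq_integral => x _ do rewrite gee0_abs ?lee_fin ?sqn_ge0 //.
    rewrite ltNge leye_eq; apply/negP => /eqP e; move: h.
    by rewrite L2enorm_int e poweRyr ?invr_eq0 ?pnatr_eq0 // ltxx.
  split; split => //; apply: (integ_le _ _ I).
  - exact: measurable_funM.
  - move=> x; rewrite /re -expr2 ger0_norm ?sqr_ge0 // /sqn lerDl sqr_ge0 //.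
  - exact: measurable_funM.
  - by move=> x; rewrite /im -expr2 ger0_norm ?sqr_ge0 // /sqn lerDr sqr_ge0.
split => //.
have I : integ (fun x => sqn (psi x)).
  by rewrite /sqn; under eq_fun do rewrite !expr2; exact: integD.
rewrite L2enorm_int -EFin_int // poweR_EFin ltry //.
Qed.

Lemma nrm2_int psi : csqi psi -> nrm2 psi = int (fun x => sqn (psi x)).
Proof.
move=> [sr si]; rewrite /nrm2 /ip -intD; try exact: sqi_ipi.
by congr int; apply/funext => x; rewrite /sqn !expr2.
Qed.

Lemma L2enormE psi : csqi psi -> L2enorm psi = (Num.sqrt (nrm2 psi))%:E.
Proof.
move=> [sr si]; rewrite L2enorm_int nrm2_int // -EFin_int.
  rewrite poweR_EFin powR12_sqrt //; apply: int_ge0 => x; exact: sqn_ge0.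
rewrite /sqn; under eq_fun do rewrite !expr2; apply: integD; exact: sqi_ipi.
Qed.

Lemma L2normE psi : csqi psi -> L2norm psi = Num.sqrt (nrm2 psi).
Proof. by move=> s; rewrite /L2norm L2enormE. Qed.

Lemma csqiB psi psi' : csqi psi -> csqi psi' -> csqi (fun x => psi x - psi' x).
Proof.
move=> [r i] [r' i']; split.
  rewrite (_ : re _ = fun x => re psi x - re psi' x); first exact: sqiB.
  by apply/funext => x; rewrite /re; case: (psi x) => ? ?; case: (psi' x).
rewrite (_ : im _ = fun x => im psi x - im psi' x); first exact: sqiB.
by apply/funext => x; rewrite /im; case: (psi x) => ? ?; case: (psi' x).
Qed.

Lemma nrm2B psi psi' : nrm2 (fun x => psi x - psi' x) =
  ip (fun x => re psi x - re psi' x) (fun x => re psi x - re psi' x) +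
  ip (fun x => im psi x - im psi' x) (fun x => im psi x - im psi' x).
Proof.
rewrite /nrm2; congr (ip _ _ + ip _ _); apply/funext => x;
  by rewrite /re /im; case: (psi x) => ? ?; case: (psi' x).
Qed.

Lemma L2enorm_cvg0 (T : Type) (F : set_system T) {FF : Filter F} (u : T -> R -> R[i]) :
  (forall t, csqi (u t)) ->
  L2enorm (u t) @[t --> F] --> (0 : \bar R) <-> nrm2 (u t) @[t --> F] --> (0 : R).
Proof.
move=> su; under eq_fun do rewrite L2enormE //.
split=> [/fine_cvg H|H].
  have : Num.sqrt (nrm2 (u t)) * Num.sqrt (nrm2 (u t)) @[t --> F] --> (0 * 0 : R).
    by apply: cvgM; exact: H.
  rewrite mulr0; apply: cvg_trans; apply: near_eq_cvg.
  by apply: nearW => t /=; rewrite -expr2 sqr_sqrtr // nrm2_ge0.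
apply: cvg_EFin; first exact: nearW.
rewrite -(@sqrtr0 R); apply: continuous_cvg => //; exact: sqrt_continuous.
Qed.

Lemma pairingE psi phi : pairing psi phi = ip (re psi) phi +i* ip (im psi) phi.
Proof.
rewrite /pairing /cintegral /ip /int; congr (_ +i* _);
  by congr Rintegral; apply/funext => x; rewrite /re /im; case: (psi x) => p q /=; ring.
Qed.

Lemma Re_sum (I : Type) (r : seq I) (F : I -> R[i]) :
  complex.Re (\sum_(i <- r) F i) = \sum_(i <- r) complex.Re (F i).
Proof.
elim: r => [|i r IH]; first by rewrite !big_nil.
by rewrite !big_cons -IH; case: (F i); case: (\sum_(_ <- _) _).
Qed.

Lemma Im_sum (I : Type) (r : seq I) (F : I -> R[i]) :
  complex.Im (\sum_(i <- r) F i) = \sum_(i <- r) complex.Im (F i).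
Proof.
elim: r => [|i r IH]; first by rewrite !big_nil.
by rewrite !big_cons -IH; case: (F i); case: (\sum_(_ <- _) _).
Qed.

Definition wt a n : R := (2 * n%:R + 1) `^ a.
Definition hcoef psi n : R[i] := pairing psi (hermite n).

Lemma wt_ge0 a n : 0 <= wt a n. Proof. exact: powR_ge0. Qed.
Lemma wtD a b n : wt (a + b) n = wt a n * wt b n.
Proof.
by rewrite /wt powRD //; apply/implyP => _; rewrite gt_eqF.
Qed.
Lemma wt_half s n : wt (s / 2) n ^+ 2 = wt s n.
Proof. by rewrite expr2 -wtD -splitr. Qed.

Lemma hcoefE psi n : hcoef psi n = ip (re psi) (hg 0 n) +i* ip (im psi) (hg 0 n).
Proof. by rewrite /hcoef pairingE hermite_hg0. Qed.

Lemma re_spectral a psi N : re (spectral_sum a psi N) =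
  hsum 0 (fun n => wt a n * ip (re psi) (hg 0 n)) N.
Proof.
apply/funext => x; rewrite /re /spectral_sum Re_sum /hsum; apply: eq_bigr => i _.
by rewrite -/(hcoef psi i) hcoefE hermite_hg0 /= -/(wt a i); ring.
Qed.

Lemma im_spectral a psi N : im (spectral_sum a psi N) =
  hsum 0 (fun n => wt a n * ip (im psi) (hg 0 n)) N.
Proof.
apply/funext => x; rewrite /im /spectral_sum Im_sum /hsum; apply: eq_bigr => i _.
by rewrite -/(hcoef psi i) hcoefE hermite_hg0 /= -/(wt a i); ring.
Qed.

Lemma csqi_spectral a psi N : csqi (spectral_sum a psi N).
Proof. by split; rewrite ?re_spectral ?im_spectral; exact: sqi_hsum. Qed.

(** Convergence of the spectral sums fixes every coefficient of [g]; conversely the spectral sums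
    are then the partial sums of the expansion of [g]. From here on [Hs] and [Hnorm] are handled
    through coefficients only. *)
Lemma is_H0powP a psi g : is_H0pow a psi g <->
  [/\ csqi g, forall n, ip (re g) (hg 0 n) = wt a n * ip (re psi) (hg 0 n) &
    forall n, ip (im g) (hg 0 n) = wt a n * ip (im psi) (hg 0 n)].
Proof.
split=> [[/L2_csqi sg C]|[sg Er Ei]].
  have {C} : nrm2 (fun x => spectral_sum a psi N x - g x) @[N --> \oo] --> (0 : R).
    move: C; apply: (L2enorm_cvg0 _).1 => N.
    by apply: csqiB => //; exact: csqi_spectral.
  under eq_fun do rewrite nrm2B re_spectral im_spectral.
  move=> C; case: (sg) => sr si.
  have key (h : R -> R) c n : sqi h ->
      ip (fun x => hsum 0 c N x - h x) (fun x => hsum 0 c N x - h x) @[N --> \oo] --> 0 ->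
      ip h (hg 0 n) = c n.
    move=> sh Ch; apply/eqP; rewrite eq_sym -subr_eq0 -sqrf_eq0; apply/eqP.
    apply/le_anti; rewrite sqr_ge0 andbT.
    apply: (cvgr_to_ge Ch); near=> N.
    have nN : (n < N)%N by near: N; exact: nbhs_infty_gt.
    have := ip_CS (sqiB (sqi_hsum 0 c N) sh) (sqi_hg 0 n).
    by rewrite hg_orthonormal eqxx mulr1 ipBl //; [rewrite ip_hsum_hg nN|exact: sqi_hsum|exact: sqi_hg].
  split=> // n.
    apply: (key (re g) (fun n => wt a n * ip (re psi) (hg 0 n)) n sr).
    apply: (squeeze_cvgr _ (cvg_cst 0) C); apply: nearW => N.
    by rewrite ip_ge0 /= lerDl ip_ge0.
  apply: (key (im g) (fun n => wt a n * ip (im psi) (hg 0 n)) n si).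
  apply: (squeeze_cvgr _ (cvg_cst 0) C); apply: nearW => N.
  by rewrite ip_ge0 /= lerDr ip_ge0.
split; first exact/L2_csqi.
apply/L2enorm_cvg0; first by move=> N; apply: csqiB => //; exact: csqi_spectral.
under eq_fun do rewrite nrm2B re_spectral im_spectral.
case: sg => sr si; apply: cvgD0.
  have := hg_cvg 0 sr; under [X in hsum 0 X]eq_fun do rewrite Er.
  apply: cvg_trans; apply: near_eq_cvg; apply: nearW => N.
  by rewrite /ip; congr int; apply/funext => x; rewrite -mulrNN !opprB.
have := hg_cvg 0 si; under [X in hsum 0 X]eq_fun do rewrite Ei.
apply: cvg_trans; apply: near_eq_cvg; apply: nearW => N.
by rewrite /ip; congr int; apply/funext => x; rewrite -mulrNN !opprB.
Unshelve. all: by end_near. Qed.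

Lemma csqi_parseval psi : csqi psi ->
  \sum_(n < N) sqn (hcoef psi n) @[N --> \oo] --> nrm2 psi.
Proof.
move=> [sr si]; under eq_fun do under eq_bigr do rewrite hcoefE /sqn /=.
under eq_fun do rewrite big_split /=.
by apply: cvgD; exact: hg_parseval.
Qed.

Lemma csqi_bessel psi N : csqi psi -> \sum_(n < N) sqn (hcoef psi n) <= nrm2 psi.
Proof.
move=> [sr si]; apply: le_trans (lerD (hg_bessel 0 N sr) (hg_bessel 0 N si)).
by rewrite -big_split /= ler_sum // => i _; rewrite hcoefE.
Qed.

Lemma hcoef_exists (c : nat -> R[i]) M : (forall N, \sum_(n < N) sqn (c n) <= M) ->
  exists psi, csqi psi /\ forall n, hcoef psi n = c n.
Proof.
move=> cM.
have [|hr [sr Er _]] := @hexp_exists R 0 (fun n => complex.Re (c n)) M.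
  by move=> N; apply: le_trans (cM N); apply: ler_sum => i _; rewrite lerDl sqr_ge0.
have [|hi [si Ei _]] := @hexp_exists R 0 (fun n => complex.Im (c n)) M.
  by move=> N; apply: le_trans (cM N); apply: ler_sum => i _; rewrite lerDr sqr_ge0.
exists (fun x => hr x +i* hi x); split => // n.
by rewrite hcoefE /re /im /= Er Ei; case: (c n).
Qed.

(** The bound is the hypothesis under which Riesz-Fischer produces [H0 ^ (s / 2) psi]: its
    coefficients carry [wt (s / 2)], whose square is [wt s]. *)
Lemma Hs_bounded s psi M : csqi psi ->
  (forall N, \sum_(n < N) wt s n * sqn (hcoef psi n) <= M) -> Hs s psi.
Proof.
move=> sp HM; split; first exact/L2_csqi.
have [|g [sg Eg]] := @hcoef_exists (fun n => (wt (s / 2) n)%:C * hcoef psi n) M.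
  move=> N; apply: le_trans (HM N); apply: ler_sum => i _.
  rewrite le_eqVlt -(wt_half s i); apply/orP; left; apply/eqP.
  by case: (hcoef psi i) => x y; rewrite /sqn /=; ring.
exists g; apply/is_H0powP; split=> // n; have := Eg n; rewrite !hcoefE;
  by case=> e1 e2; rewrite ?e1 ?e2; ring.
Qed.

Lemma Hs_is_H0pow s psi : Hs s psi -> is_H0pow (s / 2) psi (H0pow (s / 2) psi).
Proof. by move=> [_ [g Hg]]; exact: (@xgetI _ _ _ g). Qed.

Lemma Hnorm_ge0 s psi : Hs s psi -> 0 <= Hnorm s psi.
Proof.
by move=> /Hs_is_H0pow /is_H0powP[sg _ _]; rewrite /Hnorm L2normE.
Qed.

Lemma Hnorm_cvg s psi : Hs s psi ->
  \sum_(n < N) wt s n * sqn (hcoef psi n) @[N --> \oo] --> Hnorm s psi ^+ 2.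
Proof.
move=> /Hs_is_H0pow /is_H0powP[sg Er Ei].
rewrite /Hnorm L2normE // sqr_sqrtr ?nrm2_ge0 //.
apply: cvg_trans (csqi_parseval sg); apply: near_eq_cvg; apply: nearW => N.
apply: eq_bigr => i _; rewrite /sqn !hcoefE /= Er Ei -(wt_half s i).
by ring.
Qed.

Lemma Hnorm_le s psi M : Hs s psi ->
  (forall N, \sum_(n < N) wt s n * sqn (hcoef psi n) <= M) -> Hnorm s psi ^+ 2 <= M.
Proof. by move=> hs HM; apply: (cvgr_to_le (Hnorm_cvg hs)); exact: nearW. Qed.

Lemma Hnorm_ge s psi N : Hs s psi ->
  \sum_(n < N) wt s n * sqn (hcoef psi n) <= Hnorm s psi ^+ 2.
Proof.
move=> hs; apply: (cvgr_to_ge (Hnorm_cvg hs)); near=> n.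
have Nn : (N <= n)%N by near: n; exact: nbhs_infty_ge.
rewrite -(subnKC Nn) big_split_ord /= lerDl; apply: sumr_ge0 => i _.
by rewrite mulr_ge0 ?wt_ge0 ?sqn_ge0.
Unshelve. all: by end_near. Qed.

End ComplexL2.

Section RealDerive.
Context {R : realType}.

Lemma is_derive_sumr (F dF : nat -> R -> R) N (t : R) :
  (forall n, (n < N)%N -> is_derive t 1 (F n) (dF n t)) ->
  is_derive t 1 (fun t => \sum_(n < N) F n t) (\sum_(n < N) dF n t).
Proof.
elim: N => [|N IH] H.
  under eq_fun do rewrite big_ord0; rewrite big_ord0; exact: is_derive_cst.
under eq_fun do rewrite big_ord_recr /=; rewrite big_ord_recr /=.
apply: is_deriveD; last exact: H.
by apply: IH => n nN; apply: H; exact: ltnW.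
Qed.

Lemma within_continuous_sumr (A : set R) (F : nat -> R -> R) N :
  (forall n, {within A, continuous (F n)}) ->
  {within A, continuous (fun t => \sum_(n < N) F n t)}.
Proof.
move=> H; elim: N => [|N IH].
  by under eq_fun do rewrite big_ord0; move=> x; exact: cvg_cst.
under eq_fun do rewrite big_ord_recr /=.
by move=> x; apply: cvgD; [exact: IH|exact: H].
Qed.

End RealDerive.

(** * Conservation laws with linearly growing fluxes *)

Section HarmonicCutoff.
Context {R : realType}.
Implicit Types (N M n : nat) (f : nat -> R).

Definition hcut N n : R := \sum_(n <= k < N) k.+1%:R^-1.

Lemma hcut_ge0 N n : 0 <= hcut N n.
Proof. by apply: sumr_ge0 => k _; rewrite invr_ge0. Qed.

Lemma hcut_geq N n : (N <= n)%N -> hcut N n = 0.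
Proof. by move=> Nn; rewrite /hcut big_geq. Qed.

Lemma hcutS N n : hcut N n - hcut N n.+1 = if (n < N)%N then n.+1%:R^-1 else 0.
Proof.
case: ltnP => nN; last by rewrite !hcut_geq ?subrr // ltnW.
by rewrite /hcut big_ltn // addrK.
Qed.

Lemma hcut_dvg n (B : R) : exists N, B < hcut N n.
Proof.
apply: contrapT => H.
have {}H N : hcut N n <= B by rewrite leNgt; apply/negP => h; apply: H; exists N.
apply: (@dvg_harmonic R); apply: nondecreasing_is_cvgn.
  by apply/nondecreasing_seqP => k; rewrite seriesSr lerDl harmonic_ge0.
exists (\sum_(0 <= k < n) k.+1%:R^-1 + B) => _ [N _ <-].
rewrite /series /= /harmonic; case: (leqP n N) => nN.
  by rewrite (big_cat_nat (leq0n n) nN) /= lerD2l; exact: H.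
rewrite (big_cat_nat (leq0n N) (ltnW nN)) /= -addrA lerDl addr_ge0 //.
  by apply: sumr_ge0 => k _; rewrite invr_ge0.
exact: le_trans (hcut_ge0 n n) (H n).
Qed.

Lemma sum_by_parts1 (c f : nat -> R) M :
  \sum_(n < M) c n * (f n.+1 - f n) =
  \sum_(n < M) f n.+1 * (c n - c n.+1) + f M * c M - f 0%N * c 0%N.
Proof.
elim: M => [|M IH]; first by rewrite !big_ord0; ring.
by rewrite !big_ord_recr /= IH; ring.
Qed.

Lemma sum_by_parts2 (c f : nat -> R) M :
  \sum_(n < M) c n * (f n.+2 - f n) =
  \sum_(n < M) f n.+2 * (c n - c n.+2) + (f M * c M + f M.+1 * c M.+1)
    - (f 0%N * c 0%N + f 1%N * c 1%N).
Proof.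
elim: M => [|M IH]; first by rewrite !big_ord0; ring.
by rewrite !big_ord_recr /= IH; ring.
Qed.

Lemma sum_shift_le (e : nat -> R) N k : (forall n, 0 <= e n) ->
  \sum_(n < N) e (n + k)%N <= \sum_(n < N + k) e n.
Proof.
move=> e0; rewrite addnC big_split_ord /= -[leLHS]add0r lerD ?sumr_ge0 //.
by apply: ler_sum => i _; rewrite addnC.
Qed.

(* The cutoff [hcut N] has slope O(1/n), which beats the linear growth of the
   fluxes; as it diverges with N, nothing can escape to infinity. *)
Lemma flux_vanish (e f1 f2 : nat -> R -> R) (C K T : R) : 0 < T ->
  (forall n (t : R), 0 <= t <= T -> 0 <= e n t) ->
  (forall n, {within `[0, T], continuous (e n)}) ->
  (forall n (t : R), 0 < t < T -> is_derive t 1 (e n)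
     ((f1 n.+1 t - f1 n t) + (f2 n.+2 t - f2 n t))) ->
  (forall t, [/\ f1 0%N t = 0, f2 0%N t = 0 & f2 1%N t = 0]) ->
  (forall n (t : R), 0 < t < T -> `|f1 n.+1 t| <= C * n.+1%:R * (e n t + e n.+1 t)) ->
  (forall n (t : R), 0 < t < T -> `|f2 n.+2 t| <= C * n.+1%:R * (e n t + e n.+2 t)) ->
  (forall N (t : R), 0 <= t <= T -> \sum_(n < N) e n t <= K) -> 0 <= C ->
  (forall n, e n 0 = 0) -> forall n, e n T = 0.
Proof.
move=> T0 e0 ce de f0 F1 F2 eK C0 eI n.
have TT : 0 <= T <= T by rewrite lexx ltW.
apply/le_anti; rewrite (e0 n T TT) andbT leNgt; apply/negP => enT.
have K0 : 0 <= K by have := eK 0%N T TT; rewrite big_ord0.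
(* [6 C K] will bound the growth rate of the cut-off mass [E]. With this [N], level [n] alone would
   contribute more to [E T] than time [T] allows. *)
have [N HN] := hcut_dvg n (6 * C * K * T / e n T).
have nN : (n < N)%N.
  rewrite ltnNge; apply/negP => Nn; move: HN; rewrite hcut_geq //.
  apply/negP; rewrite -leNgt divr_ge0 // ?(ltW enT) // mulr_ge0 ?(ltW T0) //.
  by rewrite !mulr_ge0.
pose E t := \sum_(k < N) hcut N k * e k t.
pose dE t := \sum_(k < N) hcut N k * ((f1 k.+1 t - f1 k t) + (f2 k.+2 t - f2 k t)).
have [c /itvP cT] : exists2 c, c \in `]0, T[%R & E T - E 0 = dE c * (T - 0).
  apply: (@MVT R E dE 0 T T0).
    move=> t; rewrite in_itv /= => tT; apply: (@is_derive_sumr _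
      (fun k t => hcut N k * e k t) (fun k t => hcut N k * ((f1 k.+1 t - f1 k t) + (f2 k.+2 t - f2 k t)))).
    by move=> k _; have := de k t tT => d; exact: is_deriveZ.
  apply: (@within_continuous_sumr _ _ (fun k t => hcut N k * e k t)) => k x.
  by apply: cvgM; [exact: cvg_cst|exact: ce].
have {cT} cT : 0 < c < T by rewrite !cT.
have cT' : 0 <= c <= T by case/andP: cT => /ltW -> /ltW ->.
have -> : E 0 = 0 by rewrite /E big1 // => k _; rewrite eI mulr0.
rewrite !subr0 => ET.
have [f10 f20 f21] := f0 c.
have dEle : dE c <= 6 * C * K.
  rewrite /dE; under eq_bigr do rewrite mulrDr.
  (* Summation by parts moves the differences onto the cutoff. Both ends vanish: the fluxes at the
     bottom, the cutoff at [N] and [N.+1]. *)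
  rewrite big_split /= (sum_by_parts1 (hcut N) (f1 ^~ c)).
  rewrite (sum_by_parts2 (hcut N) (f2 ^~ c)) f10 f20 f21 !(hcut_geq (leqnn N)).
  rewrite !(hcut_geq (leqnSn N)) !mulr0 !mul0r !(addr0, subr0).
  have S1 : \sum_(k < N) f1 k.+1 c * (hcut N k - hcut N k.+1) <=
      \sum_(k < N) C * (e k c + e k.+1 c).
    apply: ler_sum => k _; rewrite hcutS ltn_ord ler_pdivrMr //.
    apply: (le_trans (ler_norm _)); apply: (le_trans (F1 k c cT)).
    by rewrite mulrAC.
  have S2 : \sum_(k < N) f2 k.+2 c * (hcut N k - hcut N k.+2) <=
      \sum_(k < N) 2 * C * (e k c + e k.+2 c).
    apply: ler_sum => k _.
    have h0 : 0 <= hcut N k - hcut N k.+2 <= 2 * k.+1%:R^-1.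
      have -> : hcut N k - hcut N k.+2 =
        (hcut N k - hcut N k.+1) + (hcut N k.+1 - hcut N k.+2) by ring.
      rewrite !hcutS ltn_ord mulr_natl mulr2n.
      have l2 : k.+2%:R^-1 <= k.+1%:R^-1 :> R by rewrite lef_pV2 ?posrE // ler_nat.
      have p1 : 0 <= k.+1%:R^-1 :> R by rewrite invr_ge0.
      have p2 : 0 <= k.+2%:R^-1 :> R by rewrite invr_ge0.
      by case: ifP => _; apply/andP; split; rewrite ?addr_ge0 ?lerD2l.
    case/andP: h0 => h0 h1.
    apply: (@le_trans _ _ (`|f2 k.+2 c| * (hcut N k - hcut N k.+2))).
      by rewrite ler_wpM2r // ler_norm.
    apply: (@le_trans _ _ (C * k.+1%:R * (e k c + e k.+2 c) * (2 * k.+1%:R^-1))).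
      by rewrite ler_pM // F2.
    rewrite le_eqVlt; apply/orP; left; apply/eqP.
    have k0 : k.+1%:R != 0 :> R by rewrite pnatr_eq0.
    by field.
  have e0' k : 0 <= e k c by exact: e0.
  have K1 : \sum_(k < N) e k.+1 c <= K.
    apply: (le_trans _ (eK (N + 1)%N c cT')); apply: (le_trans _ (sum_shift_le _ _ e0')).
    by under [leRHS]eq_bigr do rewrite addn1.
  have K2 : \sum_(k < N) e k.+2 c <= K.
    apply: (le_trans _ (eK (N + 2)%N c cT')); apply: (le_trans _ (sum_shift_le _ _ e0')).
    by under [leRHS]eq_bigr do rewrite addn2.
  have KN := eK N c cT'.
  apply: (le_trans (lerD S1 S2)); rewrite -!mulr_sumr !big_split /=.
  apply: (@le_trans _ _ (C * (K + K) + 2 * C * (K + K))).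
    by rewrite lerD // ler_wpM2l ?mulr_ge0 // lerD.
  by rewrite le_eqVlt; apply/orP; left; apply/eqP; ring.
have : hcut N n * e n T <= 6 * C * K * T.
  apply: (@le_trans _ _ (E T)); last by rewrite ET ler_wpM2r // ltW.
  rewrite /E (bigD1 (Ordinal nN)) //= lerDl sumr_ge0 // => k _.
  by rewrite mulr_ge0 ?hcut_ge0 // e0 // ltW //= lexx.
by rewrite leNgt -ltr_pdivrMr // HN.
Qed.

End HarmonicCutoff.

(** * Differentiation of scalar products in a parameter *)

Section UnderIntegral.
Context {R : realType}.
Local Notation mu := (@lebesgue_measure R).

Lemma dec_oneDsqrV (C : R) : dec (fun x : R => C * (oneDsqr x)^-1).
Proof.
apply: decZ; split; first exact: (continuous_measurable_fun continuous_oneDsqrV).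
exists 1 => x; rewrite ger0_norm; last by rewrite invr_ge0 ltW // oneD_gt0.
by rewrite mulVf // gt_eqF // oneD_gt0.
Qed.

(** Only the kernel is differentiated, so [f] may be any square-integrable function; the domination
    has to be uniform on a neighbourhood of [t0]. *)
Lemma is_derive_ip (f : R -> R) (K dK : R -> R -> R) (C t0 : R) : sqi f ->
  (forall t, sqi (K t)) ->
  (forall t y : R, is_derive t 1 (K ^~ y) (dK t y)) ->
  (forall t y, `|t - t0| < 1 -> `|dK t y| <= C * (oneDsqr y)^-1) ->
  is_derive t0 1 (fun t => ip f (K t)) (ip f (dK t0)).
Proof.
move=> sf sK dd dC.
pose F t y := f y * K t y.
pose G (y : R) : R := `|f y * (C * (oneDsqr y)^-1)|.
have dF (t y : R) : is_derive t 1 (F ^~ y) (f y * dK t y).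
  by have := dd t y => d; exact: is_deriveZ.
have a1 : t0 - 1 < t0 by rewrite ltrBlDr ltrDl.
have a2 : t0 < t0 + 1 by rewrite ltrDl.
have Ia : `]t0 - 1, t0 + 1[%classic t0 by rewrite /= in_itv /= a1 a2.
have intF x : `]t0 - 1, t0 + 1[%classic x -> mu.-integrable setT (EFin \o F x).
  by move=> _; exact: sqi_ipi.
have dF1 x y : `]t0 - 1, t0 + 1[%classic x -> [set: R] y -> derivable (F ^~ y) x 1.
  by move=> _ _; have [] := dF x y.
have G0 y : 0 <= G y by exact: normr_ge0.
have iG : mu.-integrable setT (EFin \o G).
  exact: (integ_norm (sqi_ipi sf (dec_sqi (dec_oneDsqrV C)))).
have Gub x y : `]t0 - 1, t0 + 1[%classic x -> [set: R] y -> `|partial1of2 F x y| <= G y.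
  rewrite /= in_itv /= => /andP[x1 x2] _; rewrite partial1of2E derive_val.
  rewrite /G !normrM ler_wpM2l // -normrM; apply: le_trans (ler_norm _).
  by apply: dC; rewrite ltr_norml; apply/andP; split; lra.
have D := @derivable_under_integral R _ _ mu F setT measurableT t0 (t0 - 1) (t0 + 1) Ia intF dF1 G G0 iG Gub.
have E := @differentiation_under_integral R _ _ mu F setT measurableT t0 (t0 - 1) (t0 + 1) Ia intF dF1 G G0 iG Gub.
apply: DeriveDef; first exact: D.
rewrite -derive1E; apply: (eq_trans E).
rewrite /ip /int; congr Rintegral; apply/funext => y.
by rewrite partial1of2E derive_val.
Qed.

End UnderIntegral.

(** * The explicit flow *)

Section Flow.
Context {R : realType}.
Variables (kappa iota : R).
Implicit Types (t y x : R) (n m : nat).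

(* Conjugating the equation by exp (- i t H0 / 2) leaves a Hamiltonian for which
   translation by [gt] and multiplication by exp (i [th]) give the flow.  [be] is
   the momentum gained and [ga], an explicit primitive, the accumulated phase. *)
Definition gt t : R := iota * (t + sin t * cos t).
Definition be t : R := - kappa * (iota * (t ^+ 2 / 2 + sin t ^+ 2 / 2)) - iota * sin t ^+ 2.
Definition ga t : R :=
  iota ^+ 2 * (kappa / 2 * (t ^+ 3 / 3 + t / 8
    + sin t * cos t * (2^-1 - (cos t ^+ 2 - sin t ^+ 2) / 8)
    - t * (cos t ^+ 2 - sin t ^+ 2) / 2)
  + (t / 4 + sin t * cos t * (2^-1 - (cos t ^+ 2 - sin t ^+ 2) / 4)
    - t * (cos t ^+ 2 - sin t ^+ 2) / 2)).
Definition th t y : R := kappa * t / 2 * y ^+ 2 + be t * y + ga t.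

Lemma sin2E t : sin t ^+ 2 = 1 - cos t ^+ 2.
Proof. by rewrite -(cos2Dsin2 t); ring. Qed.

Lemma is_derive_gt t : is_derive t 1 gt (2 * iota * cos t ^+ 2).
Proof.
rewrite /gt; apply: is_derive_eq; rewrite /GRing.scale /=.
by have := sin2E t; set s := sin t; set c := cos t => e; ring: e.
Qed.

Lemma is_derive_be t : is_derive t 1 be (- kappa * gt t - 2 * iota * sin t * cos t).
Proof.
rewrite /be /gt; apply: is_derive_eq; rewrite /GRing.scale /=.
by field.
Qed.

Lemma is_derive_ga t : is_derive t 1 ga (kappa / 2 * gt t ^+ 2 + 2 * iota * sin t * cos t * gt t).
Proof.
rewrite /ga /gt; apply: is_derive_eq; rewrite /GRing.scale /=.
by have := sin2E t; set s := sin t; set c := cos t => e; field: e.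
Qed.

(** The purpose of [be] and [ga]: the derivative of the phase depends on [y] through [y - gt t] only
    and has no constant term, so that on [hg (gt t) n] it acts through [opX]. *)
Lemma is_derive_th t y : is_derive t 1 (th ^~ y)
  (kappa / 2 * (y - gt t) ^+ 2 - 2 * iota * sin t * cos t * (y - gt t)).
Proof.
have d1 := is_derive_be t; have d2 := is_derive_ga t.
by rewrite /th; apply: is_derive_eq; rewrite /GRing.scale /=; field.
Qed.

Lemma is_derive_thy t y : is_derive y 1 (th t) (kappa * t * y + be t).
Proof. by rewrite /th; apply: is_derive_eq; rewrite /GRing.scale /=; field. Qed.

(* On coefficients with respect to the Hermite functions, [opX] is
   multiplication by x and [opD] is minus the derivative: it sends
   <f, h_n> to <f, h_n'>. At n = 0 the junk index is harmless as [Bc 0] = 0. *)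
Definition opX (A : pzRingType) (B v : nat -> A) (n : nat) : A := B n.+1 * v n.+1 + B n * v n.-1.
Definition opD (A : pzRingType) (B v : nat -> A) (n : nat) : A := B n * v n.-1 - B n.+1 * v n.+1.

Local Notation X := (opX Bc).
Local Notation D := (opD Bc).

Lemma Bc_le n : Bc n <= n.+1%:R :> R.
Proof.
rewrite -(@ler_pXn2r _ 2) ?nnegrE ?Bc_ge0 // Bc_sq expr2 -natrM ler_pdivrMr // -natrM ler_nat.
by rewrite (leq_trans (leqnSn n)) // -mulnA leq_pmulr.
Qed.

Lemma opX_le (v : nat -> R) n M : (forall m, (m <= n.+1)%N -> `|v m| <= M) ->
  `|X v n| <= 2 * n.+2%:R * M.
Proof.
move=> H; have M0 : 0 <= M by apply: le_trans (H 0%N _).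
rewrite /opX; apply: (le_trans (ler_normD _ _)); rewrite !normrM !(ger0_norm (Bc_ge0 _)).
rewrite -mulrA mulr_natl mulr2n; apply: lerD; rewrite ler_pM ?Bc_ge0 ?Bc_le ?H //.
  by apply: (le_trans (Bc_le _)); rewrite ler_nat.
by apply: leq_trans (leq_pred n) (leqnSn n).
Qed.

Lemma opD_le (v : nat -> R) n M : (forall m, (m <= n.+1)%N -> `|v m| <= M) ->
  `|D v n| <= 2 * n.+2%:R * M.
Proof.
move=> H; have M0 : 0 <= M by apply: le_trans (H 0%N _).
rewrite /opD; apply: (le_trans (ler_normB _ _)); rewrite !normrM !(ger0_norm (Bc_ge0 _)).
rewrite -mulrA mulr_natl mulr2n; apply: lerD; rewrite ler_pM ?Bc_ge0 ?Bc_le ?H //.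
  by apply: (le_trans (Bc_le _)); rewrite ler_nat.
by apply: leq_trans (leq_pred n) (leqnSn n).
Qed.

Lemma ip_opX (f : R -> R) (v : nat -> R -> R) n : sqi f -> (forall m, sqi (v m)) ->
  ip f (fun y => X (v ^~ y) n) = X (fun m => ip f (v m)) n.
Proof.
move=> sf sv; rewrite ipC /opX ipDl //; try exact: sqiZ.
by rewrite !ipZl // !(ipC f).
Qed.

Lemma ip_opD (f : R -> R) (v : nat -> R -> R) n : sqi f -> (forall m, sqi (v m)) ->
  ip f (fun y => D (v ^~ y) n) = D (fun m => ip f (v m)) n.
Proof.
move=> sf sv; rewrite ipC /opD ipBl //; try exact: sqiZ.
by rewrite !ipZl // !(ipC f).
Qed.

Lemma sqi_opX (v : nat -> R -> R) n : (forall m, sqi (v m)) -> sqi (fun y => X (v ^~ y) n).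
Proof. by move=> sv; apply: sqiD; exact: sqiZ. Qed.

Lemma sqi_opD (v : nat -> R -> R) n : (forall m, sqi (v m)) -> sqi (fun y => D (v ^~ y) n).
Proof. by move=> sv; apply: sqiB; exact: sqiZ. Qed.

Lemma hg_uniform_bound m (G0 : R) : exists C : R, 0 <= C /\
  forall g y, `|g| <= G0 -> `|hg g m y| <= C * (oneDsqr y)^-1.
Proof.
have b0 : 0 < 2^-1 :> R by rewrite invr_gt0.
(* The second factor accounts for [1 + y ^ 2 <= 1 + 2 G0 ^ 2 + 2 (y - g) ^ 2], which makes the
   constant uniform in the centre. *)
have [C [C0 HC]] := poly_gauss_bound (hpoly m * ((1 + 2 * G0 ^+ 2)%:P + 2%:P * 'X * 'X)) 0 b0.
exists C; split=> // g y gG; rewrite ler_pdivlMr ?oneD_gt0 //.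
apply: le_trans (HC (y - g)).
have QE x : ((1 + 2 * G0 ^+ 2)%:P + 2%:P * 'X * 'X : {poly R}).[x] = 1 + 2 * G0 ^+ 2 + 2 * x * x.
  by rewrite hornerD !hornerM !hornerC hornerX.
rewrite hornerM QE /hg /gpoly !normrM (ger0_norm (expR_ge0 _)).
have -> : - (y - g) ^+ 2 / 2 = - 2^-1 * (y - g) ^+ 2 + 0 * `|y - g| by field.
rewrite mulrAC ler_wpM2r ?expR_ge0 // ler_wpM2l //.
apply: le_trans (ler_norm _).
rewrite /oneDsqr.
have g2 : g ^+ 2 <= G0 ^+ 2.
  by rewrite -(real_normK (num_real g)) lerXn2r ?nnegrE // (le_trans (normr_ge0 g)).
by have := sqr_ge0 (y - 2 * g); nra.
Qed.

Lemma hg_uniform_bounds n (G0 : R) : exists C : R, 0 <= C /\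
  forall m g y, (m <= n)%N -> `|g| <= G0 -> `|hg g m y| <= C * (oneDsqr y)^-1.
Proof.
elim: n => [|n [C [C0 HC]]].
  have [C [C0 HC]] := hg_uniform_bound 0 G0; exists C; split=> // m g y.
  by rewrite leqn0 => /eqP ->; exact: HC.
have [C' [C'0 HC']] := hg_uniform_bound n.+1 G0.
exists (C + C'); split; first exact: addr_ge0.
have o0 y : 0 <= (oneDsqr y)^-1 by rewrite invr_ge0 ltW // oneD_gt0.
move=> m g y; rewrite leq_eqVlt => /orP[/eqP ->|mn] gG.
  by apply: (le_trans (HC' g y gG)); rewrite ler_wpM2r // lerDr.
by apply: (le_trans (HC m g y mn gG)); rewrite ler_wpM2r // lerDl.
Qed.

(** Real and imaginary parts of [exp (i th(t, y)) h_n(y - gt t)]. Integrating the initial state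
    against this smooth kernel gives the coefficients at time [t], whatever the regularity of the
    state. *)
Definition Kc t n y : R := cos (th t y) * hg (gt t) n y.
Definition Ks t n y : R := sin (th t y) * hg (gt t) n y.

Lemma continuous_th t : continuous (th t).
Proof.
move=> y; apply/differentiable_continuous/derivable1_diffP.
by have [] := is_derive_thy t y.
Qed.

Lemma measurable_cos_th t : measurable_fun setT (fun y => cos (th t y)).
Proof.
apply: continuous_measurable_fun => y; apply: continuous_comp.
  exact: continuous_th.
exact: continuous_cos.
Qed.

Lemma measurable_sin_th t : measurable_fun setT (fun y => sin (th t y)).
Proof.
apply: continuous_measurable_fun => y; apply: continuous_comp.
  exact: continuous_th.
exact: continuous_sin.
Qed.

Lemma cos_norm_le1 x : `|cos x| <= 1.
Proof. by rewrite ler_norml cos_geN1 cos_le1. Qed.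
Lemma sin_norm_le1 x : `|sin x| <= 1.
Proof. by rewrite ler_norml sin_geN1 sin_le1. Qed.

Lemma dec_Kc t n : dec (Kc t n).
Proof.
apply: (@dec_bM _ _ _ 1 (measurable_cos_th t)); last exact: dec_hg.
by move=> x; exact: cos_norm_le1.
Qed.

Lemma dec_Ks t n : dec (Ks t n).
Proof.
apply: (@dec_bM _ _ _ 1 (measurable_sin_th t)); last exact: dec_hg.
by move=> x; exact: sin_norm_le1.
Qed.

Lemma sqi_Kc t n : sqi (Kc t n). Proof. exact/dec_sqi/dec_Kc. Qed.
Lemma sqi_Ks t n : sqi (Ks t n). Proof. exact/dec_sqi/dec_Ks. Qed.

Lemma mulX_Kc t n y : (y - gt t) * Kc t n y = X (Kc t ^~ y) n.
Proof. by rewrite /Kc mulrCA mulX_hg /opX; ring. Qed.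

Lemma mulX_Ks t n y : (y - gt t) * Ks t n y = X (Ks t ^~ y) n.
Proof. by rewrite /Ks mulrCA mulX_hg /opX; ring. Qed.

Lemma opXZ a (v : nat -> R) n : X (fun m => a * v m) n = a * X v n.
Proof. by rewrite /opX; ring. Qed.

Lemma is_derive_hg_gt n y t : is_derive t 1 (fun t => hg (gt t) n y)
  (- (2 * iota * cos t ^+ 2) * D (fun m => hg (gt t) m y) n).
Proof.
have E t' m : hg (gt t') m y = hg 0 m (y - gt t') by rewrite -hermiteE hermite_hg0.
under eq_fun do rewrite E.
have d1 : is_derive t 1 (fun t => y - gt t) (- (2 * iota * cos t ^+ 2)).
  have d := is_derive_gt t; apply: is_derive_eq.
  by rewrite add0r mul1r.
have := @is_derive1_comp R (hg 0 n) (fun t => y - gt t) t _ _ (is_derive_hg 0 n (y - gt t)) d1.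
by rewrite /opD !E mulrC.
Qed.

(** The generator in the rotating frame, seen on coefficients: [ka] is multiplication by a quadratic
    polynomial in the distance to the moving centre, [kb] the drift at speed [2 iota cos t ^ 2]. *)
Definition ka t (v : nat -> R) n : R :=
  kappa / 2 * X (X v) n - 2 * iota * sin t * cos t * X v n.
Definition kb t (v : nat -> R) n : R := 2 * iota * cos t ^+ 2 * D v n.

Lemma is_derive_Kc t n y : is_derive t 1 (fun t => Kc t n y)
  (- ka t (Ks t ^~ y) n - kb t (Kc t ^~ y) n).
Proof.
have d1 := is_derive_hg_gt n y t.
have d2 : is_derive t 1 (fun t => cos (th t y)) (- sin (th t y) *
  (kappa / 2 * (y - gt t) ^+ 2 - 2 * iota * sin t * cos t * (y - gt t))).
  exact: (@is_derive1_comp R cos (th ^~ y) t _ _ (is_derive_cos _) (is_derive_th t y)).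
rewrite /Kc; apply: is_derive_eq; rewrite /GRing.scale /= /ka /kb.
have -> : X (Ks t ^~ y) = fun m => (y - gt t) * Ks t m y.
  by apply/funext => m; rewrite mulX_Ks.
rewrite opXZ -mulX_Ks /Ks /opD /Kc; ring.
Qed.

Lemma is_derive_Ks t n y : is_derive t 1 (fun t => Ks t n y)
  (ka t (Kc t ^~ y) n - kb t (Ks t ^~ y) n).
Proof.
have d1 := is_derive_hg_gt n y t.
have d2 : is_derive t 1 (fun t => sin (th t y)) (cos (th t y) *
  (kappa / 2 * (y - gt t) ^+ 2 - 2 * iota * sin t * cos t * (y - gt t))).
  exact: (@is_derive1_comp R sin (th ^~ y) t _ _ (is_derive_sin _) (is_derive_th t y)).
rewrite /Ks; apply: is_derive_eq; rewrite /GRing.scale /= /ka /kb.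
have -> : X (Kc t ^~ y) = fun m => (y - gt t) * Kc t m y.
  by apply/funext => m; rewrite mulX_Kc.
rewrite opXZ -mulX_Kc /Kc /opD /Ks; ring.
Qed.

Lemma gt_bound t0 t : `|t - t0| < 1 -> `|gt t| <= `|iota| * (`|t0| + 2).
Proof.
move=> h; rewrite /gt normrM ler_wpM2l // (le_trans (ler_normD _ _)) //.
have h1 : `|t| <= `|t0| + 1.
  rewrite -[t](subrK t0) (le_trans (ler_normD _ _)) // addrC lerD2l ltW //.
have h2 : `|sin t * cos t| <= 1.
  by rewrite normrM mulr_ile1 // ?sin_norm_le1 ?cos_norm_le1.
lra.
Qed.

(** The domination required by [is_derive_ip]. Allowing any [v] and [w] below the Hermite functions
    lets it serve [Kc] and [Ks] alike. *)
Lemma kab_bound t0 n : exists C, forall t y (v w : nat -> R), `|t - t0| < 1 ->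
  (forall m, `|v m| <= `|hg (gt t) m y|) -> (forall m, `|w m| <= `|hg (gt t) m y|) ->
  `|ka t v n| + `|kb t w n| <= C * (oneDsqr y)^-1.
Proof.
have [C [C0 HC]] := hg_uniform_bounds n.+2 (`|iota| * (`|t0| + 2)).
exists ((`|kappa / 2| * (2 * n.+2%:R * (2 * n.+3%:R)) + `|2 * iota| * (2 * n.+2%:R) + `|2 * iota| * (2 * n.+2%:R)) * C).
move=> t y v w tt0 Hv Hw; set Y := (oneDsqr y)^-1.
have gb := gt_bound tt0.
have Y0 : 0 <= Y by rewrite invr_ge0 ltW // oneD_gt0.
have M0 : 0 <= C * Y by exact: mulr_ge0.
have v2 m : (m <= n.+2)%N -> `|v m| <= C * Y.
  by move=> mn; apply: (le_trans (Hv m)); exact: HC.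
have w1 m : (m <= n.+1)%N -> `|w m| <= C * Y.
  by move=> mn; apply: (le_trans (Hw m)); apply: HC => //; exact: leqW.
have X1 : `|X v n| <= 2 * n.+2%:R * (C * Y).
  by apply: opX_le => m mn; apply: v2; exact: leqW.
have X2 : `|X (X v) n| <= 2 * n.+2%:R * (2 * n.+3%:R * (C * Y)).
  apply: opX_le => m mn.
  have : `|X v m| <= 2 * m.+2%:R * (C * Y).
    by apply: opX_le => k km; apply: v2; exact: (leq_trans km).
  by move=> h; apply: (le_trans h); rewrite ler_wpM2r // ler_wpM2l // ler_nat !ltnS.
have D1 : `|D w n| <= 2 * n.+2%:R * (C * Y) by apply: opD_le => m mn; exact: w1.
rewrite /ka /kb.
have -> : (`|kappa / 2| * (2 * n.+2%:R * (2 * n.+3%:R)) + `|2 * iota| * (2 * n.+2%:R) + `|2 * iota| * (2 * n.+2%:R)) * C * Y =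
  `|kappa / 2| * (2 * n.+2%:R * (2 * n.+3%:R * (C * Y))) + `|2 * iota| * (2 * n.+2%:R * (C * Y)) + `|2 * iota| * (2 * n.+2%:R * (C * Y)) by ring.
apply: lerD; first apply: (le_trans (ler_normB _ _)); first apply: lerD.
- by rewrite normrM ler_wpM2l.
- rewrite -(mulrA (2 * iota)) 2!normrM ler_pM //.
  by rewrite ler_piMr // normrM mulr_ile1 ?sin_norm_le1 ?cos_norm_le1.
- rewrite 2!normrM ler_pM // ler_piMr // normrX exprn_ile1 ?cos_norm_le1 //.
Qed.

Definition Ec t (f : R -> R) n : R := ip f (Kc t n).
Definition Es t (f : R -> R) n : R := ip f (Ks t n).

Lemma sqi_ka t (v : nat -> R -> R) n : (forall m, sqi (v m)) -> sqi (fun y => ka t (v ^~ y) n).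
Proof.
move=> sv; have s1 m := sqi_opX m sv.
by apply: sqiB; apply: sqiZ => //; exact: (sqi_opX n s1).
Qed.

Lemma sqi_kb t (v : nat -> R -> R) n : (forall m, sqi (v m)) -> sqi (fun y => kb t (v ^~ y) n).
Proof. by move=> sv; apply: sqiZ; exact: sqi_opD. Qed.

Lemma ip_ka t (f : R -> R) (v : nat -> R -> R) n : sqi f -> (forall m, sqi (v m)) ->
  ip f (fun y => ka t (v ^~ y) n) = ka t (fun m => ip f (v m)) n.
Proof.
move=> sf sv; have s1 m := sqi_opX m sv.
rewrite ipC /ka ipBl //; first last.
- by apply: sqiZ.
- by apply: sqiZ; exact: (sqi_opX n s1).
rewrite !ipZl //; last exact: (sqi_opX n s1).
rewrite !(ipC _ f) (ip_opX n sf s1) ip_opX //.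
by congr (_ * opX _ _ _ - _); apply/funext => m; rewrite ip_opX.
Qed.

Lemma ip_kb t (f : R -> R) (v : nat -> R -> R) n : sqi f -> (forall m, sqi (v m)) ->
  ip f (fun y => kb t (v ^~ y) n) = kb t (fun m => ip f (v m)) n.
Proof.
move=> sf sv; rewrite ipC /kb ipZl //; last exact: sqi_opD.
by rewrite ipC ip_opD.
Qed.

Lemma Kc_le t n y : `|Kc t n y| <= `|hg (gt t) n y|.
Proof. by rewrite normrM ler_piMl // cos_norm_le1. Qed.
Lemma Ks_le t n y : `|Ks t n y| <= `|hg (gt t) n y|.
Proof. by rewrite normrM ler_piMl // sin_norm_le1. Qed.

Lemma is_derive_Ec (f : R -> R) t n : sqi f ->
  is_derive t 1 (fun t => Ec t f n) (- ka t (Es t f) n - kb t (Ec t f) n).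
Proof.
move=> sf; have [C HC] := kab_bound t n.
have := @is_derive_ip R f (fun t => Kc t n)
  (fun t y => - ka t (Ks t ^~ y) n - kb t (Kc t ^~ y) n) C t sf.
have sk : sqi (fun y => ka t (Ks t ^~ y) n) by apply: sqi_ka => m; exact: sqi_Ks.
have sk' : sqi (fun y => kb t (Kc t ^~ y) n) by apply: sqi_kb => m; exact: sqi_Kc.
rewrite ipC ipBl //; last exact: sqiN.
rewrite ipNl // !(ipC _ f) ip_ka //; last by move=> m; exact: sqi_Ks.
rewrite ip_kb //; last by move=> m; exact: sqi_Kc.
apply.
- by move=> t'; exact: sqi_Kc.
- by move=> t' y; exact: is_derive_Kc.
- move=> t' y h; apply: le_trans (HC t' y (Ks t' ^~ y) (Kc t' ^~ y) h _ _).
  + by apply: (le_trans (ler_normB _ _)); rewrite normrN.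
  + by move=> m; exact: Ks_le.
  + by move=> m; exact: Kc_le.
Qed.

Lemma is_derive_Es (f : R -> R) t n : sqi f ->
  is_derive t 1 (fun t => Es t f n) (ka t (Ec t f) n - kb t (Es t f) n).
Proof.
move=> sf; have [C HC] := kab_bound t n.
have := @is_derive_ip R f (fun t => Ks t n)
  (fun t y => ka t (Kc t ^~ y) n - kb t (Ks t ^~ y) n) C t sf.
have sk : sqi (fun y => ka t (Kc t ^~ y) n) by apply: sqi_ka => m; exact: sqi_Kc.
have sk' : sqi (fun y => kb t (Ks t ^~ y) n) by apply: sqi_kb => m; exact: sqi_Ks.
rewrite ipC ipBl // !(ipC _ f) ip_ka //; last by move=> m; exact: sqi_Kc.
rewrite ip_kb //; last by move=> m; exact: sqi_Ks.
apply.
- by move=> t'; exact: sqi_Ks.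
- by move=> t' y; exact: is_derive_Ks.
- move=> t' y h; apply: le_trans (HC t' y (Kc t' ^~ y) (Ks t' ^~ y) h _ _).
  + by apply: (le_trans (ler_normB _ _)).
  + by move=> m; exact: Kc_le.
  + by move=> m; exact: Ks_le.
Qed.

Lemma is_derive_Kcy t n y : is_derive y 1 (Kc t n)
  (- (kappa * t * y + be t) * Ks t n y + D (Kc t ^~ y) n).
Proof.
have d1 := is_derive_hg (gt t) n y.
have d2 := @is_derive1_comp R cos (th t) y _ _ (is_derive_cos _) (is_derive_thy t y).
rewrite /Kc; apply: is_derive_eq; rewrite /GRing.scale /= /opD /Ks; ring.
Qed.

Lemma is_derive_Ksy t n y : is_derive y 1 (Ks t n)
  ((kappa * t * y + be t) * Kc t n y + D (Ks t ^~ y) n).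
Proof.
have d1 := is_derive_hg (gt t) n y.
have d2 := @is_derive1_comp R sin (th t) y _ _ (is_derive_sin _) (is_derive_thy t y).
rewrite /Ks; apply: is_derive_eq; rewrite /GRing.scale /= /opD /Kc; ring.
Qed.

Lemma continuous_Kc t n : continuous (Kc t n).
Proof.
move=> y; apply/differentiable_continuous/derivable1_diffP.
by have [] := is_derive_Kcy t n y.
Qed.

Lemma continuous_Ks t n : continuous (Ks t n).
Proof.
move=> y; apply/differentiable_continuous/derivable1_diffP.
by have [] := is_derive_Ksy t n y.
Qed.

Lemma continuous_hg (g : R) n : continuous (hg g n).
Proof. exact: continuous_gpoly. Qed.

Lemma contM (f h : R -> R) : continuous f -> continuous h -> continuous (fun x => f x * h x).
Proof. by move=> cf ch x; apply: cvgM; [exact: cf|exact: ch]. Qed.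

Lemma contD (f h : R -> R) : continuous f -> continuous h -> continuous (fun x => f x + h x).
Proof. by move=> cf ch x; apply: cvgD; [exact: cf|exact: ch]. Qed.

Lemma contB (f h : R -> R) : continuous f -> continuous h -> continuous (fun x => f x - h x).
Proof. by move=> cf ch x; apply: cvgB; [exact: cf|exact: ch]. Qed.

Lemma contZ (f : R -> R) a : continuous f -> continuous (fun x => a * f x).
Proof. by apply: contM => x; exact: cvg_cst. Qed.

Lemma continuous_opX (v : nat -> R -> R) n : (forall m, continuous (v m)) ->
  continuous (fun y => X (v ^~ y) n).
Proof. by move=> cv; apply: contD; exact: contZ. Qed.

Lemma continuous_opD (v : nat -> R -> R) n : (forall m, continuous (v m)) ->
  continuous (fun y => D (v ^~ y) n).
Proof. by move=> cv; apply: contB; exact: contZ. Qed.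

Lemma opX_hg0 m y : X (hg 0 ^~ y) m = y * hg 0 m y.
Proof. by rewrite /opX -mulX_hg subr0. Qed.

(** On the kernel [opX] in [n] is multiplication by [y - gt t]; on [hg 0 m] the same operator in [m]
    is multiplication by [y]. The shift is the difference. *)
Lemma EcX t m n : X (Ec t (hg 0 m)) n =
  X (fun k => Ec t (hg 0 k) n) m - gt t * Ec t (hg 0 m) n.
Proof.
have s0 := @sqi_hg R 0; have sk := sqi_Kc t.
rewrite -(ip_opX n (s0 m) sk).
have -> : X (fun k => Ec t (hg 0 k) n) m = ip (Kc t n) (fun y => X ((hg 0) ^~ y) m).
  by rewrite ip_opX //; congr opX; apply/funext => k; rewrite /Ec ipC.
rewrite /Ec -ipZl // /ip -intB; first last.
- by apply: sqi_ipi => //; exact: sqiZ.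
- by apply: sqi_ipi => //; exact: sqi_opX.
congr int; apply/funext => y; rewrite -mulX_Kc opX_hg0; ring.
Qed.

Lemma EsX t m n : X (Es t (hg 0 m)) n =
  X (fun k => Es t (hg 0 k) n) m - gt t * Es t (hg 0 m) n.
Proof.
have s0 := @sqi_hg R 0; have sk := sqi_Ks t.
rewrite -(ip_opX n (s0 m) sk).
have -> : X (fun k => Es t (hg 0 k) n) m = ip (Ks t n) (fun y => X ((hg 0) ^~ y) m).
  by rewrite ip_opX //; congr opX; apply/funext => k; rewrite /Es ipC.
rewrite /Es -ipZl // /ip -intB; first last.
- by apply: sqi_ipi => //; exact: sqiZ.
- by apply: sqi_ipi => //; exact: sqi_opX.
congr int; apply/funext => y; rewrite -mulX_Ks opX_hg0; ring.
Qed.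

(** The product of [hg 0 m] and [Kc t n] has a derivative of integral 0; the phase contributes its
    slope [kappa t y + be t] times [Ks t n]. *)
Lemma EcD t m n : D (Ec t (hg 0 m)) n =
  - D (fun k => Ec t (hg 0 k) n) m + kappa * t * X (fun k => Es t (hg 0 k) n) m
  + be t * Es t (hg 0 m) n.
Proof.
have s0 := @sqi_hg R 0; have sk := sqi_Kc t; have ss := sqi_Ks t.
rewrite -(ip_opD n (s0 m) sk).
have -> : D (fun k => Ec t (hg 0 k) n) m = ip (Kc t n) (fun y => D ((hg 0) ^~ y) m).
  by rewrite ip_opD //; congr opD; apply/funext => k; rewrite /Ec ipC.
have -> : X (fun k => Es t (hg 0 k) n) m = ip (Ks t n) (fun y => X ((hg 0) ^~ y) m).
  by rewrite ip_opX //; congr opX; apply/funext => k; rewrite /Es ipC.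
have i1 : integ (fun y => hg 0 m y * D (Kc t ^~ y) n).
  by apply: sqi_ipi => //; exact: sqi_opD.
have i2 : integ (fun y => Kc t n y * D ((hg 0) ^~ y) m).
  by apply: sqi_ipi => //; exact: sqi_opD.
have i3 : integ (fun y => Ks t n y * X ((hg 0) ^~ y) m).
  by apply: sqi_ipi => //; exact: sqi_opX.
have i4 : integ (fun y => hg 0 m y * Ks t n y) by exact: sqi_ipi.
have i5 := integD i1 i2.
have i6 := integD (integZ (kappa * t) i3) (integZ (be t) i4).
have Z : int (fun y => (hg 0 m y * D (Kc t ^~ y) n + Kc t n y * D ((hg 0) ^~ y) m) -
    (kappa * t * (Ks t n y * X ((hg 0) ^~ y) m) + be t * (hg 0 m y * Ks t n y))) = 0.
  apply: (@int_derive0 R (fun y => hg 0 m y * Kc t n y)).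
  - have ck := @continuous_Kc t; have cs := @continuous_Ks t.
    have ch := @continuous_hg 0.
    apply: contB; apply: contD.
    + exact: contM (ch m) (continuous_opD ck).
    + exact: contM (ck n) (continuous_opD ch).
    + exact/contZ/(contM (cs n) (continuous_opX ch)).
    + exact/contZ/(contM (ch m) (cs n)).
  - move=> y; have d1 := is_derive_hg 0 m y; have d2 := is_derive_Kcy t n y.
    apply: is_derive_eq; rewrite /GRing.scale /= opX_hg0 /opD; ring.
  - by apply: dec_M; [exact: dec_hg|exact: dec_Kc].
  - exact: integB.
move: Z; rewrite intB // intD // intD; [|exact: integZ|exact: integZ].
rewrite (intZ _ i3) (intZ _ i4) -/(ip (hg 0 m) (fun y => D (Kc t ^~ y) n)).
rewrite -/(ip (Kc t n) _) -/(ip (Ks t n) _) -/(ip (hg 0 m) (Ks t n)) /Es.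
move: (ip _ _) (ip _ _) (ip _ _) (ip _ _) => a b c d Z.
by rewrite -[LHS]subr0 -Z; ring.
Qed.

Lemma EsD t m n : D (Es t (hg 0 m)) n =
  - D (fun k => Es t (hg 0 k) n) m - kappa * t * X (fun k => Ec t (hg 0 k) n) m
  - be t * Ec t (hg 0 m) n.
Proof.
have s0 := @sqi_hg R 0; have sk := sqi_Kc t; have ss := sqi_Ks t.
rewrite -(ip_opD n (s0 m) ss).
have -> : D (fun k => Es t (hg 0 k) n) m = ip (Ks t n) (fun y => D ((hg 0) ^~ y) m).
  by rewrite ip_opD //; congr opD; apply/funext => k; rewrite /Es ipC.
have -> : X (fun k => Ec t (hg 0 k) n) m = ip (Kc t n) (fun y => X ((hg 0) ^~ y) m).
  by rewrite ip_opX //; congr opX; apply/funext => k; rewrite /Ec ipC.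
have i1 : integ (fun y => hg 0 m y * D (Ks t ^~ y) n).
  by apply: sqi_ipi => //; exact: sqi_opD.
have i2 : integ (fun y => Ks t n y * D ((hg 0) ^~ y) m).
  by apply: sqi_ipi => //; exact: sqi_opD.
have i3 : integ (fun y => Kc t n y * X ((hg 0) ^~ y) m).
  by apply: sqi_ipi => //; exact: sqi_opX.
have i4 : integ (fun y => hg 0 m y * Kc t n y) by exact: sqi_ipi.
have i5 := integD i1 i2.
have i6 := integD (integZ (kappa * t) i3) (integZ (be t) i4).
have Z : int (fun y => (hg 0 m y * D (Ks t ^~ y) n + Ks t n y * D ((hg 0) ^~ y) m) +
    (kappa * t * (Kc t n y * X ((hg 0) ^~ y) m) + be t * (hg 0 m y * Kc t n y))) = 0.
  apply: (@int_derive0 R (fun y => hg 0 m y * Ks t n y)).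
  - have ck := @continuous_Kc t; have cs := @continuous_Ks t.
    have ch := @continuous_hg 0.
    apply: contD; apply: contD.
    + exact: contM (ch m) (continuous_opD cs).
    + exact: contM (cs n) (continuous_opD ch).
    + exact/contZ/(contM (ck n) (continuous_opX ch)).
    + exact/contZ/(contM (ch m) (ck n)).
  - move=> y; have d1 := is_derive_hg 0 m y; have d2 := is_derive_Ksy t n y.
    apply: is_derive_eq; rewrite /GRing.scale /= opX_hg0 /opD; ring.
  - by apply: dec_M; [exact: dec_hg|exact: dec_Ks].
  - exact: integD.
move: Z; rewrite intD // intD // intD; [|exact: integZ|exact: integZ].
rewrite (intZ _ i3) (intZ _ i4) -/(ip (hg 0 m) (fun y => D (Ks t ^~ y) n)).
rewrite -/(ip (Ks t n) _) -/(ip (Kc t n) _) -/(ip (hg 0 m) (Kc t n)) /Ec.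
move: (ip _ _) (ip _ _) (ip _ _) (ip _ _) => a b c d Z.
by rewrite -[LHS]subr0 -Z; ring.
Qed.

Definition BC n : R[i] := (Bc n)%:C.
Local Notation XC := (opX BC).
Local Notation DC := (opD BC).
Implicit Types (psi : R -> R[i]) (b v w : nat -> R[i]).

Lemma Re_opX v n : complex.Re (XC v n) = X (fun m => complex.Re (v m)) n.
Proof. by rewrite /opX /BC; case: (v n.+1) => ? ?; case: (v n.-1) => ? ? /=; ring. Qed.
Lemma Im_opX v n : complex.Im (XC v n) = X (fun m => complex.Im (v m)) n.
Proof. by rewrite /opX /BC; case: (v n.+1) => ? ?; case: (v n.-1) => ? ? /=; ring. Qed.
Lemma Re_opD v n : complex.Re (DC v n) = D (fun m => complex.Re (v m)) n.
Proof. by rewrite /opD /BC; case: (v n.+1) => ? ?; case: (v n.-1) => ? ? /=; ring. Qed.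
Lemma Im_opD v n : complex.Im (DC v n) = D (fun m => complex.Im (v m)) n.
Proof. by rewrite /opD /BC; case: (v n.+1) => ? ?; case: (v n.-1) => ? ? /=; ring. Qed.

Lemma complex_eq (z z' : R[i]) : complex.Re z = complex.Re z' ->
  complex.Im z = complex.Im z' -> z = z'.
Proof. by case: z => ? ?; case: z' => ? ? /= -> ->. Qed.

Lemma Re_mul (z z' : R[i]) : complex.Re (z * z') =
  complex.Re z * complex.Re z' - complex.Im z * complex.Im z'.
Proof. by case: z => ? ?; case: z'. Qed.
Lemma Im_mul (z z' : R[i]) : complex.Im (z * z') =
  complex.Re z * complex.Im z' + complex.Im z * complex.Re z'.
Proof. by case: z => ? ?; case: z'. Qed.
Lemma Re_add (z z' : R[i]) : complex.Re (z + z') = complex.Re z + complex.Re z'.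
Proof. by case: z => ? ?; case: z'. Qed.
Lemma Im_add (z z' : R[i]) : complex.Im (z + z') = complex.Im z + complex.Im z'.
Proof. by case: z => ? ?; case: z'. Qed.
Lemma Re_opp (z : R[i]) : complex.Re (- z) = - complex.Re z.
Proof. by case: z. Qed.
Lemma Im_opp (z : R[i]) : complex.Im (- z) = - complex.Im z.
Proof. by case: z. Qed.

Lemma Re_iM (z : R[i]) : complex.Re ('i * z) = - complex.Im z.
Proof. by case: z => ? ? /=; ring. Qed.
Lemma Im_iM (z : R[i]) : complex.Im ('i * z) = complex.Re z.
Proof. by case: z => ? ? /=; ring. Qed.
Lemma Re_CM a (z : R[i]) : complex.Re (a%:C * z) = a * complex.Re z.
Proof. by case: z => ? ? /=; ring. Qed.
Lemma Im_CM a (z : R[i]) : complex.Im (a%:C * z) = a * complex.Im z.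
Proof. by case: z => ? ? /=; ring. Qed.

(* matrix of the flow in the Hermite basis *)
Definition gmx t m n : R[i] := Ec t (hg 0 m) n +i* Es t (hg 0 m) n.

Lemma gmx_X t m n : XC (gmx t m) n = XC (fun k => gmx t k n) m - (gt t)%:C * gmx t m n.
Proof.
apply: complex_eq.
  by rewrite Re_opX Re_add Re_opX Re_opp Re_CM; exact: EcX.
by rewrite Im_opX Im_add Im_opX Im_opp Im_CM; exact: EsX.
Qed.

Lemma gmx_D t m n : DC (gmx t m) n = - DC (fun k => gmx t k n) m
  - 'i * ((kappa * t)%:C * XC (fun k => gmx t k n) m + (be t)%:C * gmx t m n).
Proof.
apply: complex_eq.
  rewrite Re_opD Re_add 2!Re_opp Re_opD Re_iM Im_add !Im_CM Im_opX opprK addrA.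
  exact: EcD.
rewrite Im_opD Im_add 2!Im_opp Im_opD Im_iM Re_add !Re_CM Re_opX (EsD t m n) -addrA -opprD.
by [].
Qed.

Definition wave t psi : R -> R[i] := fun y => (cos (th t y) +i* sin (th t y)) * psi y.

(* coefficients of [wave t psi] in the Hermite basis centred at [gt t] *)
Definition cw t psi n : R[i] := (Ec t (re psi) n - Es t (im psi) n) +i*
  (Es t (re psi) n + Ec t (im psi) n).

Lemma re_wave t psi : re (wave t psi) =
  (fun y => cos (th t y) * re psi y - sin (th t y) * im psi y).
Proof. by apply/funext => y; rewrite /re /im /wave Re_mul. Qed.
Lemma im_wave t psi : im (wave t psi) =
  (fun y => sin (th t y) * re psi y + cos (th t y) * im psi y).
Proof. by apply/funext => y; rewrite /re /im /wave Im_mul /= addrC. Qed.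

Lemma sqi_bM (f h : R -> R) : measurable_fun setT f -> (forall y, `|f y| <= 1) -> sqi h ->
  sqi (fun y => f y * h y).
Proof.
move=> mf f1 sh; apply: (@sqi_le _ _ h) => //.
  by apply: measurable_funM => //; exact: sqi_meas.
by move=> y; rewrite normrM ler_piMl.
Qed.

Lemma csqi_wave t psi : csqi psi -> csqi (wave t psi).
Proof.
move=> [sr si]; have mc := measurable_cos_th t; have ms := measurable_sin_th t.
have c1 y := cos_norm_le1 (th t y); have s1 y := sin_norm_le1 (th t y).
split; rewrite ?re_wave ?im_wave.
  by apply: sqiB; exact: sqi_bM.
by apply: sqiD; exact: sqi_bM.
Qed.

Lemma nrm2_wave t psi : csqi psi -> nrm2 (wave t psi) = nrm2 psi.
Proof.
move=> sp; rewrite !nrm2_int //; last exact: csqi_wave.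
congr int; apply/funext => y; rewrite /wave /sqn Re_mul Im_mul /=.
have := cos2Dsin2 (th t y); set c := cos _; set s := sin _ => e.
transitivity ((c ^+ 2 + s ^+ 2) * (complex.Re (psi y) ^+ 2 + complex.Im (psi y) ^+ 2)).
  by ring.
by rewrite e mul1r.
Qed.

Lemma cw_wave t psi n : csqi psi -> cw t psi n =
  ip (re (wave t psi)) (hg (gt t) n) +i* ip (im (wave t psi)) (hg (gt t) n).
Proof.
move=> [sr si]; have mc := measurable_cos_th t; have ms := measurable_sin_th t.
have c1 y := cos_norm_le1 (th t y); have s1 y := sin_norm_le1 (th t y).
have sh := sqi_hg (gt t) n.
rewrite re_wave im_wave ipBl //; try exact: sqi_bM.
rewrite ipDl //; try exact: sqi_bM.
rewrite /cw /Ec /Es /ip; congr ((_ - _) +i* (_ + _)); congr int; apply/funext => y;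
  rewrite /Kc /Ks; ring.
Qed.

(** Multiplication by [exp (i th)] is unitary and the translated Hermite functions are again a
    complete orthonormal system, hence conservation of mass. *)
Lemma cw_parseval t psi : csqi psi ->
  \sum_(n < N) sqn (cw t psi n) @[N --> \oo] --> nrm2 psi.
Proof.
move=> sp; have [sr si] := csqi_wave t sp.
under eq_fun do under eq_bigr do rewrite (cw_wave t _ sp) /sqn /=.
under eq_fun do rewrite big_split /=.
by rewrite -(nrm2_wave t sp) /nrm2; apply: cvgD; exact: hg_parseval.
Qed.

Lemma cw_bessel t psi N : csqi psi -> \sum_(n < N) sqn (cw t psi n) <= nrm2 psi.
Proof.
move=> sp; have [sr si] := csqi_wave t sp.
under eq_bigr do rewrite (cw_wave t _ sp) /sqn /=.
by rewrite big_split /= -(nrm2_wave t sp) /nrm2; apply: lerD; exact: hg_bessel.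
Qed.

Lemma cwB t psi psi' n : csqi psi -> csqi psi' ->
  cw t (fun x => psi x - psi' x) n = cw t psi n - cw t psi' n.
Proof.
move=> [r i] [r' i'].
have sk := sqi_Kc t n; have ss := sqi_Ks t n.
have Er : re (fun x => psi x - psi' x) = fun x => re psi x - re psi' x.
  by apply/funext => x; rewrite /re Re_add Re_opp.
have Ei : im (fun x => psi x - psi' x) = fun x => im psi x - im psi' x.
  by apply/funext => x; rewrite /im Im_add Im_opp.
rewrite /cw /Ec /Es Er Ei !ipBl //.
by apply: complex_eq => /=; rewrite ?Re_add ?Im_add ?Re_opp ?Im_opp /=; ring.
Qed.

Definition csum b M : R -> R[i] := fun x => \sum_(m < M) b m * (hg 0 m x)%:C.

Lemma re_csum b M : re (csum b M) = hsum 0 (fun m => complex.Re (b m)) M.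
Proof.
apply/funext => x; rewrite /re /csum Re_sum; apply: eq_bigr => m _.
by rewrite Re_mul /= mulr0 subr0.
Qed.
Lemma im_csum b M : im (csum b M) = hsum 0 (fun m => complex.Im (b m)) M.
Proof.
apply/funext => x; rewrite /im /csum Im_sum; apply: eq_bigr => m _.
by rewrite Im_mul /= mulr0 add0r.
Qed.

Lemma csqi_csum b M : csqi (csum b M).
Proof. by split; rewrite ?re_csum ?im_csum; exact: sqi_hsum. Qed.

Lemma nrm2_csum b M : nrm2 (csum b M) = \sum_(m < M) sqn (b m).
Proof. by rewrite /nrm2 re_csum im_csum !ip_hsum_sq -big_split. Qed.

Lemma nrm2_sub_csum psi M : csqi psi ->
  nrm2 (fun x => psi x - csum (hcoef psi) M x) = nrm2 psi - \sum_(m < M) sqn (hcoef psi m).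
Proof.
move=> [sr si]; rewrite nrm2B re_csum im_csum.
have -> : (fun m => complex.Re (hcoef psi m)) = (fun m => ip (re psi) (hg 0 m)).
  by apply/funext => m; rewrite hcoefE.
have -> : (fun m => complex.Im (hcoef psi m)) = (fun m => ip (im psi) (hg 0 m)).
  by apply/funext => m; rewrite hcoefE.
rewrite !ip_sub_hsum // /nrm2.
under [X in _ = _ - X]eq_bigr do rewrite hcoefE /sqn.
by rewrite big_split /=; ring.
Qed.

Lemma cw_csum t b M n : cw t (csum b M) n = \sum_(m < M) b m * gmx t m n.
Proof.
apply: complex_eq; rewrite ?Re_sum ?Im_sum /cw /Ec /Es re_csum im_csum /=.
  rewrite !ip_hsum; try exact: sqi_Kc; try exact: sqi_Ks.
  by rewrite -sumrB; apply: eq_bigr => m _; rewrite Re_mul.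
rewrite !ip_hsum; try exact: sqi_Kc; try exact: sqi_Ks.
by rewrite -big_split; apply: eq_bigr => m _; rewrite Im_mul.
Qed.

Lemma cw0 psi n : cw 0 psi n = hcoef psi n.
Proof.
have t0 y : th 0 y = 0.
  by rewrite /th /be /ga sin0 cos0 /=; field.
have g0 : gt 0 = 0 by rewrite /gt sin0; ring.
have -> : cw 0 psi n = (ip (re psi) (hg 0 n) - 0) +i* (0 + ip (im psi) (hg 0 n)).
  rewrite /cw /Ec /Es; congr ((_ - _) +i* (_ + _)).
  - by congr (ip _ _); apply/funext => y; rewrite /Kc t0 cos0 g0 mul1r.
  - rewrite /ip -[RHS](@int0 R); congr int; apply/funext => y.
    by rewrite /Ks t0 sin0 mul0r mulr0.
  - rewrite /ip -[RHS](@int0 R); congr int; apply/funext => y.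
    by rewrite /Ks t0 sin0 mul0r mulr0.
  - by congr (ip _ _); apply/funext => y; rewrite /Kc t0 cos0 g0 mul1r.
by rewrite hcoefE subr0 add0r.
Qed.

Definition kac t v n : R[i] := (kappa / 2)%:C * XC (XC v) n - (2 * iota * sin t * cos t)%:C * XC v n.
Definition kbc t v n : R[i] := (2 * iota * cos t ^+ 2)%:C * DC v n.

Lemma kaD t (v w : nat -> R) n : ka t (fun m => v m + w m) n = ka t v n + ka t w n.
Proof. by rewrite /ka /opX; ring. Qed.
Lemma kaB t (v w : nat -> R) n : ka t (fun m => v m - w m) n = ka t v n - ka t w n.
Proof. by rewrite /ka /opX; ring. Qed.
Lemma kbD t (v w : nat -> R) n : kb t (fun m => v m + w m) n = kb t v n + kb t w n.
Proof. by rewrite /kb /opD; ring. Qed.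
Lemma kbB t (v w : nat -> R) n : kb t (fun m => v m - w m) n = kb t v n - kb t w n.
Proof. by rewrite /kb /opD; ring. Qed.

Lemma Re_kac t v n : complex.Re (kac t v n) = ka t (fun m => complex.Re (v m)) n.
Proof.
rewrite /kac /ka Re_add Re_opp !Re_CM !Re_opX; congr (_ * opX _ _ _ - _).
by apply/funext => m; rewrite Re_opX.
Qed.
Lemma Im_kac t v n : complex.Im (kac t v n) = ka t (fun m => complex.Im (v m)) n.
Proof.
rewrite /kac /ka Im_add Im_opp !Im_CM !Im_opX; congr (_ * opX _ _ _ - _).
by apply/funext => m; rewrite Im_opX.
Qed.
Lemma Re_kbc t v n : complex.Re (kbc t v n) = kb t (fun m => complex.Re (v m)) n.
Proof. by rewrite /kbc /kb Re_CM Re_opD. Qed.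
Lemma Im_kbc t v n : complex.Im (kbc t v n) = kb t (fun m => complex.Im (v m)) n.
Proof. by rewrite /kbc /kb Im_CM Im_opD. Qed.

Lemma is_cderive_cw t psi n : csqi psi ->
  is_cderive (fun t => cw t psi n) t ('i * kac t (cw t psi) n - kbc t (cw t psi) n).
Proof.
move=> [sr si].
have dcr := is_derive_Ec t n sr; have dsr := is_derive_Es t n sr.
have dci := is_derive_Ec t n si; have dsi := is_derive_Es t n si.
split.
  rewrite Re_add Re_opp Re_iM Im_kac Re_kbc (kaD t (Es t (re psi)) (Ec t (im psi))).
  rewrite (kbB t (Ec t (re psi)) (Es t (im psi))) /cw /=.
  by apply: is_derive_eq; ring.
rewrite Im_add Im_opp Im_iM Re_kac Im_kbc (kaB t (Ec t (re psi)) (Es t (im psi))).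
rewrite (kbD t (Es t (re psi)) (Ec t (im psi))) /cw /=.
by apply: is_derive_eq; ring.
Qed.

End Flow.

(** * Interpolation *)

Section Interpolation.
Context {R : realType}.
Implicit Types (s p mu x y : R) (j n m : nat).

Definition lam j : R := 2 * j%:R + 1.

Lemma lam_ge1 j : 1 <= lam j. Proof. by rewrite /lam lerDr mulr_ge0. Qed.
Lemma lam_gt0 j : 0 < lam j. Proof. exact: lt_le_trans (lam_ge1 j). Qed.
Lemma lam_le j m : (j <= m)%N -> lam j <= lam m.
Proof. by move=> jm; rewrite /lam lerD2r ler_wpM2l // ler_nat. Qed.

Lemma wtE s j : wt s j = lam j `^ s. Proof. by []. Qed.
Lemma wt_gt0 s j : 0 < wt s j. Proof. by rewrite wtE powR_gt0 // lam_gt0. Qed.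
Lemma wt_ge1 s j : 0 <= s -> 1 <= wt s j.
Proof. by move=> s0; rewrite -(powRr0 (lam j)) ler_powR ?lam_ge1. Qed.
Lemma wt_le s j m : 0 <= s -> (j <= m)%N -> wt s j <= wt s m.
Proof.
move=> s0 jm; have l0 i := ltW (lam_gt0 i).
by apply: ge0_ler_powR; rewrite ?nnegrE ?l0 ?lam_le.
Qed.
Lemma wtN s j : wt (- s) j = (wt s j)^-1. Proof. by rewrite !wtE powRN. Qed.

Lemma powR_le_neg s x y : s <= 0 -> 0 < x -> x <= y -> y `^ s <= x `^ s.
Proof.
move=> s0 x0 xy; have y0 := lt_le_trans x0 xy.
rewrite -[s]opprK !(powRN _ (- s)) lef_pV2 ?posrE ?powR_gt0 //.
by apply: ge0_ler_powR; rewrite ?oppr_ge0 ?nnegrE ?(ltW x0) ?(ltW y0).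
Qed.

(** The claim is [2 y ^ (s - p) <= x ^ (s - p) + x ^ s y ^ - p]. The right-hand side is at least
    twice the geometric mean [x ^ (s - p / 2) y ^ (- p / 2)], and [2 s <= p] makes [r ^ (s - p / 2)]
    nonincreasing in [r]. *)
Lemma powR_mono_diff s p x y : 2 * s <= p -> 0 < x -> x <= y ->
  (y `^ s - x `^ s) * y `^ (- p) <= x `^ (s - p) - y `^ (s - p).
Proof.
move=> sp x0 xy; have y0 := lt_le_trans x0 xy.
have nx : x != 0 by rewrite gt_eqF.
have ny : y != 0 by rewrite gt_eqF.
have D z u v : z != 0 -> z `^ (u + v) = z `^ u * z `^ v.
  by move=> z0; rewrite powRD //; apply/implyP.
rewrite mulrBl -D //.
set a := x `^ ((s - p) / 2); set b := x `^ (s / 2) * y `^ (- p / 2).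
have E1 : x `^ (s - p) = a ^+ 2 by rewrite expr2 -D //; congr (_ `^ _); field.
have E2 : x `^ s * y `^ (- p) = b ^+ 2.
  by rewrite exprMn !expr2 -!D //; congr (_ `^ _ * _ `^ _); field.
have E3 : y `^ (s - p) <= a * b.
  rewrite /a /b mulrA -D // -(@ler_pM2r _ (y `^ (p / 2))) ?powR_gt0 //.
  rewrite -mulrA -!D //.
  have -> : (s - p) / 2 + s / 2 = s - p / 2 by field.
  have -> : s - p + p / 2 = s - p / 2 by field.
  have -> : - p / 2 + p / 2 = 0 by field.
  by rewrite powRr0 mulr1; apply: powR_le_neg => //; lra.
rewrite E1 E2; have := sqr_ge0 (a - b); nra.
Qed.

(** The increments by which [abel_dwt] turns a weighted sum into a combination of tails, the
    quantities on which the flow can be estimated. *)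
Definition dwt s j : R := if j is i.+1 then wt s j - wt s i else wt s 0.

Lemma dwt_ge0 s j : 0 <= s -> 0 <= dwt s j.
Proof. by case: j => [|j] s0; rewrite /dwt ?wt_ge0 // subr_ge0 wt_le. Qed.

Lemma sum_dwt s n : \sum_(j < n.+1) dwt s j = wt s n.
Proof.
elim: n => [|n IH]; first by rewrite big_ord1.
by rewrite big_ord_recr /= IH; ring.
Qed.

Lemma sum_dwt_le s mu J : 0 <= s -> 0 <= mu ->
  \sum_(j < J) dwt s j * (lam j <= mu)%R%:R <= mu `^ s.
Proof.
move=> s0 m0; elim: J => [|J IH]; first by rewrite big_ord0 powR_ge0.
have [h|h] := leP (lam J) mu; last first.
  by rewrite big_ord_recr /= (leNgt (lam J)) h mulr0 addr0.
rewrite (eq_bigr (fun j : 'I_J.+1 => dwt s j)).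
  by rewrite sum_dwt; apply: ge0_ler_powR; rewrite ?nnegrE ?(ltW (lam_gt0 J)).
move=> j _; rewrite (le_trans (lam_le _) h) ?mulr1 // -ltnS; exact: ltn_ord.
Qed.

(** Discrete version of integrating [r ^ (- p)] against [d(r ^ s)] beyond [mu]. The first level
    beyond [mu] contributes at most [mu ^ (s - p)], and [powR_mono_diff] makes the later ones
    telescope. *)
Lemma sum_dwt_gt s p mu J : 0 <= s -> 2 * s <= p -> 0 < mu ->
  \sum_(j < J) dwt s j * wt (- p) j * (mu < lam j)%R%:R <= 2 * mu `^ (s - p).
Proof.
move=> s0 sp m0.
have sp0 : s - p <= 0 by lra.
have dle j : dwt s j * wt (- p) j <= wt (s - p) j.
  rewrite wtD ler_wpM2r ?wt_ge0 //; case: j => [|j] //=.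
  by rewrite lerBlDr lerDl wt_ge0.
(* The subtracted term is what the telescoping has not yet used; it makes the induction close. *)
have key : forall J, \sum_(j < J.+1) dwt s j * wt (- p) j * (mu < lam j)%R%:R <=
    if mu < lam J then 2 * mu `^ (s - p) - wt (s - p) J else 0.
  elim=> [|K IH].
    rewrite big_ord1; case: ifP => h; last by rewrite mulr0.
    rewrite mulr1 (le_trans (dle 0%N)) //.
    have := powR_le_neg sp0 m0 (ltW h); rewrite -wtE; lra.
  rewrite big_ord_recr /=; have [h|h] := ltP mu (lam K.+1); last first.
    rewrite mulr0 addr0 (le_trans IH) // ifF //; apply/negbTE; rewrite -leNgt.
    exact: le_trans (lam_le (leqnSn K)) h.
  rewrite mulr1; move: IH; have [h'|h'] := ltP mu (lam K) => IH.
    have := powR_mono_diff sp (lam_gt0 K) (lam_le (leqnSn K)).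
    by rewrite -!wtE; lra.
  have := powR_le_neg sp0 m0 (ltW h); rewrite -wtE.
  by have := dle K.+1 => /=; lra.
case: J => [|J]; first by rewrite big_ord0 mulr_ge0 // powR_ge0.
apply: (le_trans (key J)); case: ifP => _; last by rewrite mulr_ge0 // powR_ge0.
by rewrite lerBlDr lerDl wt_ge0.
Qed.

Lemma abel_dwt s (e : nat -> R) J :
  \sum_(n < J) wt s n * e n = \sum_(j < J) dwt s j * \sum_(j <= n < J) e n.
Proof.
elim: J => [|J IH]; first by rewrite !big_ord0.
rewrite big_ord_recr /= IH.
have -> : \sum_(j < J.+1) dwt s j * (\sum_(j <= n < J.+1) e n) =
    \sum_(j < J.+1) (dwt s j * (\sum_(j <= n < J) e n) + dwt s j * e J).
  by apply: eq_bigr => j _; rewrite -mulrDr -big_nat_recr //= -ltnS.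
rewrite big_split /= -mulr_suml sum_dwt; congr (_ + _).
by rewrite big_ord_recr /= big_geq // mulr0 addr0.
Qed.

(* Interpolation of the exponents 0 and p: splitting the data at level L and
   bounding the tails of e gives every intermediate exponent s after an Abel
   summation.  L is then adapted to the tail index j. *)
Lemma interp_bound s p (C0 M T S : R) (e b : nat -> R) :
  0 <= s -> 2 * s <= p -> 1 <= M -> 0 <= C0 ->
  (forall n, 0 <= e n) -> (forall n, 0 <= b n) ->
  (forall j L J, \sum_(j <= n < J) e n <=
     2 * (T - \sum_(m < L) b m) +
     2 * wt (- p) j * (C0 * M `^ p * \sum_(m < L) wt p m * b m)) ->
  \sum_(m < Q) b m @[Q --> \oo] --> T ->
  (forall Q, \sum_(m < Q) wt s m * b m <= S) ->
  forall J, \sum_(n < J) wt s n * e n <= 2 * M `^ s * (1 + 2 * C0) * S.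
Proof.
move=> s0 sp M1 C00 e0 b0 HB bT bS J.
have M0 : 0 < M by exact: lt_le_trans M1.
have p0 : 0 <= p by lra.
(* [L j] is the first index [m] with [lam j <= M * lam m] *)
have LP j : exists L, (L <= j)%N /\ forall m, (m < L)%N = (M * lam m < lam j)%R.
  have ex : exists m, lam j <= M * lam m.
    by exists j; rewrite ler_peMl // ltW // lam_gt0.
  exists (ex_minn ex); case: ex_minnP => L HL Lmin; split.
    by apply: Lmin; rewrite ler_peMl // ltW // lam_gt0.
  move=> m; apply/idP/idP => h.
    by rewrite ltNge; apply/negP => /Lmin; rewrite leqNgt h.
  rewrite ltnNge; apply/negP => Lm; move: h; rewrite ltNge => /negP; apply.
  by rewrite (le_trans HL) // ler_pM2l // lam_le.
have [L HL] := choice LP.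
have -> : \sum_(n < J) wt s n * e n = \sum_(j < J) dwt s j * \sum_(j <= n < J) e n.
  exact: abel_dwt.
(* The initial levels are cut at a large [Q]; the error is a multiple of the mass beyond [Q], which
   tends to 0. *)
suff H : \forall Q \near \oo, \sum_(j < J) dwt s j * (\sum_(j <= n < J) e n) <=
    2 * M `^ s * (1 + 2 * C0) * S + 2 * (\sum_(j < J) dwt s j) * (T - \sum_(m < Q) b m).
  apply: (cvgr_to_ge _ H); rewrite -[X in _ --> X]addr0; apply: cvgD; first exact: cvg_cst.
  rewrite -[X in _ --> X](mulr0 (2 * \sum_(j < J) dwt s j)); apply: cvgM; first exact: cvg_cst.
  by rewrite -[X in _ --> X](subrr T); apply: cvgB; [exact: cvg_cst|exact: bT].
exists J => // Q /= JQ.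
(* Indicators replace the range [m < L j], which depends on [j], so that the two sums can be
   exchanged. *)
have Hj (j : nat) : (j < J)%N -> \sum_(j <= n < J) e n <=
    2 * (T - \sum_(m < Q) b m) + 2 * \sum_(m < Q) b m * ((lam j <= M * lam m)%R%:R
      + C0 * M `^ p * wt p m * (wt (- p) j * (M * lam m < lam j)%R%:R)).
  move=> jJ; apply: (le_trans (HB j (L j) J)); have [Lj HLj] := HL j.
  have LQ : (L j <= Q)%N by rewrite (leq_trans Lj) // (leq_trans _ JQ) // ltnW.
  have E (F : nat -> R) : \sum_(m < L j) F m = \sum_(m < Q) F m * (M * lam m < lam j)%R%:R.
    rewrite -(subnKC LQ) [RHS]big_split_ord /= [X in _ + X]big1 ?addr0.
      by apply: eq_bigr => i _; rewrite -HLj ltn_ord mulr1.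
    by move=> i _; rewrite -HLj ltnNge leq_addr mulr0.
  rewrite (E b) (E (fun m => wt p m * b m)).
  have -> : T - \sum_(m < Q) b m * (M * lam m < lam j)%R%:R =
     T - \sum_(m < Q) b m + \sum_(m < Q) b m * (lam j <= M * lam m)%R%:R.
    rewrite -addrA; congr (_ + _); rewrite -!sumrN -big_split /=; apply: eq_bigr => m _.
    by rewrite leNgt; case: (_ < _); rewrite ?mulr1 ?mulr0; ring.
  rewrite mulrDr -addrA lerD2l -mulrA -mulrDr ler_wpM2l // le_eqVlt; apply/orP; left; apply/eqP.
  by rewrite !mulr_sumr -big_split /=; apply: eq_bigr => m _; ring.
apply: (@le_trans _ _ (\sum_(j < J) dwt s j * (2 * (T - \sum_(m < Q) b m) + 2 * \sum_(m < Q) b m * ((lam j <= M * lam m)%R%:R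
      + C0 * M `^ p * wt p m * (wt (- p) j * (M * lam m < lam j)%R%:R))))).
  by apply: ler_sum => j _; rewrite ler_wpM2l ?dwt_ge0 // Hj.
under [leLHS]eq_bigr do rewrite mulrDr; rewrite big_split /= addrC.
apply: lerD; last by rewrite -mulr_suml mulrCA mulrA.
under [leLHS]eq_bigr do rewrite mulrCA !mulr_sumr.
(* At a fixed initial level [m], the sum over [j] is split at [M * lam m]: [sum_dwt_le] handles one
   side and [sum_dwt_gt] the other. *)
rewrite exchange_big /=.
apply: (@le_trans _ _ (\sum_(m < Q) 2 * M `^ s * (1 + 2 * C0) * (wt s m * b m))); last first.
  rewrite -mulr_sumr ler_wpM2l // !mulr_ge0 ?powR_ge0 // addr_ge0 // mulr_ge0 //.
apply: ler_sum => m _.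
have lm0 : 0 < M * lam m by rewrite mulr_gt0 // lam_gt0.
have S1 := @sum_dwt_le s _ J s0 (ltW lm0).
have S2 := sum_dwt_gt J s0 sp lm0.
have -> : \sum_(j < J) 2 * (dwt s j * (b m * ((lam j <= M * lam m)%R%:R
      + C0 * M `^ p * wt p m * (wt (- p) j * (M * lam m < lam j)%R%:R)))) =
  2 * b m * (\sum_(j < J) dwt s j * (lam j <= M * lam m)%R%:R +
   C0 * M `^ p * wt p m * \sum_(j < J) dwt s j * wt (- p) j * (M * lam m < lam j)%R%:R).
  by rewrite [RHS]mulrDr (mulrA (2 * b m) (C0 * M `^ p * wt p m)) !mulr_sumr -big_split; apply: eq_bigr => j _ /=; ring.
have -> : 2 * M `^ s * (1 + 2 * C0) * (wt s m * b m) =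
  2 * b m * (M `^ s * wt s m + C0 * (2 * (M `^ s * wt s m))) by ring.
rewrite ler_wpM2l ?mulr_ge0 //; apply: lerD.
  by apply: (le_trans S1); rewrite powRM // ltW // lam_gt0.
rewrite -!mulrA ler_wpM2l //.
have -> : M `^ s * wt s m = M `^ p * (wt p m * (M * lam m) `^ (s - p)).
  have l0 := lam_gt0 m.
  rewrite powRM ?(ltW l0) ?(ltW M0) // wtE wtE mulrA mulrACA -!powRD.
  - by rewrite addrC subrK.
  - by apply/implyP => _; rewrite gt_eqF.
  - by apply/implyP => _; rewrite gt_eqF.
have -> : 2 * (M `^ p * (wt p m * (M * lam m) `^ (s - p))) =
  M `^ p * (wt p m * (2 * (M * lam m) `^ (s - p))) by ring.
by rewrite !ler_wpM2l ?powR_ge0 ?wt_ge0.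
Qed.

End Interpolation.

(** * Growth of the Sobolev norms along the flow *)

Section MatrixBounds.
Context {R : realType}.
Variables (kappa iota : R).
Implicit Types (t : R) (n m M N k j : nat) (b v : nat -> R[i]).
Local Notation XC := (opX BC).
Local Notation DC := (opD BC).
Local Notation gmx := (gmx kappa iota).
Local Notation gt := (gt iota).
Local Notation be := (be kappa iota).

Lemma BC0 : BC 0 = 0 :> R[i]. Proof. by rewrite /BC Bc0. Qed.

(** For truncated data all sums over the initial index are finite; each application of [opX] or
    [opD] enlarges the support by one. *)
Definition supp b M := forall m, (M <= m)%N -> b m = 0.

Lemma suppS b M : supp b M -> supp b M.+1.
Proof. by move=> sb m Mm; apply: sb; exact: ltnW. Qed.

Lemma supp_opX b M : supp b M -> supp (XC b) M.+1.
Proof.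
move=> sb [|m] Mm; rewrite /opX; first by [].
by rewrite !sb ?mulr0 ?addr0 // ltnW // ltnW.
Qed.

Lemma supp_opD b M : supp b M -> supp (DC b) M.+1.
Proof.
move=> sb [|m] Mm; rewrite /opD; first by [].
by rewrite !sb ?mulr0 ?subr0 // ltnW // ltnW.
Qed.

Lemma sum_up b v M : supp b M ->
  \sum_(m < M) b m * (BC m.+1 * v m.+1) = \sum_(m < M.+1) (BC m * b m.-1) * v m.
Proof.
move=> _; rewrite big_ord_recl BC0 !mul0r add0r.
by apply: eq_bigr => m _ /=; rewrite /bump /= add1n; ring.
Qed.

Lemma sum_down b v M : supp b M ->
  \sum_(m < M) b m * (BC m * v m.-1) = \sum_(m < M.+1) (BC m.+1 * b m.+1) * v m.
Proof.
move=> sb; case: M sb => [|M] sb.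
  by rewrite big_ord0 big_ord1 sb // mulr0 mul0r.
rewrite big_ord_recl BC0 mul0r mulr0 add0r !big_ord_recr /= !sb ?mulr0 ?mul0r ?addr0 //.
by apply: eq_bigr => m _ /=; rewrite /bump /= add1n; ring.
Qed.

Lemma sum_opX b v M : supp b M ->
  \sum_(m < M) b m * XC v m = \sum_(m < M.+1) XC b m * v m.
Proof.
move=> sb; under eq_bigr do rewrite /opX mulrDr.
rewrite big_split /= sum_up // sum_down // -big_split /=.
by apply: eq_bigr => m _; rewrite /opX; ring.
Qed.

Lemma sum_opD b v M : supp b M ->
  \sum_(m < M) b m * DC v m = - \sum_(m < M.+1) DC b m * v m.
Proof.
move=> sb; under eq_bigr do rewrite /opD mulrBr.
rewrite sumrB sum_up // sum_down // -sumrB -sumrN /=.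
by apply: eq_bigr => m _; rewrite /opD; ring.
Qed.

Lemma sum_supp b v M M' : supp b M -> (M <= M')%N ->
  \sum_(m < M') b m * v m = \sum_(m < M) b m * v m.
Proof.
move=> sb MM; rewrite -(subnKC MM) big_split_ord /= [X in _ + X]big1 ?addr0 //.
by move=> m _; rewrite sb ?mul0r // leq_addr.
Qed.

Definition Gs t b M n : R[i] := \sum_(m < M) b m * gmx t m n.

(* x and d/dx conjugated by the flow, acting on the initial coefficients *)
Definition Uop t b m : R[i] := XC b m - (gt t)%:C * b m.
Definition Vop t b m : R[i] := DC b m - 'i * ((kappa * t)%:C * XC b m + (be t)%:C * b m).

Lemma supp_Uop t b M : supp b M -> supp (Uop t b) M.+1.
Proof.
move=> sb m Mm; rewrite /Uop (supp_opX sb) // (suppS sb) //; ring.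
Qed.

Lemma supp_Vop t b M : supp b M -> supp (Vop t b) M.+1.
Proof.
move=> sb m Mm; rewrite /Vop (supp_opX sb) // (supp_opD sb) // (suppS sb) //; ring.
Qed.

Lemma opX_sum (F : nat -> nat -> R[i]) b M n :
  XC (fun n => \sum_(m < M) b m * F m n) n = \sum_(m < M) b m * XC (F m) n.
Proof.
rewrite /opX !mulr_sumr -big_split /=; apply: eq_bigr => m _; ring.
Qed.

Lemma opD_sum (F : nat -> nat -> R[i]) b M n :
  DC (fun n => \sum_(m < M) b m * F m n) n = \sum_(m < M) b m * DC (F m) n.
Proof.
rewrite /opD !mulr_sumr -sumrB /=; apply: eq_bigr => m _; ring.
Qed.

Lemma Gs_X t b M n : supp b M -> XC (Gs t b M) n = Gs t (Uop t b) M.+1 n.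
Proof.
move=> sb; rewrite /Gs opX_sum; under eq_bigr do rewrite gmx_X mulrBr.
rewrite sumrB (sum_opX (fun k => gmx t k n)) //.
rewrite /Uop; under [RHS]eq_bigr do rewrite mulrBl; rewrite sumrB; congr (_ - _).
rewrite -(sum_supp (fun m => (gt t)%:C * gmx t m n) sb (leqnSn M)); apply: eq_bigr => m _; ring.
Qed.

Lemma Gs_D t b M n : supp b M -> DC (Gs t b M) n = Gs t (Vop t b) M.+1 n.
Proof.
move=> sb; rewrite /Gs opD_sum.
have -> : \sum_(m < M) b m * DC (gmx t m) n =
   - (\sum_(m < M) b m * DC (fun k => gmx t k n) m)
   - 'i * (kappa * t)%:C * (\sum_(m < M) b m * XC (fun k => gmx t k n) m)
   - 'i * (be t)%:C * (\sum_(m < M) b m * gmx t m n).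
  rewrite !mulr_sumr -!sumrN -!big_split /=; apply: eq_bigr => m _.
  rewrite gmx_D; ring.
rewrite (sum_opX (fun k => gmx t k n)) // (sum_opD (fun k => gmx t k n)) // opprK.
rewrite -(sum_supp (fun m => gmx t m n) sb (leqnSn M)) !mulr_sumr -!sumrN -!big_split /=.
by apply: eq_bigr => m _; rewrite /Vop; ring.
Qed.

Lemma opXX_DD v n : XC (XC v) n - DC (DC v) n = (lam n)%:C * v n.
Proof.
have B k : BC k * BC k = (k%:R / 2)%:C :> R[i].
  by rewrite /BC -rmorphM /= -expr2 Bc_sq.
have -> : (lam n)%:C = 2 * (BC n.+1 * BC n.+1) + 2 * (BC n * BC n) :> R[i].
  rewrite !B -[2]/(2%:R) -(rmorph_nat (real_complex R)) -!rmorphM -rmorphD /=.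
  by congr (_%:C); rewrite /lam -natr1; field.
by case: n => [|n]; rewrite /opX /opD /= ?BC0; ring.
Qed.

(** [opXX_DD] is the harmonic oscillator on the final index; [Gs_X] and [Gs_D] transport it to the
    initial index, which trades a weight at time [t] for regularity of the data. *)
Lemma Gs_lam t b M n : supp b M -> (lam n)%:C * Gs t b M n =
  Gs t (fun m => Uop t (Uop t b) m - Vop t (Vop t b) m) M.+2 n.
Proof.
move=> sb; rewrite -opXX_DD.
have -> : XC (XC (Gs t b M)) n = Gs t (Uop t (Uop t b)) M.+2 n.
  rewrite -Gs_X; last exact: supp_Uop.
  by congr opX; apply/funext => k; rewrite Gs_X.
have -> : DC (DC (Gs t b M)) n = Gs t (Vop t (Vop t b)) M.+2 n.
  rewrite -Gs_D; last exact: supp_Vop.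
  by congr opD; apply/funext => k; rewrite Gs_D.
by rewrite /Gs -sumrB; apply: eq_bigr => m _; ring.
Qed.

Lemma Gs_bessel t b M N : \sum_(n < N) sqn (Gs t b M n) <= \sum_(m < M) sqn (b m).
Proof.
under eq_bigr do rewrite /Gs -cw_csum.
rewrite -nrm2_csum; exact/cw_bessel/csqi_csum.
Qed.

Lemma sqnM (z z' : R[i]) : sqn (z * z') = sqn z * sqn z'.
Proof. by case: z => ? ?; case: z' => ? ?; rewrite /sqn /=; ring. Qed.
Lemma sqnC (x : R) : sqn x%:C = x ^+ 2.
Proof. by rewrite /sqn /=; ring. Qed.
Lemma sqn0 : sqn (0 : R[i]) = 0.
Proof. by rewrite /sqn /=; ring. Qed.
Lemma sqnN (z : R[i]) : sqn (- z) = sqn z.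
Proof. by case: z => ? ?; rewrite /sqn /=; ring. Qed.
Lemma sqnD_le (z z' : R[i]) : sqn (z + z') <= 2 * sqn z + 2 * sqn z'.
Proof.
case: z => a b; case: z' => c d; rewrite /sqn /=.
by have := sqr_ge0 (a - c); have := sqr_ge0 (b - d); nra.
Qed.
Lemma sqnB_le (z z' : R[i]) : sqn (z - z') <= 2 * sqn z + 2 * sqn z'.
Proof. by rewrite -(sqnN z') sqnD_le. Qed.

Definition wnorm j b M : R := \sum_(m < M) lam m ^+ j * sqn (b m).

Lemma lam_ge0 m : 0 <= lam m :> R. Proof. exact/ltW/lam_gt0. Qed.
Lemma lamX_ge0 m j : 0 <= lam m ^+ j :> R. Proof. by rewrite exprn_ge0 // lam_ge0. Qed.

Lemma wnorm_ge0 j b M : 0 <= wnorm j b M.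
Proof. by apply: sumr_ge0 => m _; rewrite mulr_ge0 ?sqn_ge0 ?lamX_ge0. Qed.

Lemma wnorm_supp j b M M' : supp b M -> (M <= M')%N -> wnorm j b M' = wnorm j b M.
Proof.
move=> sb MM; rewrite /wnorm -(subnKC MM) big_split_ord /= [X in _ + X]big1 ?addr0 //.
by move=> m _; rewrite sb ?leq_addr // sqn0 mulr0.
Qed.

Lemma wnorm_mono j k b M : (j <= k)%N -> wnorm j b M <= wnorm k b M.
Proof.
move=> jk; apply: ler_sum => m _; rewrite ler_wpM2r ?sqn_ge0 //.
by rewrite -(subnKC jk) exprD ler_peMr ?lamX_ge0 // exprn_ege1 // lam_ge1.
Qed.

(** The square of [Bc] costs one power of [lam], and [3 ^ j] pays for the shift of index through
    [lam m.+1 <= 3 * lam m]. *)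
Lemma wnorm_step j b w M : supp b M ->
  (forall m, sqn (w m) <= 2 * sqn (BC m.+1 * b m.+1) + 2 * sqn (BC m * b m.-1)) ->
  wnorm j w M.+1 <= 4 * 3 ^+ j * wnorm j.+1 b M.
Proof.
move=> sb wb.
have Bl k l : (k <= l.+1)%N -> sqn (BC k) <= lam l :> R.
  move=> kl; rewrite sqnC Bc_sq ler_pdivrMr // /lam.
  by apply: (@le_trans _ _ l.+1%:R); [rewrite ler_nat|rewrite -natr1; have := ler0n R l; lra].
have E1 : \sum_(m < M.+1) lam m ^+ j * sqn (BC m.+1 * b m.+1) <= wnorm j.+1 b M.
  rewrite -(wnorm_supp j.+1 sb (leq_trans (leqnSn M) (leqnSn M.+1))) /wnorm [leRHS]big_ord_recl.
  rewrite -[leLHS]add0r lerD ?mulr_ge0 ?sqn_ge0 ?lamX_ge0 //.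
  apply: ler_sum => m _; rewrite lift0 /= sqnM mulrA ler_wpM2r ?sqn_ge0 //.
  rewrite exprSr ler_pM ?sqn_ge0 ?lamX_ge0 ?Bl //.
  by rewrite lerXn2r ?nnegrE ?lam_ge0 // lam_le.
have E2 : \sum_(m < M.+1) lam m ^+ j * sqn (BC m * b m.-1) <= 3 ^+ j * wnorm j.+1 b M.
  rewrite big_ord_recl BC0 mul0r sqn0 mulr0 add0r /wnorm mulr_sumr.
  apply: ler_sum => m _; rewrite lift0 /= sqnM !mulrA ler_wpM2r ?sqn_ge0 //.
  rewrite exprSr mulrA -exprMn ler_pM ?sqn_ge0 ?lamX_ge0 ?Bl //.
  rewrite lerXn2r ?nnegrE ?mulr_ge0 ?lam_ge0 // /lam -natr1.
  by have := ler0n R m; lra.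
apply: (@le_trans _ _ (2 * wnorm j.+1 b M + 2 * (3 ^+ j * wnorm j.+1 b M))).
  apply: (@le_trans _ _ (\sum_(m < M.+1) (2 * (lam m ^+ j * sqn (BC m.+1 * b m.+1)) +
      2 * (lam m ^+ j * sqn (BC m * b m.-1))))).
    apply: ler_sum => m _.
    rewrite mulrCA [2 * (lam m ^+ j * _)]mulrCA -mulrDr ler_wpM2l ?lamX_ge0 //.
  by rewrite big_split /= -!mulr_sumr lerD // ler_wpM2l.
have h3 : 1 <= 3 ^+ j :> R by rewrite exprn_ege1 // ler1n.
by have := ler_wpM2r (wnorm_ge0 j.+1 b M) h3; lra.
Qed.

Lemma wnorm_opX j b M : supp b M -> wnorm j (XC b) M.+1 <= 4 * 3 ^+ j * wnorm j.+1 b M.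
Proof. by move=> sb; apply: wnorm_step => // m; exact: sqnD_le. Qed.

Lemma wnorm_opD j b M : supp b M -> wnorm j (DC b) M.+1 <= 4 * 3 ^+ j * wnorm j.+1 b M.
Proof. by move=> sb; apply: wnorm_step => // m; rewrite addrC; exact: sqnB_le. Qed.

Lemma wnormB j b v M : wnorm j (fun m => b m - v m) M <= 2 * wnorm j b M + 2 * wnorm j v M.
Proof.
rewrite /wnorm !mulr_sumr -big_split /=; apply: ler_sum => m _.
rewrite mulrCA [2 * (lam m ^+ j * _)]mulrCA -mulrDr ler_wpM2l ?lamX_ge0 //.
exact: sqnB_le.
Qed.

Lemma wnormD j b v M : wnorm j (fun m => b m + v m) M <= 2 * wnorm j b M + 2 * wnorm j v M.
Proof.
rewrite /wnorm !mulr_sumr -big_split /=; apply: ler_sum => m _.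
rewrite mulrCA [2 * (lam m ^+ j * _)]mulrCA -mulrDr ler_wpM2l ?lamX_ge0 //.
exact: sqnD_le.
Qed.

Lemma wnormZ j (z : R[i]) b M : wnorm j (fun m => z * b m) M = sqn z * wnorm j b M.
Proof. by rewrite /wnorm mulr_sumr; apply: eq_bigr => m _; rewrite sqnM; ring. Qed.

(** It is [be], of order [t ^ 2], that imposes the fourth power; the two other quantities are of
    order [t]. *)
Lemma flow_bound : exists C : R, 0 <= C /\ forall t, 0 <= t ->
  [/\ gt t ^+ 2 <= C * (1 + t) ^+ 4, (kappa * t) ^+ 2 <= C * (1 + t) ^+ 4 &
      be t ^+ 2 <= C * (1 + t) ^+ 4].
Proof.
exists (iota ^+ 2 + kappa ^+ 2 + (`|kappa| * `|iota| + `|iota|) ^+ 2).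
split; first by rewrite !addr_ge0 ?sqr_ge0.
move=> t t0.
have c1 := @cos_norm_le1 R t; have s1 := @sin_norm_le1 R t.
have s2 : sin t ^+ 2 <= 1 by have := sin2E t; have := sqr_ge0 (cos t); lra.
have s2' := sqr_ge0 (sin t).
have q1 : 1 <= (1 + t) ^+ 2 by rewrite exprn_ege1 // lerDl.
have q4 : (1 + t) ^+ 2 <= (1 + t) ^+ 4.
  by rewrite (exprD _ 2 2) ler_peMr // exprn_ge0 // addr_ge0.
have sq (x y : R) : `|x| <= y -> x ^+ 2 <= y ^+ 2.
  by move=> xy; rewrite -(real_normK (num_real x)) lerXn2r ?nnegrE // (le_trans _ xy).
have i2 := sqr_ge0 iota; have k2 := sqr_ge0 kappa.
have ki2 := sqr_ge0 (`|kappa| * `|iota| + `|iota|).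
have P4 : 0 <= (1 + t) ^+ 4 by rewrite exprn_ge0 // addr_ge0.
have up (c d : R) : 0 <= d -> c <= iota ^+ 2 + kappa ^+ 2 + (`|kappa| * `|iota| + `|iota|) ^+ 2 -> d <= (1 + t) ^+ 4 -> 0 <= c ->
    c * d <= (iota ^+ 2 + kappa ^+ 2 + (`|kappa| * `|iota| + `|iota|) ^+ 2) * (1 + t) ^+ 4.
  by move=> d0 cC d4 c0; apply: ler_pM.
split.
- rewrite /gt exprMn; apply: up => //; [exact: sqr_ge0|lra|].
  apply: le_trans q4; apply: sq; apply: (le_trans (ler_normD _ _)).
  rewrite (ger0_norm t0) addrC lerD2r normrM mulr_ile1 //.
- rewrite exprMn; apply: up => //; [exact: sqr_ge0|lra|].
  by apply: le_trans q4; apply: sq; rewrite ger0_norm // lerDr.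
- apply: (@le_trans _ _ (((`|kappa| * `|iota| + `|iota|) * (1 + t) ^+ 2) ^+ 2)).
    apply: sq; rewrite /be; apply: (le_trans (ler_normB _ _)); rewrite mulrDl lerD //.
      rewrite mulNr normrN !normrM -mulrA !ler_wpM2l //.
      rewrite ger0_norm; first by have := sqr_ge0 t; nra.
      by rewrite addr_ge0 // divr_ge0 // sqr_ge0.
    by rewrite normrM ler_wpM2l // ger0_norm // (le_trans s2).
  rewrite exprMn -exprM; apply: up => //; lra.
Qed.

Lemma wnorm_UV : exists C : nat -> R, (forall j, 0 <= C j) /\ forall j t b M, 0 <= t -> supp b M ->
  wnorm j (Uop t b) M.+1 <= C j * (1 + t) ^+ 4 * wnorm j.+1 b M /\
  wnorm j (Vop t b) M.+1 <= C j * (1 + t) ^+ 4 * wnorm j.+1 b M.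
Proof.
have [C [C0 HC]] := flow_bound.
exists (fun j => (8 * 3 ^+ j + 2 * C + 16 * 3 ^+ j * C + 4 * C)).
split; first by move=> j; rewrite !addr_ge0 ?mulr_ge0 ?exprn_ge0.
move=> j t b M t0 sb; have [g2 k2 b2] := HC t t0.
set q := (1 + t) ^+ 4 in g2 k2 b2 *; have q1 : 1 <= q by rewrite exprn_ege1 // lerDl.
have q0 : 0 <= q := le_trans ler01 q1.
have nX := wnorm_opX j sb; have nD := wnorm_opD j sb.
set S := wnorm j.+1 b M in nX nD *; have S0 : 0 <= S := wnorm_ge0 _ _ _.
have nb : wnorm j b M.+1 <= S by rewrite (wnorm_supp j sb (leqnSn M)) wnorm_mono.
have h3 : 0 <= 3 ^+ j :> R by rewrite exprn_ge0.
set T := 3 ^+ j in h3 nX nD *.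
clearbody q S T.
have TS : T * S <= T * (q * S) by rewrite ler_wpM2l // ler_peMl.
have CqS : 0 <= C * (q * S) by rewrite !mulr_ge0.
have TqS : 0 <= T * (q * S) by rewrite !mulr_ge0.
have CTqS : 0 <= C * (T * (q * S)) by rewrite mulr_ge0.
have G1 : gt t ^+ 2 * wnorm j b M.+1 <= C * q * S.
  by rewrite ler_pM ?sqr_ge0 ?wnorm_ge0.
have G2 : be t ^+ 2 * wnorm j b M.+1 <= C * q * S.
  by rewrite ler_pM ?sqr_ge0 ?wnorm_ge0.
have G3 : (kappa * t) ^+ 2 * wnorm j (XC b) M.+1 <= C * q * (4 * T * S).
  by rewrite ler_pM ?sqr_ge0 ?wnorm_ge0.
have -> : (8 * T + 2 * C + 16 * T * C + 4 * C) * q * S =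
  8 * (T * (q * S)) + 2 * (C * (q * S)) + 16 * (C * (T * (q * S))) + 4 * (C * (q * S)) by ring.
rewrite -mulrA in G1; rewrite -mulrA in G2.
have E3 : C * q * (4 * T * S) = 4 * (C * (T * (q * S))) by ring.
rewrite E3 in G3; rewrite -mulrA in nX; rewrite -mulrA in nD.
split.
  apply: (le_trans (wnormB _ _ _ _)); rewrite wnormZ sqnC.
  by lra.
apply: (le_trans (wnormB _ _ _ _)); rewrite wnormZ.
have -> : sqn ('i : R[i]) = 1 by rewrite /sqn /=; ring.
rewrite mul1r; have := wnormD j (fun m => (kappa * t)%:C * XC b m) (fun m => (be t)%:C * b m) M.+1.
rewrite !wnormZ !sqnC => W.
by lra.
Qed.

(** Each step removes [lam ^ 2] through [Gs_lam], whose square is taken in [sqn]. The two operators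
    that appear cost a factor [(1 + t) ^ 4] and one power of [lam] each, hence [(1 + t) ^ 8] per
    step. *)
Lemma Gs_weight : exists C : nat -> R, (forall k, 0 <= C k) /\
  forall k t b M N, 0 <= t -> supp b M ->
  \sum_(n < N) lam n ^+ (2 * k) * sqn (Gs t b M n) <=
    C k * (1 + t) ^+ (8 * k) * wnorm (2 * k) b M.
Proof.
have [C [C0 HC]] := wnorm_UV.
exists (fun k => \prod_(i < k) (4 * (C (2 * i)%N * C (2 * i).+1))).
split; first by move=> k; apply: prodr_ge0 => i _; rewrite !mulr_ge0.
elim=> [|k IH] t b M N t0 sb.
  rewrite big_ord0 !muln0 expr0 !mul1r /wnorm.
  under eq_bigr do rewrite expr0 mul1r.
  by under [leRHS]eq_bigr do rewrite expr0 mul1r; exact: Gs_bessel.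
set b2 := fun m => Uop t (Uop t b) m - Vop t (Vop t b) m.
have s1 := supp_Uop t sb; have s2 := supp_Vop t sb.
have sb2 : supp b2 M.+2.
  by move=> m Mm; rewrite /b2 (supp_Uop t s1) // (supp_Vop t s2) // subr0.
have E n : lam n ^+ (2 * k.+1) * sqn (Gs t b M n) = lam n ^+ (2 * k) * sqn (Gs t b2 M.+2 n).
  by rewrite -(Gs_lam t n sb) sqnM sqnC mulrA -exprD mulnS addnC.
under eq_bigr do rewrite E.
apply: (le_trans (IH t b2 M.+2 N t0 sb2)).
rewrite big_ord_recr /=; set P := \prod_(i < k) _.
have P0 : 0 <= P by apply: prodr_ge0 => i _; rewrite !mulr_ge0.
rewrite mulnS exprD (_ : (1 + t) ^+ 8 = (1 + t) ^+ 4 * (1 + t) ^+ 4); last by rewrite -exprD.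
set q := (1 + t) ^+ 4; set Q := (1 + t) ^+ (8 * k).
have q0 : 0 <= q by rewrite exprn_ge0 // addr_ge0.
have Q0 : 0 <= Q by rewrite exprn_ge0 // addr_ge0.
have [U1 W1] := HC (2 * k).+1 t b M t0 sb.
have [U2 _] := HC (2 * k)%N t _ M.+1 t0 s1.
have [_ W2] := HC (2 * k)%N t _ M.+1 t0 s2.
rewrite -/q in U1 W1 U2 W2.
have Cq0 j : 0 <= C j * q by rewrite mulr_ge0.
have U3 := le_trans U2 (ler_wpM2l (Cq0 (2 * k)%N) U1).
have W3 := le_trans W2 (ler_wpM2l (Cq0 (2 * k)%N) W1).
rewrite mulnS add2n.
rewrite (_ : _ * _ * (q * q * Q) * _ =
  P * Q * (4 * (C (2 * k)%N * q * (C (2 * k).+1 * q * wnorm (2 * k).+2 b M)))); last by ring.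
rewrite ler_wpM2l ?mulr_ge0 //.
apply: (le_trans (wnormB _ _ _ _)); lra.
Qed.

Lemma hcoef_tail psi t L J : csqi psi ->
  \sum_(n < J) sqn (cw kappa iota t psi n - Gs t (hcoef psi) L n) <=
    nrm2 psi - \sum_(m < L) sqn (hcoef psi m).
Proof.
move=> sp; rewrite -nrm2_sub_csum //.
have sc := csqi_csum (hcoef psi) L.
under eq_bigr do rewrite /Gs -cw_csum -(cwB _ _ _ _ sp sc).
by apply: cw_bessel; apply: csqiB => //; exact: csqi_csum.
Qed.

Lemma sum_nat_sub (F : nat -> R) j N : (forall n, 0 <= F n) ->
  \sum_(j <= n < N) F n <= \sum_(n < N) F n.
Proof.
move=> F0; case: (leqP j N) => jN; last first.
  by rewrite big_geq ?sumr_ge0 // ltnW.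
by rewrite -(big_mkord xpredT F) [leRHS](big_cat_nat (leq0n j) jN) /= lerDr sumr_ge0.
Qed.

Lemma cw_upper (s : R) : 0 <= s -> exists C : R, 0 <= C /\ forall t psi (S : R), 0 <= t -> csqi psi ->
  (forall Q, \sum_(m < Q) wt s m * sqn (hcoef psi m) <= S) ->
  forall J, \sum_(n < J) wt s n * sqn (cw kappa iota t psi n) <= C * (1 + t) `^ (4 * s) * S.
Proof.
move=> s0; have [C [C0 HC]] := Gs_weight.
(* The exponent [p = 2 k] is covered by [Gs_weight] and satisfies [2 s <= p], as the interpolation
   requires. *)
pose k := (Num.truncn s).+1.
have sk : s <= k%:R by rewrite ltW // truncnS_gt.
exists (2 * (1 + 2 * C k)); split; first by rewrite mulr_ge0 // addr_ge0 // mulr_ge0.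
move=> t psi S t0 sp HS J.
have M1 : 1 <= (1 + t) ^+ 4 by rewrite exprn_ege1 // lerDl.
have q0 : 0 <= 1 + t by rewrite addr_ge0.
have -> : 2 * (1 + 2 * C k) * (1 + t) `^ (4 * s) * S =
    2 * ((1 + t) ^+ 4) `^ s * (1 + 2 * C k) * S.
  by rewrite powRrM powR_mulrn //; ring.
apply: (@interp_bound R s (2 * k)%:R (C k) ((1 + t) ^+ 4) (nrm2 psi) S (fun n => sqn (cw kappa iota t psi n))
  (fun m => sqn (hcoef psi m))) => //; try by move=> n; exact: sqn_ge0.
- by rewrite natrM ler_wpM2l.
(* The splitting hypothesis of [interp_bound]: data above level [L] are controlled by conservation
   of mass, data below by [Gs_weight], where the weight is at least [wt p j] on the levels from [j]
   on. *)
- move=> j L N; pose b m := if (m < L)%N then hcoef psi m else 0.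
  have sb : supp b L by move=> m Lm; rewrite /b ltnNge Lm.
  have Gb n : Gs t (hcoef psi) L n = Gs t b L n.
    by apply: eq_bigr => m _; rewrite /b ltn_ord.
  have wb : wnorm (2 * k) b L = \sum_(m < L) wt (2 * k)%:R m * sqn (hcoef psi m).
    by apply: eq_bigr => m _; rewrite /b ltn_ord wtE powR_mulrn // lam_ge0.
  have G := HC k t b L N t0 sb; rewrite wb in G.
  rewrite powR_mulrn ?exprn_ge0 // -exprM mulnA.
  pose F n := sqn (cw kappa iota t psi n - Gs t (hcoef psi) L n).
  pose H n := lam n ^+ (2 * k) * sqn (Gs t b L n).
  have F0 n : 0 <= F n by exact: sqn_ge0.
  have H0 n : 0 <= H n by rewrite mulr_ge0 ?lamX_ge0 ?sqn_ge0.
  have w0 : 0 <= wt (- (2 * k)%:R) j :> R by exact: wt_ge0.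
  apply: (@le_trans _ _ (2 * \sum_(j <= n < N) F n + 2 * wt (- (2 * k)%:R) j * \sum_(j <= n < N) H n)).
    rewrite !mulr_sumr -big_split /= !big_nat; apply: ler_sum => n /andP[jn _].
    rewrite -[cw kappa iota t psi n](subrK (Gs t (hcoef psi) L n)).
    apply: (le_trans (sqnD_le _ _)); rewrite lerD2l -mulrA ler_wpM2l //.
    rewrite Gb /H mulrA ler_peMl ?sqn_ge0 // -powR_mulrn ?lam_ge0 // -wtE wtN.
    by rewrite mulrC ler_pdivlMr ?wt_gt0 // mul1r wt_le.
  apply: lerD; rewrite ler_wpM2l ?mulr_ge0 //.
    by apply: (le_trans (sum_nat_sub _ _ F0)); exact: hcoef_tail.
  exact: (le_trans (sum_nat_sub _ _ H0)).
- exact: csqi_parseval.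
Qed.
(** [|be t|] is at least [|kappa iota| t ^ 2 / 2 - |iota|], and the assumption on [t] bounds
    [|iota|] by half of the first term. *)
Lemma be_lower t : 0 <= t -> 4 <= `|kappa| * t ^+ 2 ->
  (kappa * iota) ^+ 2 * t ^+ 4 / 16 <= be t ^+ 2.
Proof.
move=> t0 ht; pose x := `|kappa * iota| * t ^+ 2 / 4.
have x0 : 0 <= x by rewrite divr_ge0 // mulr_ge0 // sqr_ge0.
have s2 : sin t ^+ 2 <= 1 by have := sin2E t; have := sqr_ge0 (cos t); lra.
have s0 := sqr_ge0 (sin t).
have xb : x <= `|be t|.
  have -> : be t = - (kappa * iota * (t ^+ 2 / 2 + sin t ^+ 2 / 2) + iota * sin t ^+ 2).
    by rewrite /be; ring.
  rewrite normrN; apply: le_trans (lerB_normD _ _).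
  rewrite (normrM (kappa * iota)) (normrM kappa) (normrM iota) (ger0_norm s0) (@ger0_norm _ (t ^+ 2 / 2 + _)); last first.
    by rewrite addr_ge0 // divr_ge0 // sqr_ge0.
  rewrite /x (normrM kappa).
  have h1 : `|iota| * sin t ^+ 2 <= `|iota| by rewrite ler_piMr.
  have h2 : `|iota| * 4 <= `|iota| * (`|kappa| * t ^+ 2) by rewrite ler_wpM2l.
  have h3 : 0 <= `|kappa| * `|iota| * sin t ^+ 2 by apply: mulr_ge0 => //; exact: mulr_ge0.
  lra.
rewrite -(real_normK (num_real (be t))).
apply: (@le_trans _ _ (x ^+ 2)); last by rewrite lerXn2r ?nnegrE.
have := real_normK (num_real (kappa * iota)); rewrite /x => <-.
by rewrite le_eqVlt; apply/orP; left; apply/eqP; field.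
Qed.

Lemma sum_opD_le v N K : (forall J, \sum_(n < J) sqn (v n) <= K) ->
  \sum_(n < N) sqn (DC v n) <= 2 * N%:R * K.
Proof.
move=> HK; have K0 : 0 <= K by have := HK 0%N; rewrite big_ord0.
have h (n : 'I_N) : sqn (DC v n) <= N%:R * sqn (v n.-1) *+ (n != 0 :> nat) + N%:R * sqn (v n.+1).
  apply: (le_trans (sqnB_le _ _)); rewrite !sqnM !sqnC !Bc_sq; apply: lerD.
    case: n => [[|n] nN] /=; first by rewrite !mul0r mulr0.
    rewrite mulr1n mulrA ler_wpM2r ?sqn_ge0 // mulrC divfK // ler_nat ltnW //.
  by rewrite mulrA ler_wpM2r ?sqn_ge0 // mulrC divfK // ler_nat.
apply: (le_trans (ler_sum _ (fun i _ => h i))); rewrite big_split /=.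
rewrite mulrAC -mulrA mulr_natl mulr2n -[K * _]mulrC; apply: lerD.
  case: N {h} => [|N]; first by rewrite big_ord0 mul0r.
  rewrite big_ord_recl /= mulr0n add0r.
  under eq_bigr do rewrite add0n mulr1n.
  by rewrite -mulr_sumr ler_wpM2l // HK.
rewrite -mulr_sumr ler_wpM2l //; apply: le_trans (HK N.+1).
by rewrite big_ord_recl lerDr sqn_ge0.
Qed.

(* The momentum operator i [be] (with [be] of order t ^ 2) differs from
   differentiation by terms of order t; differentiation costs at most N ^ (1/2)
   on the levels below N, so little mass stays below a multiple of t ^ 4. *)
Lemma low_mass psi : kappa != 0 -> iota != 0 -> csqi psi -> 0 < nrm2 psi ->
  exists de T : R, [/\ 0 < de, 1 <= T & forall t (N : nat), T <= t -> N%:R <= de * t ^+ 4 ->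
    \sum_(n < N) sqn (cw kappa iota t psi n) <= nrm2 psi / 2].
Proof.
move=> k0 i0 sp; set m := nrm2 psi => m0.
(* A truncation that loses at most [m / 16] of the mass, at every time; for the truncated data the
   norms of [XC b] and [DC b] are finite. *)
have [M HM] : exists M, m - \sum_(n < M) sqn (hcoef psi n) <= m / 16.
  have /cvgrPdist_le/(_ (m / 16)) := csqi_parseval sp.
  move=> /(_ (divr_gt0 m0 _))[] // M _ /(_ M (leqnn M)) /= h; exists M.
  exact: le_trans (ler_norm _) h.
pose b n := if (n < M)%N then hcoef psi n else 0.
have sb : supp b M by move=> n Mn; rewrite /b ltnNge Mn.
have Gb t n : Gs t (hcoef psi) M n = Gs t b M n.
  by apply: eq_bigr => i _; rewrite /b ltn_ord.
have Kb : \sum_(n < M) sqn (b n) <= m.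
  apply: le_trans (csqi_bessel M sp); rewrite le_eqVlt; apply/orP; left; apply/eqP.
  by apply: eq_bigr => i _; rewrite /b ltn_ord.
pose K1 := 4 * 3 ^+ 0 * wnorm 1 b M.
have K10 : 0 <= K1 by rewrite !mulr_ge0 ?wnorm_ge0.
pose a := (kappa * iota) ^+ 2 / 16.
have a0 : 0 < a by rewrite divr_gt0 // exprn_even_gt0 //= mulf_neq0.
have am0 : 0 < a * m by rewrite mulr_gt0.
have nk0 : 0 < `|kappa| by rewrite normr_gt0.
pose c2 := 64 * K1 * (1 + kappa ^+ 2) / (a * m).
have k20 : 0 <= 1 + kappa ^+ 2 by rewrite addr_ge0 // sqr_ge0.
have c20 : 0 <= c2.
  by apply: divr_ge0; [apply: mulr_ge0 => //; exact: mulr_ge0|exact: ltW].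
have c10 : 0 <= 4 / `|kappa| by rewrite divr_ge0.
(* With [N <= (a / 64) t ^ 4], the term [4 N m] coming from differentiation is at most
   [a t ^ 4 m / 16], and [c2] makes the term of [b1] equally small. Together they give [S <= m / 8]
   below, and [2 (m / 16) + 2 (m / 8) <= m / 2]. *)
exists (a / 64), (1 + 4 / `|kappa| + c2); split.
- by rewrite divr_gt0.
- by rewrite -addrA lerDl addr_ge0.
move=> t N Tt Nt.
have t1 : 1 <= t by lra.
have t0 : 0 <= t by lra.
have tt : t <= t ^+ 2 by rewrite expr2 ler_peMl.
have h4 : 4 <= `|kappa| * t ^+ 2.
  by rewrite mulrC -ler_pdivrMr //; lra.
have t20 : 0 <= t ^+ 2 := sqr_ge0 t.
have h5 : 64 * K1 * (1 + kappa ^+ 2 * t ^+ 2) <= a * m * t ^+ 4.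
  have : c2 * (a * m) <= t ^+ 2 * (a * m) by rewrite ler_pM2r //; lra.
  rewrite divfK ?gt_eqF // => h.
  have : 64 * K1 * (1 + kappa ^+ 2) * t ^+ 2 <= t ^+ 2 * (a * m) * t ^+ 2 by rewrite ler_wpM2r.
  have : K1 * 1 <= K1 * t ^+ 2 by rewrite ler_wpM2l // (le_trans t1).
  by rewrite (exprD t 2 2); lra.
have B := be_lower t0 h4.
have aB : a * t ^+ 4 <= be t ^+ 2 by move: B; rewrite /a mulrAC.
pose b1 n := DC b n - 'i * (kappa * t)%:C * XC b n.
(* [Gs_D] solved for its momentum term; [b1] collects what grows at most like [t]. *)
have E n : 'i * (be t)%:C * Gs t b M n = Gs t b1 M.+1 n - DC (Gs t b M) n.
  rewrite Gs_D // /Gs -sumrB -(sum_supp (fun m => gmx t m n) sb (leqnSn M)) mulr_sumr.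
  by apply: eq_bigr => i _; rewrite /b1 /Vop; ring.
have HG J : \sum_(n < J) sqn (Gs t b M n) <= m := le_trans (Gs_bessel t b M J) Kb.
have nb1 : \sum_(n < N) sqn (Gs t b1 M.+1 n) <= 2 * K1 * (1 + kappa ^+ 2 * t ^+ 2).
  apply: (le_trans (Gs_bessel _ _ _ _)).
  have -> : \sum_(m < M.+1) sqn (b1 m) = wnorm 0 b1 M.+1.
    by apply: eq_bigr => i _; rewrite expr0 mul1r.
  apply: (le_trans (wnormB _ _ _ _)); rewrite wnormZ sqnM sqnC.
  have -> : sqn ('i : R[i]) = 1 by rewrite /sqn /=; ring.
  rewrite mul1r exprMn.
  have := wnorm_opD 0 sb; have := wnorm_opX 0 sb; rewrite -/K1 => hX hD.
  have := ler_wpM2l (mulr_ge0 (sqr_ge0 kappa) t20) hX; lra.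
have nD := sum_opD_le N HG.
set S := \sum_(n < N) sqn (Gs t b M n).
have S0 : 0 <= S by apply: sumr_ge0 => i _; exact: sqn_ge0.
have HS : a * t ^+ 4 * S <= 4 * K1 * (1 + kappa ^+ 2 * t ^+ 2) + 4 * N%:R * m.
  apply: (@le_trans _ _ (be t ^+ 2 * S)); first by rewrite ler_wpM2r.
  have -> : be t ^+ 2 * S = \sum_(n < N) sqn (Gs t b1 M.+1 n - DC (Gs t b M) n).
    rewrite mulr_sumr; apply: eq_bigr => i _; rewrite -E !sqnM sqnC.
    have -> : sqn ('i : R[i]) = 1 by rewrite /sqn /=; ring.
    by rewrite mul1r.
  apply: (@le_trans _ _ (\sum_(n < N) (2 * sqn (Gs t b1 M.+1 n) + 2 * sqn (DC (Gs t b M) n)))).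
    by apply: ler_sum => i _; exact: sqnB_le.
  by rewrite big_split /= -!mulr_sumr; lra.
have t4 : 0 < a * t ^+ 4 by rewrite mulr_gt0 // exprn_gt0 //; lra.
have S8 : S <= m / 8.
  rewrite -(ler_pM2l t4); apply: (le_trans HS).
  have := ler_wpM2r (ltW m0) Nt; lra.
apply: (@le_trans _ _ (2 * (m / 16) + 2 * S)); last by lra.
apply: (@le_trans _ _ (\sum_(n < N) (2 * sqn (cw kappa iota t psi n - Gs t (hcoef psi) M n) +
    2 * sqn (Gs t b M n)))).
  apply: ler_sum => n _; rewrite -{1}[cw kappa iota t psi n](subrK (Gs t (hcoef psi) M n)).
  by rewrite -Gb; exact: sqnD_le.
rewrite big_split /= -!mulr_sumr lerD2r ler_wpM2l //.
exact: le_trans (hcoef_tail _ _ _ sp) HM.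
Qed.

Lemma cw_lower (s : R) psi : 0 <= s -> kappa != 0 -> iota != 0 -> csqi psi -> 0 < nrm2 psi ->
  exists c : R, 0 < c /\ forall t, 0 <= t -> exists J,
    c * t `^ (4 * s) <= \sum_(n < J) wt s n * sqn (cw kappa iota t psi n).
Proof.
move=> s0 k0 i0 sp m0; have [de [T [de0 T1 HT]]] := low_mass k0 i0 sp m0.
set m := nrm2 psi in m0 HT *.
have T0 : 0 < T by exact: lt_le_trans T1.
have Ts : 0 < T `^ (4 * s) by rewrite powR_gt0.
have ds : 0 < de `^ s by rewrite powR_gt0.
(* Two regimes. For [t < T] it is enough that all weights are at least 1. For [t >= T], three
   quarters of the mass lie below [J] and at most half below [N], so a quarter remains on levels of
   weight at least [(de t ^ 4) ^ s]. *)
exists (m / 4 * Num.min (T `^ (4 * s))^-1 (de `^ s)); split.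
  by rewrite mulr_gt0 ?divr_gt0 // lt_min invr_gt0 Ts.
move=> t t0.
have [J HJ] : exists J, 3 / 4 * m <= \sum_(n < J) sqn (cw kappa iota t psi n).
  have /cvgrPdist_le/(_ (m / 4)) := cw_parseval kappa iota t sp.
  move=> /(_ (divr_gt0 m0 _))[] // J _ /(_ J (leqnn J)) /= h; exists J.
  have := le_trans (ler_norm _) h; rewrite -/m; lra.
exists J; have p0 : 0 <= t `^ (4 * s) by exact: powR_ge0.
have [tT|Tt] := ltP t T.
  apply: (@le_trans _ _ (m / 4 * ((T `^ (4 * s))^-1 * T `^ (4 * s)))).
    rewrite -mulrA ler_wpM2l ?divr_ge0 ?(ltW m0) // ler_pM //.
    - by rewrite le_min invr_ge0 (ltW Ts) ltW.
    - by rewrite ge_min lexx.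
    by rewrite ge0_ler_powR ?nnegrE ?mulr_ge0 // ?(ltW tT) // ltW.
  rewrite mulVf ?gt_eqF // mulr1.
  apply: (@le_trans _ _ (3 / 4 * m)); first by lra.
  apply: (le_trans HJ); apply: ler_sum => n _.
  by rewrite ler_peMl ?sqn_ge0 // wt_ge1.
pose N := Num.truncn (de * t ^+ 4).
have d4 : 0 <= de * t ^+ 4 by rewrite mulr_ge0 ?exprn_ge0 // ltW.
have /andP[Nd dN] := truncn_itv d4; rewrite -/N in Nd dN.
have HN := HT t N Tt Nd.
apply: (@le_trans _ _ (wt s N * (m / 4))).
  rewrite -mulrA mulrC ler_wpM2r ?divr_ge0 ?(ltW m0) //.
  apply: (@le_trans _ _ (de `^ s * t `^ (4 * s))).
    by rewrite ler_wpM2r // ge_min lexx orbT.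
  rewrite powRrM -[4]/(4%:R) powR_mulrn // -powRM ?exprn_ge0 ?(ltW de0) //.
  rewrite ge0_ler_powR ?nnegrE ?addr_ge0 ?mulr_ge0 //; first exact: ltW.
  rewrite (le_trans (ltW dN)) // -natr1 lerD2r.
  by have := ler0n R N; lra.
have [JN|NJ] := leqP J N.
  have : \sum_(n < J) sqn (cw kappa iota t psi n) <= m / 2.
    apply: le_trans HN; rewrite -(subnKC JN) big_split_ord /= lerDl.
    by apply: sumr_ge0 => n _; exact: sqn_ge0.
  move: HJ; lra.
rewrite -(big_mkord xpredT (fun n => wt s n * sqn (cw kappa iota t psi n))).
rewrite (big_cat_nat (leq0n N) (ltnW NJ)) /=.
rewrite -(big_mkord xpredT (fun n => sqn (cw kappa iota t psi n))) in HJ.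
rewrite -(big_mkord xpredT (fun n => sqn (cw kappa iota t psi n))) in HN.
rewrite (big_cat_nat (leq0n N) (ltnW NJ)) /= in HJ.
rewrite -[leLHS]add0r; apply: lerD.
  by apply: sumr_ge0 => n _; rewrite mulr_ge0 ?wt_ge0 ?sqn_ge0.
apply: (@le_trans _ _ (wt s N * \sum_(N <= n < J) sqn (cw kappa iota t psi n))).
  rewrite ler_wpM2l ?wt_ge0 //; lra.
rewrite mulr_sumr !big_nat; apply: ler_sum => n /andP[Nn _].
by rewrite ler_wpM2r ?sqn_ge0 // wt_le.
Qed.

End MatrixBounds.

(** * The Hamiltonian on Hermite coefficients *)

Section HermiteOperators.
Context {R : realType}.
Implicit Types (phi : R -> R) (n m k : nat) (x : R) (p : {poly R}).
Local Notation X := (opX (@Bc R)).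
Local Notation D := (opD (@Bc R)).

Lemma derive1_gpoly p : derive1 (gpoly 0 p) = gpoly 0 (deriv p - 'X * p).
Proof.
apply/funext => x; rewrite derive1E.
by have H := is_derive_gpoly 0 p x; rewrite derive_val.
Qed.

Lemma schwartz_gpoly p : schwartz (gpoly 0 p).
Proof.
have E n : exists q, derive1n n (gpoly 0 p) = gpoly 0 q.
  elim: n => [|n [q Hq]]; first by exists p.
  by exists (deriv q - 'X * q); rewrite derive1nS Hq derive1_gpoly.
split=> [n x|k n]; have [q ->] := E n.
  by have [] := is_derive_gpoly 0 q x.
have b0 : 0 < 2^-1 :> R by rewrite invr_gt0.
have [C [_ HC]] := poly_gauss_bound ('X^k * q) 0 b0; exists C => x.
apply: le_trans (HC x); rewrite gpolyE /= hornerM hornerXn subr0 !mul0r !addr0.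
by rewrite !normrM (ger0_norm (expR_ge0 _)) mulrA.
Qed.

Lemma schwartz_hg n : schwartz (hg (0 : R) n). Proof. exact: schwartz_gpoly. Qed.

Lemma schwartz_derive1 phi : schwartz phi -> schwartz (derive1 phi).
Proof.
move=> [H1 H2]; have E n : derive1n n (derive1 phi) = derive1n n.+1 phi.
  by rewrite /derive1n iterSr.
split=> [n x|k n]; first by rewrite E; exact: H1.
by have [M HM] := H2 k n.+1; exists M => x; rewrite E.
Qed.

Lemma is_derive_schwartz phi x : schwartz phi -> is_derive x 1 phi (derive1 phi x).
Proof. by move=> [H1 _]; rewrite derive1E; apply: derivableP; exact: (H1 0%N). Qed.

Lemma derive1n_mulX phi n : schwartz phi ->
  derive1n n (mulX phi) = fun x => x * derive1n n phi x + n%:R * derive1n n.-1 phi x.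
Proof.
move=> sp; elim: n => [|n IH].
  by apply/funext => x; rewrite /mulX /= mul0r addr0.
apply/funext => x; rewrite derive1nS IH derive1E.
have d1 : is_derive x 1 (derive1n n phi) (derive1n n.+1 phi x).
  by rewrite derive1nS derive1E; apply: derivableP; exact: (sp.1 n).
case: n IH d1 => [|n] IH d1.
  have e : is_derive x 1 (fun x => x * derive1n 0 phi x + 0%:R * derive1n 0.-1 phi x)
     (x * derive1n 1 phi x + 1%:R * derive1n 0 phi x).
    by apply: is_derive_eq; rewrite /GRing.scale /=; ring.
  by rewrite derive_val.
have d2 : is_derive x 1 (derive1n n phi) (derive1n n.+1 phi x).
  by rewrite derive1nS derive1E; apply: derivableP; exact: (sp.1 n).
have e : is_derive x 1 (fun x => x * derive1n n.+1 phi x + n.+1%:R * derive1n n phi x)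
     (x * derive1n n.+2 phi x + n.+2%:R * derive1n n.+1 phi x).
  by apply: is_derive_eq; rewrite /GRing.scale /= -[n.+2%:R]natr1; ring.
by rewrite derive_val.
Qed.

Lemma schwartz_mulX phi : schwartz phi -> schwartz (mulX phi).
Proof.
move=> sp; split=> [n x|k n]; rewrite derive1n_mulX //.
  have d1 : is_derive x 1 (derive1n n phi) (derive1n n.+1 phi x).
    by rewrite derive1nS derive1E; apply: derivableP; exact: (sp.1 n).
  have d2 : is_derive x 1 (derive1n n.-1 phi) (derive1n n.-1.+1 phi x).
    by rewrite derive1nS derive1E; apply: derivableP; exact: (sp.1 n.-1).
  have d3 : is_derive x 1 (fun x => x * derive1n n phi x + n%:R * derive1n n.-1 phi x)
    (x * derive1n n.+1 phi x + derive1n n phi x + n%:R * derive1n n.-1.+1 phi x).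
    by apply: is_derive_eq; rewrite /GRing.scale /=; ring.
  by case: d3.
have [M1 H1] := sp.2 k.+1 n; have [M2 H2] := sp.2 k n.-1.
exists (M1 + n%:R * M2) => x.
rewrite mulrDr mulrA -exprSr mulrCA (le_trans (ler_normD _ _)) // lerD //.
by rewrite normrM ger0_norm // ler_wpM2l.
Qed.

Lemma continuous_schwartz phi : schwartz phi -> continuous phi.
Proof.
move=> [H1 _] x; apply/differentiable_continuous/derivable1_diffP; exact: (H1 0%N).
Qed.

Lemma dec_schwartz phi : schwartz phi -> dec phi.
Proof.
move=> sp; split; first by apply: continuous_measurable_fun; exact: continuous_schwartz.
have [M0 H0] := sp.2 0%N 0%N; have [M2 H2] := sp.2 2%N 0%N.
exists (M0 + M2) => x; have := H0 x; have := H2 x.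
rewrite /= expr0 mul1r normrM (ger0_norm (sqr_ge0 x)); lra.
Qed.

Lemma sqi_schwartz phi : schwartz phi -> sqi phi.
Proof. by move=> sp; exact/dec_sqi/dec_schwartz. Qed.

Lemma ip_mulX (f : R -> R) phi : ip (mulX f) phi = ip f (mulX phi).
Proof. by rewrite /ip; congr int; apply/funext => x; rewrite /mulX; ring. Qed.

Lemma ip_derive1 phi psi : schwartz phi -> schwartz psi ->
  ip (derive1 phi) psi = - ip phi (derive1 psi).
Proof.
move=> s1 s2; have s1' := schwartz_derive1 s1; have s2' := schwartz_derive1 s2.
have q1 := sqi_schwartz s1; have q2 := sqi_schwartz s2.
have q1' := sqi_schwartz s1'; have q2' := sqi_schwartz s2'.
have I1 := sqi_ipi q1' q2; have I2 := sqi_ipi q1 q2'.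
apply/eqP; rewrite -addr_eq0; apply/eqP; rewrite /ip -intD //.
apply: (@int_derive0 _ (fun x => phi x * psi x)).
- by apply: contD; apply: contM; exact: continuous_schwartz.
- move=> x; have d1 := is_derive_schwartz x s1; have d2 := is_derive_schwartz x s2.
  by apply: is_derive_eq; rewrite /GRing.scale /=; ring.
- by apply: dec_M; exact: dec_schwartz.
- exact: integD.
Qed.

Lemma mulX_opX (v : nat -> R -> R) n :
  mulX (fun x => X (v ^~ x) n) = fun x => X ((fun m => mulX (v m)) ^~ x) n.
Proof. by apply/funext => x; rewrite /mulX /opX; ring. Qed.

Lemma mulX_opD (v : nat -> R -> R) n :
  mulX (fun x => D (v ^~ x) n) = fun x => D ((fun m => mulX (v m)) ^~ x) n.
Proof. by apply/funext => x; rewrite /mulX /opD; ring. Qed.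

Lemma derive1_opX (v : nat -> R -> R) n : (forall m, schwartz (v m)) ->
  derive1 (fun x => X (v ^~ x) n) = fun x => X ((fun m => derive1 (v m)) ^~ x) n.
Proof.
move=> sv; apply/funext => x; rewrite derive1E /opX.
have d1 := is_derive_schwartz x (sv n.+1); have d2 := is_derive_schwartz x (sv n.-1).
by rewrite derive_val.
Qed.

Lemma derive1_opD (v : nat -> R -> R) n : (forall m, schwartz (v m)) ->
  derive1 (fun x => D (v ^~ x) n) = fun x => D ((fun m => derive1 (v m)) ^~ x) n.
Proof.
move=> sv; apply/funext => x; rewrite derive1E /opD.
have d1 := is_derive_schwartz x (sv n.+1); have d2 := is_derive_schwartz x (sv n.-1).
by rewrite derive_val.
Qed.

Lemma mulX_hg0 n : mulX (hg 0 n) = fun x => X (hg 0 ^~ x) n.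
Proof. by apply/funext => x; rewrite /mulX opX_hg0. Qed.

Lemma derive1_hg0 n : derive1 (hg 0 n) = fun x => D (hg 0 ^~ x) n.
Proof.
apply/funext => x; rewrite derive1E.
by have H := is_derive_hg 0 n x; rewrite derive_val.
Qed.

Lemma ip_mulX_hg0 (f : R -> R) n : sqi f -> ip f (mulX (hg 0 n)) = X (fun m => ip f (hg 0 m)) n.
Proof. by move=> sf; rewrite mulX_hg0 ip_opX // => m; exact: sqi_hg. Qed.

Lemma ip_derive1_hg0 (f : R -> R) n : sqi f -> ip f (derive1 (hg 0 n)) = D (fun m => ip f (hg 0 m)) n.
Proof. by move=> sf; rewrite derive1_hg0 ip_opD // => m; exact: sqi_hg. Qed.

End HermiteOperators.

(** * The harmonic rotation and the reduced generator *)

Section CoefficientHamiltonian.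
Context {R : realType}.
Variables (kappa iota : R).
Implicit Types (t : R) (n m k : nat) (a v w : nat -> R[i]) (u psi : R -> R[i]) (phi : R -> R).
Local Notation XC := (opX BC).
Local Notation DC := (opD BC).
Local Notation ham := (hamiltonian kappa iota Xdist Ddist).

(** Operators pass to the test function in reverse order, and each derivative brings a sign. *)
Lemma hamiltonianE t (T : @tempered R) phi : ham t T phi =
  (2^-1)%:C * (- T (derive1 (derive1 phi)) + T (mulX (mulX phi))) +
  (kappa / 2)%:C * (- (cos t ^+ 2)%:C * T (mulX (mulX phi))
    + 'i * (cos t * sin t)%:C * (T (derive1 (mulX phi)) + T (mulX (derive1 phi)))
    + (sin t ^+ 2)%:C * T (derive1 (derive1 phi)))
  - 2 * 'i * (iota * cos t)%:C * T (derive1 phi).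
Proof.
rewrite /hamiltonian /H0 /Wop /Xdist /Ddist !fctE /GRing.scale /=.
ring.
Qed.

Lemma pairing_opX u (v : nat -> R -> R) n : csqi u -> (forall m, sqi (v m)) ->
  pairing u (fun x => opX Bc (v ^~ x) n) = XC (fun m => pairing u (v m)) n.
Proof.
move=> [sr si] sv; rewrite pairingE !ip_opX //.
under [in RHS]eq_fun do rewrite pairingE.
by apply: complex_eq; rewrite ?Re_opX ?Im_opX.
Qed.

Lemma pairing_opD u (v : nat -> R -> R) n : csqi u -> (forall m, sqi (v m)) ->
  pairing u (fun x => opD Bc (v ^~ x) n) = DC (fun m => pairing u (v m)) n.
Proof.
move=> [sr si] sv; rewrite pairingE !ip_opD //.
under [in RHS]eq_fun do rewrite pairingE.
by apply: complex_eq; rewrite ?Re_opD ?Im_opD.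
Qed.

Definition hamc t a n : R[i] :=
  (2^-1)%:C * (- DC (DC a) n + XC (XC a) n) +
  (kappa / 2)%:C * (- (cos t ^+ 2)%:C * XC (XC a) n
    + 'i * (cos t * sin t)%:C * (XC (DC a) n + DC (XC a) n)
    + (sin t ^+ 2)%:C * DC (DC a) n)
  - 2 * 'i * (iota * cos t)%:C * DC a n.

Lemma hamiltonian_hermite t u n : csqi u ->
  ham t (regular_dist u) (hermite n) = hamc t (hcoef u) n.
Proof.
move=> su; rewrite hermite_hg0 hamiltonianE /hamc /regular_dist.
have sh m : schwartz (hg (0 : R) m) := schwartz_hg m.
have sm m := schwartz_mulX (sh m); have sd m := schwartz_derive1 (sh m).
have qh m := sqi_schwartz (sh m); have qm m := sqi_schwartz (sm m).
have qd m := sqi_schwartz (sd m).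
have E : hcoef u = fun m => pairing u (hg 0 m).
  by apply/funext => m; rewrite /hcoef hermite_hg0.
have EX : (fun m => pairing u (mulX (hg 0 m))) = XC (hcoef u).
  by apply/funext => m; rewrite mulX_hg0 pairing_opX // E.
have ED : (fun m => pairing u (derive1 (hg 0 m))) = DC (hcoef u).
  by apply/funext => m; rewrite derive1_hg0 pairing_opD // E.
have -> : pairing u (mulX (mulX (hg 0 n))) = XC (XC (hcoef u)) n.
  by rewrite -EX {1}mulX_hg0 mulX_opX pairing_opX.
have -> : pairing u (mulX (derive1 (hg 0 n))) = DC (XC (hcoef u)) n.
  by rewrite -EX {1}derive1_hg0 mulX_opD pairing_opD.
have -> : pairing u (derive1 (mulX (hg 0 n))) = XC (DC (hcoef u)) n.
  by rewrite -ED {1}mulX_hg0 derive1_opX // pairing_opX.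
have -> : pairing u (derive1 (derive1 (hg 0 n))) = DC (DC (hcoef u)) n.
  by rewrite -ED {1}derive1_hg0 derive1_opD // pairing_opD.
by rewrite -[pairing u (derive1 _)]/((fun m => pairing u (derive1 (hg 0 m))) n) ED.
Qed.

(* eigenvalues of exp (- i t H0 / 2) *)
Definition ev t n : R[i] := cos (lam n / 2 * t) +i* (- sin (lam n / 2 * t)).

Lemma evS t n : ev t n.+1 = ev t n * (cos t +i* - sin t).
Proof.
have -> : ev t n.+1 = cos (lam n / 2 * t + t) +i* - sin (lam n / 2 * t + t).
  by rewrite /ev /lam -natr1; congr (cos _ +i* - sin _); field.
by apply: complex_eq; rewrite ?Re_mul ?Im_mul /= ?cosD ?sinD; ring.
Qed.

Lemma cos2Dsin2C t : (cos t)%:C ^+ 2 + (sin t)%:C ^+ 2 = 1 :> R[i].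
Proof. by rewrite -!rmorphXn -rmorphD /= cos2Dsin2. Qed.

Lemma sqr_i : 'i * 'i = -1 :> R[i].
Proof. by rewrite -expr2 sqr_i. Qed.

Lemma cisE (x y : R) : x +i* y = x%:C + 'i * y%:C.
Proof. by apply: complex_eq; rewrite /=; ring. Qed.

Lemma ev_pred t n : BC n * ev t n.-1 = BC n * (ev t n * (cos t +i* sin t)).
Proof.
case: n => [|n]; first by rewrite /BC Bc0 !mul0r.
rewrite evS -[ev t n.+1.-1]/(ev t n) !cisE rmorphN /=.
have := cos2Dsin2C t; have := sqr_i; set c := (cos t)%:C; set s := (sin t)%:C => i2 cs.
congr (_ * _); rewrite -mulrA.
have -> : (c + 'i * - s) * (c + 'i * s) = c ^+ 2 - 'i * 'i * s ^+ 2 by ring.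
by rewrite i2 mulN1r opprK cs mulr1.
Qed.

(** Eigenvalues of neighbouring levels differ by a factor [exp (- i t)] or [exp (i t)], so the
    harmonic flow rotates position and momentum into each other. *)
Lemma ev_X t v n : XC (fun m => ev t m * v m) n =
  ev t n * ((cos t)%:C * XC v n + 'i * (sin t)%:C * DC v n).
Proof.
rewrite /opX mulrA [BC n * (_ * _)]mulrA ev_pred evS !cisE rmorphN /= /opD; ring.
Qed.

Lemma ev_D t v n : DC (fun m => ev t m * v m) n =
  ev t n * ((cos t)%:C * DC v n + 'i * (sin t)%:C * XC v n).
Proof.
rewrite /opD [BC n * (_ * _)]mulrA ev_pred evS !cisE rmorphN /= /opX; ring.
Qed.

Lemma XCl (a b : R[i]) v w n : XC (fun m => a * v m + b * w m) n = a * XC v n + b * XC w n.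
Proof. by rewrite /opX; ring. Qed.
Lemma DCl (a b : R[i]) v w n : DC (fun m => a * v m + b * w m) n = a * DC v n + b * DC w n.
Proof. by rewrite /opD; ring. Qed.

(** The resonance: the rotation undoes the time dependence of the quadratic part, leaving
    [kappa / 2] times [opX] squared inside [kac], while [cos t] meets its own rotation and becomes
    [cos t ^ 2] in [kbc]. *)
Lemma hamc_ev t v n : hamc t (fun m => ev t m * v m) n =
  ev t n * ((lam n / 2)%:C * v n - kac kappa iota t v n - 'i * kbc iota t v n).
Proof.
rewrite /hamc.
have -> : XC (fun m => ev t m * v m) =
    fun m => ev t m * ((cos t)%:C * XC v m + 'i * (sin t)%:C * DC v m).
  by apply/funext => m; exact: ev_X.
have -> : DC (fun m => ev t m * v m) =
    fun m => ev t m * ((cos t)%:C * DC v m + 'i * (sin t)%:C * XC v m).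
  by apply/funext => m; exact: ev_D.
rewrite !ev_X !ev_D !XCl !DCl /kac /kbc.
have -> : (lam n / 2)%:C * v n = (2^-1)%:C * (XC (XC v) n - DC (DC v) n).
  by rewrite opXX_DD mulrA -rmorphM /= [2^-1 * _]mulrC.
have -> : (2 * iota * sin t * cos t)%:C = 2 * iota%:C * (sin t)%:C * (cos t)%:C.
  by rewrite -[2]/(2%:R) -(rmorph_nat (real_complex R)) -!rmorphM.
have -> : (2 * iota * cos t ^+ 2)%:C = 2 * iota%:C * (cos t)%:C ^+ 2.
  by rewrite -[2]/(2%:R) -(rmorph_nat (real_complex R)) -rmorphXn -!rmorphM.
have -> : (cos t ^+ 2)%:C = (cos t)%:C ^+ 2 by rewrite -rmorphXn.
have -> : (sin t ^+ 2)%:C = (sin t)%:C ^+ 2 by rewrite -rmorphXn.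
have -> : (cos t * sin t)%:C = (cos t)%:C * (sin t)%:C by rewrite -rmorphM.
have -> : (iota * cos t)%:C = iota%:C * (cos t)%:C by rewrite -rmorphM.
set c := (cos t)%:C; set s := (sin t)%:C.
have i2 := sqr_i; have cs : s ^+ 2 = 1 - c ^+ 2 by rewrite -(cos2Dsin2C t); ring.
set XX := XC (XC v) n; set XD := XC (DC v) n; set DX := DC (XC v) n; set DD := DC (DC v) n.
set X1 := XC v n; set D1 := DC v n; set K := (kappa / 2)%:C; set h := (2^-1)%:C.
ring: i2 cs.
Qed.

Lemma is_cderive_eq (f : R -> R[i]) t (d d' : R[i]) : is_cderive f t d -> d = d' -> is_cderive f t d'.
Proof. by move=> H <-. Qed.

Lemma is_cderiveM (f g : R -> R[i]) t (df dg : R[i]) : is_cderive f t df -> is_cderive g t dg ->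
  is_cderive (fun r => f r * g r) t (df * g t + f t * dg).
Proof.
move=> [f1 f2] [g1 g2]; split.
  under eq_fun do rewrite Re_mul.
  by rewrite Re_add !Re_mul; apply: is_derive_eq; rewrite /GRing.scale /=; ring.
under eq_fun do rewrite Im_mul.
by rewrite Im_add !Im_mul; apply: is_derive_eq; rewrite /GRing.scale /=; ring.
Qed.

Lemma is_cderive_ev t n : is_cderive (ev ^~ n) t (- 'i * (lam n / 2)%:C * ev t n).
Proof.
have dl : is_derive t 1 (fun t => lam n / 2 * t) (lam n / 2).
  by apply: is_derive_eq; rewrite /GRing.scale /= mulr1.
have dc := @is_derive1_comp R cos _ t _ _ (is_derive_cos _) dl.
have ds := @is_derive1_comp R sin _ t _ _ (is_derive_sin _) dl.
split.
  rewrite -mulrA mulNr Re_opp Re_iM Im_CM opprK mulrC; exact: dc.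
rewrite -mulrA mulNr Im_opp Im_iM Re_CM mulrC -mulNr.
have H := @is_deriveN R R R _ t 1 _ ds.
by rewrite mulNr; exact: H.
Qed.

Definition av t psi n : R[i] := ev t n * cw kappa iota t psi n.

Lemma is_cderive_av t psi n : csqi psi ->
  is_cderive (fun r => av r psi n) t (- 'i * hamc t (av t psi) n).
Proof.
move=> sp; apply: is_cderive_eq (is_cderiveM (is_cderive_ev t n) (is_cderive_cw kappa iota t n sp)) _.
rewrite /av (hamc_ev t (cw kappa iota t psi)); have i2 := sqr_i; ring: i2.
Qed.

Lemma sqn_ev t n : sqn (ev t n) = 1.
Proof. by rewrite /sqn /= sqrrN cos2Dsin2. Qed.

Lemma sqn_av t psi n : sqn (av t psi n) = sqn (cw kappa iota t psi n).
Proof. by rewrite /av sqnM sqn_ev mul1r. Qed.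

Lemma av0 psi n : av 0 psi n = hcoef psi n.
Proof.
rewrite /av cw0 /ev mulr0 cos0 sin0 oppr0.
by apply: complex_eq; rewrite ?Re_mul ?Im_mul /=; ring.
Qed.

End CoefficientHamiltonian.

(** * Uniqueness *)

Section L2Limits.
Context {R : realType}.
Implicit Types (psi : R -> R[i]).

Lemma sqr_cvg0 (T : Type) (F : set_system T) {FF : Filter F} (z y : T -> R) :
  (forall t, z t ^+ 2 <= y t) -> y t @[t --> F] --> (0 : R) -> z t @[t --> F] --> (0 : R).
Proof.
move=> zy Y; apply/cvgrPdist_lt => e e0.
have /cvgrPdist_lt /(_ (e ^+ 2) (exprn_gt0 2 e0)) := Y.
apply: filterS => t /=; rewrite !sub0r !normrN => yt.
rewrite -(@ltr_pXn2r _ 2) ?nnegrE ?(ltW e0) // real_normK ?num_real //.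
by apply: le_lt_trans yt; apply: le_trans (zy t) (ler_norm _).
Qed.

Lemma le_cvg0 (T : Type) (F : set_system T) {FF : Filter F} (z y : T -> R) :
  (forall t, 0 <= z t <= y t) -> y t @[t --> F] --> (0 : R) -> z t @[t --> F] --> (0 : R).
Proof.
move=> zy Y; apply/cvgrPdist_lt => e e0.
have /cvgrPdist_lt /(_ e e0) := Y.
apply: filterS => t /=; rewrite !sub0r !normrN => yt; have /andP[z0 zt] := zy t.
by rewrite ger0_norm //; apply: le_lt_trans yt; apply: le_trans zt (ler_norm _).
Qed.

Lemma ip_cvg (T : Type) (F : set_system T) {FF : Filter F} (f : T -> R -> R) (g h : R -> R) :
  (forall t, sqi (f t)) -> sqi g -> sqi h ->
  ip (fun x => f t x - g x) (fun x => f t x - g x) @[t --> F] --> (0 : R) ->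
  ip (f t) h @[t --> F] --> ip g h.
Proof.
move=> sf sg sh C.
have D : ip (fun x => f t x - g x) h @[t --> F] --> (0 : R).
  apply: (@sqr_cvg0 _ _ _ _ (fun t => ip (fun x => f t x - g x) (fun x => f t x - g x) * ip h h)).
    by move=> t; apply: ip_CS => //; exact: sqiB.
  by rewrite -(mul0r (ip h h)); apply: cvgM => //; exact: cvg_cst.
have -> : (fun t => ip (f t) h) = fun t => ip (fun x => f t x - g x) h + ip g h.
  by apply/funext => t; rewrite ipBl // subrK.
by rewrite -[X in _ --> X]add0r; apply: cvgD => //; exact: cvg_cst.
Qed.

Lemma ip_self_cvg (T : Type) (F : set_system T) {FF : Filter F} (f : T -> R -> R) (g : R -> R) :
  (forall t, sqi (f t)) -> sqi g ->
  ip (fun x => f t x - g x) (fun x => f t x - g x) @[t --> F] --> (0 : R) ->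
  ip (f t) (f t) @[t --> F] --> ip g g.
Proof.
move=> sf sg C; have D : ip (f t) g @[t --> F] --> ip g g by exact: ip_cvg.
have -> : (fun t => ip (f t) (f t)) = fun t =>
    ip (fun x => f t x - g x) (fun x => f t x - g x) + (2 * ip (f t) g - ip g g).
  by apply/funext => t; rewrite ip_sqB //; ring.
rewrite [X in _ --> X](_ : _ = 0 + (2 * ip g g - ip g g)); last by ring.
apply: cvgD => //; apply: cvgB; last exact: cvg_cst.
by apply: cvgM; [exact: cvg_cst|exact: D].
Qed.

Lemma csqi_cvg (T : Type) (F : set_system T) {FF : Filter F} (u : T -> R -> R[i]) psi :
  (forall t, csqi (u t)) -> csqi psi ->
  nrm2 (fun x => u t x - psi x) @[t --> F] --> (0 : R) ->
  [/\ nrm2 (u t) @[t --> F] --> nrm2 psi,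
    forall h, sqi h -> ip (re (u t)) h @[t --> F] --> ip (re psi) h &
    forall h, sqi h -> ip (im (u t)) h @[t --> F] --> ip (im psi) h].
Proof.
move=> su sp; under eq_fun do rewrite nrm2B.
move=> C.
have Cr : ip (fun x => re (u t) x - re psi x) (fun x => re (u t) x - re psi x) @[t --> F] --> (0 : R).
  by apply: le_cvg0 C => t; rewrite ip_ge0 lerDl ip_ge0.
have Ci : ip (fun x => im (u t) x - im psi x) (fun x => im (u t) x - im psi x) @[t --> F] --> (0 : R).
  by apply: le_cvg0 C => t; rewrite ip_ge0 lerDr ip_ge0.
have sr t := (su t).1; have si t := (su t).2.
split=> [|h sh|h sh].
- by apply: cvgD; apply: ip_self_cvg => //; case: sp.
- by apply: ip_cvg => //; case: sp.
- by apply: ip_cvg => //; case: sp.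
Qed.

End L2Limits.

(** * Mass balance of the difference of two solutions *)

Section Uniqueness.
Context {R : realType}.
Variables (kappa iota : R).
Implicit Types (t : R) (n m : nat) (d : nat -> R[i]).

Definition dot (z z' : R[i]) : R := complex.Re z * complex.Re z' + complex.Im z * complex.Im z'.
Definition crs (z z' : R[i]) : R := complex.Re z * complex.Im z' - complex.Im z * complex.Re z'.

(* mass exchanged with the level n - 1, resp. n - 2 *)
Definition fl1 t d n : R := 4 * iota * cos t * Bc n * dot (d n.-1) (d n).
Definition fl2 t d n : R := 2 * Bc n.-1 * Bc n *
  (kappa / 2 * (sin t ^+ 2 - cos t ^+ 2) * crs (d n.-2) (d n)
   - kappa * cos t * sin t * dot (d n.-2) (d n)).

(** The matrix of [hamc] is Hermitian: the diagonal contributes nothing to the variation of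
    [sqn (d n)], and what level [n] gains from another level is what that level loses. First-order
    terms couple levels at distance 1, quadratic ones levels at distance 2. *)
Lemma hamc_flux t d n :
  2 * crs (d n) (hamc kappa iota t d n) =
  (fl1 t d n.+1 - fl1 t d n) + (fl2 t d n.+2 - fl2 t d n).
Proof.
have E2 (x : R) : (2 : R[i]) * 'i * x%:C = 'i * (2 * x)%:C.
  by rewrite rmorphM /= -[2 in RHS]/(2%:R) rmorph_nat; ring.
rewrite /crs /hamc E2 /opX /opD /BC -!mulrA !mulNr.
rewrite !(Re_add, Im_add, Re_opp, Im_opp, Re_iM, Im_iM, Re_CM, Im_CM).
rewrite /fl1 /fl2 /dot /crs.
by case: n => [|n] /=; rewrite ?Bc0; field.
Qed.

Lemma Bc_lin n : Bc n.+1 <= n.+1%:R :> R.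
Proof.
have := @Bc_sq R n.+1; have := sqr_ge0 (Bc n.+1 - 1 : R).
have : 1 <= n.+1%:R :> R by rewrite ler1n.
nra.
Qed.

Lemma Bc_lin2 n : Bc n.+1 * Bc n.+2 <= n.+1%:R :> R.
Proof.
have := @Bc_sq R n.+1; have := @Bc_sq R n.+2; have := sqr_ge0 (Bc n.+1 - Bc n.+2 : R).
have : 1 <= n.+1%:R :> R by rewrite ler1n.
rewrite -[n.+2%:R]natr1; nra.
Qed.

Lemma dot_le (z z' : R[i]) : `|dot z z'| <= (sqn z + sqn z') / 2.
Proof.
case: z => a b; case: z' => a' b'; rewrite /dot /sqn /= ler_norml.
have := sqr_ge0 (a - a'); have := sqr_ge0 (b - b').
have := sqr_ge0 (a + a'); have := sqr_ge0 (b + b') => h1 h2 h3 h4.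
by apply/andP; split; nra.
Qed.

Lemma crs_le (z z' : R[i]) : `|crs z z'| <= (sqn z + sqn z') / 2.
Proof.
case: z => a b; case: z' => c d; rewrite /crs /sqn /= ler_norml.
have := sqr_ge0 (a - d); have := sqr_ge0 (b - c).
have := sqr_ge0 (a + d); have := sqr_ge0 (b + c) => h1 h2 h3 h4.
by apply/andP; split; nra.
Qed.

Lemma fl1_le t d n :
  `|fl1 t d n.+1| <= (2 * `|iota| + 2 * `|kappa|) * n.+1%:R * (sqn (d n) + sqn (d n.+1)).
Proof.
rewrite /fl1 /= !normrM (ger0_norm (Bc_ge0 _)) (@ger0_norm _ 4) //.
set e := sqn _ + sqn _; have e0 : 0 <= e by rewrite addr_ge0 ?sqn_ge0.
apply: (@le_trans _ _ (4 * `|iota| * 1 * n.+1%:R * (e / 2))).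
  rewrite ler_pM ?dot_le ?mulr_ge0 ?Bc_ge0 //.
  by rewrite ler_pM ?mulr_ge0 ?Bc_ge0 ?Bc_lin // ler_wpM2l ?mulr_ge0 // cos_norm_le1.
have : 0 <= `|kappa| * n.+1%:R * e by rewrite !mulr_ge0.
lra.
Qed.

Lemma fl2_le t d n :
  `|fl2 t d n.+2| <= (2 * `|iota| + 2 * `|kappa|) * n.+1%:R * (sqn (d n) + sqn (d n.+2)).
Proof.
rewrite /fl2 /=; set e := sqn _ + sqn _; have e0 : 0 <= e by rewrite addr_ge0 ?sqn_ge0.
have hD := dot_le (d n) (d n.+2); have hC := crs_le (d n) (d n.+2).
rewrite -/e in hD hC.
have c1 := @cos_norm_le1 R t; have s1 := @sin_norm_le1 R t.
have cs := cos2Dsin2 t; have c0 := sqr_ge0 (cos t); have s0 := sqr_ge0 (sin t).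
rewrite normrM -mulrA normrM (ger0_norm (mulr_ge0 (Bc_ge0 _) (Bc_ge0 _))) (@ger0_norm _ 2) //.
apply: (@le_trans _ _ (2 * n.+1%:R * (`|kappa| * e))).
  apply: ler_pM; rewrite ?mulr_ge0 ?Bc_ge0 //; first by rewrite ler_wpM2l // Bc_lin2.
  apply: (le_trans (ler_normB _ _)).
  have -> : `|kappa| * e = `|kappa| * (e / 2) + `|kappa| * (e / 2) by field.
  apply: lerD; rewrite normrM ler_pM //.
    rewrite -mulrA normrM ler_piMr // normrM (ger0_norm (_ : 0 <= 2^-1)) //.
    have : `|sin t ^+ 2 - cos t ^+ 2| <= 1 by rewrite ler_norml; apply/andP; split; lra.
    by lra.
  rewrite -mulrA normrM ler_piMr // normrM mulr_ile1 //.
have : 0 <= `|iota| * n.+1%:R * e by rewrite !mulr_ge0.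
lra.
Qed.

Lemma is_derive_sqn (f : R -> R[i]) t (h : R[i]) : is_cderive f t (- 'i * h) ->
  is_derive t 1 (fun r => sqn (f r)) (2 * crs (f t) h).
Proof.
move=> [d1 d2]; rewrite mulNr Re_opp Re_iM opprK in d1; rewrite mulNr Im_opp Im_iM in d2.
rewrite /sqn; apply: is_derive_eq; rewrite /GRing.scale /= /crs; ring.
Qed.

Lemma hamc_sub t (v w : nat -> R[i]) n :
  hamc kappa iota t (fun m => v m - w m) n = hamc kappa iota t v n - hamc kappa iota t w n.
Proof. by rewrite /hamc /opX /opD; ring. Qed.

Lemma hcoef_ae psi psi' n : csqi psi -> csqi psi' ->
  {ae (@lebesgue_measure R), forall x, psi x = psi' x} -> hcoef psi n = hcoef psi' n.
Proof.
move=> [sr si] [sr' si'] E; rewrite !hcoefE; congr (_ +i* _).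
- apply: ip_ae_eq => //; [exact: sqi_hg|exact: sqi_meas|].
  by case: E => N [mN N0 sN]; exists N; split=> // x H; apply: sN => /= e; apply: H => /=; rewrite /re e.
- apply: ip_ae_eq => //; [exact: sqi_hg|exact: sqi_meas|].
  by case: E => N [mN N0 sN]; exists N; split=> // x H; apply: sN => /= e; apply: H => /=; rewrite /im e.
Qed.

Lemma solution_cvg u0 u : solution kappa iota u0 u -> forall t0, 0 <= t0 ->
  [/\ nrm2 (u t) @[t --> within [set t | 0 <= t] (nbhs t0)] --> nrm2 (u t0),
    forall n, complex.Re (hcoef (u t) n) @[t --> within [set t | 0 <= t] (nbhs t0)]
      --> complex.Re (hcoef (u t0) n) &
    forall n, complex.Im (hcoef (u t) n) @[t --> within [set t | 0 <= t] (nbhs t0)]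
      --> complex.Im (hcoef (u t0) n)].
Proof.
move=> [uL uC _ _] t0 t00; set F := within _ _.
(* only times [t >= 0] are controlled by the hypothesis *)
pose v t := u `|t|.
have sv t : csqi (v t) by apply/L2_csqi/uL.
have vt0 : v t0 = u t0 by rewrite /v ger0_norm.
have nF (P : R -> Prop) : (forall t, 0 <= t -> P t) -> \forall t \near F, P t.
  by move=> H; apply: filterS (withinT _ _) => t /= /H.
have FF : Filter F by exact: within_filter.
have C : nrm2 (fun x => v t x - u t0 x) @[t --> F] --> (0 : R).
  apply: (L2enorm_cvg0 _).1; first by move=> t; apply: csqiB => //; rewrite -vt0.
  apply: cvg_trans (uC t0 t00); apply: near_eq_cvg; apply: nF => t t1 /=.
  by rewrite /v ger0_norm.
have st0 : csqi (u t0) by rewrite -vt0.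
have [Cn Cr Ci] := csqi_cvg sv st0 C.
split=> [|n|n].
- apply: cvg_trans Cn; apply: near_eq_cvg; apply: nF => t t1 /=.
  by rewrite /v ger0_norm.
- rewrite hcoefE; apply: cvg_trans (Cr _ (sqi_hg 0 n)); apply: near_eq_cvg; apply: nF => t t1.
  by rewrite hcoefE /v ger0_norm.
- rewrite hcoefE; apply: cvg_trans (Ci _ (sqi_hg 0 n)); apply: near_eq_cvg; apply: nF => t t1.
  by rewrite hcoefE /v ger0_norm.
Qed.

Lemma is_cderive_cvg (f : R -> R[i]) t (d : R[i]) (F : set_system R) {FF : Filter F} :
  F --> t -> is_cderive f t d ->
  complex.Re (f r) @[r --> F] --> complex.Re (f t) /\
  complex.Im (f r) @[r --> F] --> complex.Im (f t).
Proof.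
move=> Ft [[d1 _] [d2 _]].
move/derivable1_diffP/differentiable_continuous: d1 => c1.
move/derivable1_diffP/differentiable_continuous: d2 => c2.
by split; [exact: (cvg_trans (cvg_app _ Ft) c1)|exact: (cvg_trans (cvg_app _ Ft) c2)].
Qed.

Theorem solution_hcoef u0 u t n : csqi u0 -> solution kappa iota u0 u -> 0 <= t ->
  hcoef (u t) n = av kappa iota t u0 n.
Proof.
move=> s0 su; have [uL uC ui ue] := su; have Uc := solution_cvg su.
have sv r : 0 <= r -> csqi (u r) by move=> r0; apply/L2_csqi/uL.
have h0 m : hcoef (u 0) m = hcoef u0 m by apply: hcoef_ae => //; exact: sv.
rewrite le_eqVlt => /predU1P[<-|t0]; first by rewrite av0 h0.
pose d r m := hcoef (u r) m - av kappa iota r u0 m.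
suff E : sqn (d t n) = 0.
  have : d t n = 0.
    move: E; case: (d t n) => a b /eqP; rewrite /sqn /= paddr_eq0 ?sqr_ge0 //.
    by rewrite !sqrf_eq0 => /andP[/eqP -> /eqP ->].
  by move=> /eqP; rewrite subr_eq0 => /eqP.
(* The weak equation is tested on Hermite functions only; both families of coefficients solve the
   same linear system, hence so does their difference. *)
have cdiff r m : 0 < r -> is_cderive (fun r => d r m) r (- 'i * hamc kappa iota r (d r) m).
  move=> r0; have sh : schwartz (@hermite R m) by rewrite hermite_hg0; exact: schwartz_hg.
  have [d1 [D1 E1]] := ue r (hermite m) r0 sh.
  have -> : - 'i * hamc kappa iota r (d r) m = d1 - (- 'i * hamc kappa iota r (av kappa iota r u0) m).
    rewrite /d hamc_sub -(hamiltonian_hermite _ _ _ _ (sv r (ltW r0))) -E1.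
    have i2 := @sqr_i R; ring: i2.
  have [D2 D3] := @is_cderive_av R kappa iota r u0 m s0; case: D1 => D1 D1'.
  split.
    under eq_fun do rewrite Re_add Re_opp.
    by rewrite Re_add Re_opp; exact: is_deriveB.
  under eq_fun do rewrite Im_add Im_opp.
  by rewrite Im_add Im_opp; exact: is_deriveB.
(* Conservation of mass is not known for an arbitrary solution; continuity on a compact interval
   gives the bound that [flux_vanish] needs. *)
have [K HK] : exists K, forall r, 0 <= r <= t -> nrm2 (u r) <= K.
  have cn : {within `[0, t], continuous (fun r => nrm2 (u r))}.
    apply/subspace_continuousP => r /=; rewrite in_itv /= => /andP[r0 rt].
    have [C _ _] := Uc r r0; apply: cvg_trans C; apply: cvg_app; apply: within_subset.
    by move=> x /=; rewrite in_itv /= => /andP[].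
  have [c _ Hc] := EVT_max (ltW t0) cn.
  by exists (nrm2 (u c)) => r rt; apply: Hc; rewrite in_itv.
pose C := 2 * `|iota| + 2 * `|kappa|.
apply: (@flux_vanish R (fun m r => sqn (d r m)) (fun m r => fl1 r (d r) m)
   (fun m r => fl2 r (d r) m) C (2 * K + 2 * nrm2 u0) t t0).
- by move=> m r _; exact: sqn_ge0.
- move=> m; apply/subspace_continuousP => r /=; rewrite in_itv /= => /andP[r0 rt].
  have [_ Cr Ci] := Uc r r0.
  have sub : within [set` `[0, t]] (nbhs r) `=>` within [set x | 0 <= x] (nbhs r).
    by apply: within_subset => x /=; rewrite in_itv /= => /andP[].
  have [Ar Ai] := @is_cderive_cvg _ r _ (within [set` `[0, t]] (nbhs r)) _ (@cvg_within _ _ _ _)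
    (@is_cderive_av R kappa iota r u0 m s0).
  have Hr := cvg_trans (cvg_app _ sub) (Cr m); have Hi := cvg_trans (cvg_app _ sub) (Ci m).
  have FF : Filter (within [set` `[0, t]] (nbhs r)) by exact: within_filter.
  have Dr := cvgB Hr Ar; have Di := cvgB Hi Ai.
  have -> : (fun x => sqn (d x m)) = fun x =>
      (complex.Re (hcoef (u x) m) - complex.Re (av kappa iota x u0 m)) *
      (complex.Re (hcoef (u x) m) - complex.Re (av kappa iota x u0 m)) +
      (complex.Im (hcoef (u x) m) - complex.Im (av kappa iota x u0 m)) *
      (complex.Im (hcoef (u x) m) - complex.Im (av kappa iota x u0 m)).
    by apply/funext => x; rewrite /sqn /d Re_add Re_opp Im_add Im_opp.
  by apply: cvgD; apply: cvgM; first [exact: (Dr FF)|exact: (Di FF)].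
- move=> m r /andP[r0 _]; rewrite -hamc_flux; apply: is_derive_sqn; exact: cdiff.
- by move=> r; rewrite /fl1 /fl2 /= !Bc0; split; ring.
- by move=> m r _; exact: fl1_le.
- by move=> m r _; exact: fl2_le.
- move=> N r /andP[r0 rt].
  apply: (@le_trans _ _ (\sum_(m < N) (2 * sqn (hcoef (u r) m) + 2 * sqn (av kappa iota r u0 m)))).
    by apply: ler_sum => m _; exact: sqnB_le.
  rewrite big_split /= -!mulr_sumr lerD // ler_wpM2l //.
    by apply: le_trans (csqi_bessel N (sv r r0)) _; apply: HK; rewrite r0.
  by under eq_bigr do rewrite sqn_av; exact: cw_bessel.
- by rewrite addr_ge0 ?mulr_ge0.
- by move=> m; rewrite /d h0 av0 subrr sqn0.
Qed.

End Uniqueness.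

(** * Existence *)

Section TermwiseDerivative.
Context {R : realType}.
Implicit Types (f g : nat -> R -> R) (t : R).

Lemma lipschitz_derive (f df : R -> R) (M : R) : (forall x : R, is_derive x 1 f (df x)) ->
  (forall x, `|df x| <= M) -> forall a b : R, `|f b - f a| <= M * `|b - a|.
Proof.
move=> fd dM a b; wlog ab : a b / a <= b => [H|].
  have [ab|/ltW ba] := leP a b; first exact: H.
  by rewrite distrC [`|b - a|]distrC; exact: H.
have cf : {within `[a, b], continuous f}.
  apply: derivable_within_continuous => x _; by case: (fd x).
have [c _ ->] := MVT_segment ab (fun x _ => fd x) cf.
by rewrite normrM ler_wpM2r.
Qed.

Lemma sum_telescope_le (K : R) N M : 0 <= K -> (N <= M)%N ->
  \sum_(N <= n < M) K * (n.+1%:R^-1 - n.+2%:R^-1) <= K * N.+1%:R^-1.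
Proof.
move=> K0 NM; rewrite -mulr_sumr ler_wpM2l //.
under eq_bigr do rewrite -opprB.
rewrite sumrN (telescope_sumr (fun n => n.+1%:R^-1) NM) opprB.
by rewrite gerBl invr_ge0.
Qed.

(** The telescoping majorant makes the tail of the series of derivatives at most [K / (N + 1)], and
    by the mean value inequality the same holds for the tails of the difference quotients, uniformly
    in the increment. *)
Lemma is_derive_series f g (F : R -> R) (G K : R) t :
  (forall n (r : R), is_derive r 1 (f n) (g n r)) ->
  (forall n r, `|g n r| <= K * (n.+1%:R^-1 - n.+2%:R^-1)) -> 0 <= K ->
  (forall r, \sum_(n < N) f n r @[N --> \oo] --> F r) ->
  \sum_(n < N) g n t @[N --> \oo] --> G ->
  is_derive t 1 F G.
Proof.
move=> df gK K0 fF gG.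
suff C : h^-1 *: ((F \o shift t) (h *: 1) - F t) @[h --> 0^'] --> G.
  by apply: DeriveDef; [exact: (cvgP G C)|exact: (cvg_lim _ C)].
have tail (N M : nat) : (N <= M)%N -> `|\sum_(n < M) g n t - \sum_(n < N) g n t| <= K * N.+1%:R^-1.
  move=> NM; rewrite -!(big_mkord xpredT (g ^~ t)) (big_cat_nat (leq0n N) NM) /= addrAC subrr add0r.
  apply: (le_trans (ler_norm_sum _ _ _)); apply: le_trans (sum_telescope_le K0 NM).
  by apply: ler_sum => n _.
have tailF (N M : nat) r : (N <= M)%N ->
   `|(\sum_(n < M) f n r - \sum_(n < M) f n t) - (\sum_(n < N) f n r - \sum_(n < N) f n t)|
     <= K * N.+1%:R^-1 * `|r - t|.
  move=> NM.
  have -> : (\sum_(n < M) f n r - \sum_(n < M) f n t) - (\sum_(n < N) f n r - \sum_(n < N) f n t) =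
     \sum_(N <= n < M) f n r - \sum_(N <= n < M) f n t.
    rewrite -!(big_mkord xpredT (f ^~ _)) !(big_cat_nat (leq0n N) NM) /=; ring.
  rewrite -sumrB; apply: (le_trans (ler_norm_sum _ _ _)).
  apply: (@le_trans _ _ (\sum_(N <= n < M) K * (n.+1%:R^-1 - n.+2%:R^-1) * `|r - t|)).
    by apply: ler_sum => n _; apply: (lipschitz_derive (df n) (gK n)).
  by rewrite -mulr_suml ler_wpM2r // sum_telescope_le.
apply/cvgrPdist_le => e e0.
(* Three errors of [e / 3]: the tail of [G], the finite sum of difference quotients, and the tail of
   the difference quotient of [F]. *)
have [N HN] : exists N : nat, K * N.+1%:R^-1 <= e / 3.
  exists (Num.truncn (K / (e / 3))); rewrite ler_pdivrMr //.
  rewrite mulrC -ler_pdivrMr ?divr_gt0 //; apply/ltW/truncnS_gt.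
have limG : `|G - \sum_(n < N) g n t| <= e / 3.
  have : `|\sum_(n < M) g n t - \sum_(n < N) g n t| @[M --> \oo] --> `|G - \sum_(n < N) g n t|.
    by apply: cvg_norm; apply: cvgB => //; exact: cvg_cst.
  move=> C; apply: (cvgr_to_le C); near=> M; apply: le_trans HN; apply: tail.
  by near: M; exact: nbhs_infty_ge.
have limF r : `|(F r - F t) - (\sum_(n < N) f n r - \sum_(n < N) f n t)| <= e / 3 * `|r - t|.
  have : `|(\sum_(n < M) f n r - \sum_(n < M) f n t) - (\sum_(n < N) f n r - \sum_(n < N) f n t)|
     @[M --> \oo] --> `|(F r - F t) - (\sum_(n < N) f n r - \sum_(n < N) f n t)|.
    by apply: cvg_norm; apply: cvgB; [apply: cvgB|exact: cvg_cst].
  move=> C; apply: (cvgr_to_le C); near=> M.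
  apply: (@le_trans _ _ (K * N.+1%:R^-1 * `|r - t|)); last by rewrite ler_wpM2r.
  by apply: tailF; near: M; exact: nbhs_infty_ge.
pose FN r := \sum_(n < N) f n r.
have dN : is_derive t 1 FN (\sum_(n < N) g n t).
  by apply: is_derive_sumr => n _; exact: df.
have CN : h^-1 *: ((FN \o shift t) (h *: 1) - FN t) @[h --> 0^'] --> \sum_(n < N) g n t.
  have <- : 'D_1 FN t = \sum_(n < N) g n t by exact: derive_val.
  by have [] := dN.
have /cvgrPdist_le/(_ (e / 3)) := CN; rewrite divr_gt0 // => /(_ isT) near1.
near=> h.
have h0 : h != 0 by near: h; exact: nbhs_dnbhs_neq.
have h1 : `|\sum_(n < N) g n t - h^-1 *: ((FN \o shift t) (h *: 1) - FN t)| <= e / 3.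
  by near: h.
have := limF (h + t); rewrite addrK => h2.
have h3 : `|h^-1 *: ((FN \o shift t) (h *: 1) - FN t) - h^-1 *: ((F \o shift t) (h *: 1) - F t)| <= e / 3.
  rewrite /= /GRing.scale /= mulr1 -mulrBr normrM normfV mulrC ler_pdivrMr ?normr_gt0 //.
  by rewrite distrC.
rewrite -[G](subrK (\sum_(n < N) g n t)) -addrA.
rewrite -[\sum_(n < N) g n t in X in _ + X](subrK (h^-1 *: ((FN \o shift t) (h *: 1) - FN t))).
rewrite -[X in `|_ + X|]addrA; apply: (le_trans (ler_normD _ _)).
have := ler_normD (\sum_(n < N) g n t - h^-1 *: ((FN \o shift t) (h *: 1) - FN t))
  (h^-1 *: ((FN \o shift t) (h *: 1) - FN t) - h^-1 *: ((F \o shift t) (h *: 1) - F t)).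
lra.
Unshelve. all: by end_near.
Qed.

End TermwiseDerivative.

(** * Pairing coefficient sequences with Schwartz functions *)

Section SummationByParts.
Context {R : realType}.
Implicit Types (z w : R[i]) (a v : nat -> R[i]) (phi : R -> R) (n m k : nat) (A C : R).
Local Notation X := (opX (@Bc R)).
Local Notation D := (opD (@Bc R)).
Local Notation XC := (opX BC).
Local Notation DC := (opD BC).

(** Limits and derivatives are taken separately on real and imaginary parts; this norm bounds both
    without square roots. *)
Definition n1 z : R := `|complex.Re z| + `|complex.Im z|.

Lemma n1_ge0 z : 0 <= n1 z. Proof. by rewrite addr_ge0. Qed.
Lemma n1_Re z : `|complex.Re z| <= n1 z. Proof. by rewrite lerDl. Qed.
Lemma n1_Im z : `|complex.Im z| <= n1 z. Proof. by rewrite lerDr. Qed.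
Lemma n1D z w : n1 (z + w) <= n1 z + n1 w.
Proof.
rewrite /n1 Re_add Im_add addrACA lerD //; exact: ler_normD.
Qed.
Lemma n1N z : n1 (- z) = n1 z. Proof. by rewrite /n1 Re_opp Im_opp !normrN. Qed.
Lemma n1B z w : n1 (z - w) <= n1 z + n1 w. Proof. by rewrite -(n1N w) n1D. Qed.
Lemma n1CM (x : R) z : n1 (x%:C * z) = `|x| * n1 z.
Proof. by rewrite /n1 Re_CM Im_CM !normrM mulrDr. Qed.
Lemma n1iM z : n1 ('i * z) = n1 z.
Proof. by rewrite /n1 Re_iM Im_iM normrN addrC. Qed.

Lemma n1_sqn z A : 0 <= A -> sqn z <= A ^+ 2 -> n1 z <= 2 * A.
Proof.
move=> A0 zA.
have h (x y : R) : x ^+ 2 + y ^+ 2 <= A ^+ 2 -> `|x| <= A.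
  move=> xy; rewrite -(@ler_pXn2r _ 2) ?nnegrE // real_normK ?num_real //.
  by apply: le_trans xy; rewrite lerDl sqr_ge0.
have h1 := h _ _ zA; move: zA; rewrite /sqn addrC => /h h2; rewrite /n1; lra.
Qed.

Definition growth k A a := forall n, n1 (a n) <= A * lam n ^+ k.

Lemma lamS n : lam n.+1 <= 3 * lam n :> R.
Proof. by rewrite /lam -natr1; have := ler0n R n; lra. Qed.

Lemma Bc_lam n : (Bc n.+1 : R) <= lam n /\ (Bc n : R) <= lam n.
Proof.
have n0 := ler0n R n; split.
  by apply: le_trans (Bc_lin n) _; rewrite /lam -natr1; lra.
case: n n0 => [|n] n0; first by rewrite Bc0 lam_ge0.
by apply: le_trans (Bc_lin n) _; rewrite /lam; lra.
Qed.

Lemma growth_step k A a n : 0 <= A -> growth k A a ->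
  n1 (BC n.+1 * a n.+1) + n1 (BC n * a n.-1) <= 2 * 3 ^+ k * A * lam n ^+ k.+1.
Proof.
move=> A0 ga; have [B1 B2] := Bc_lam n.
have l0 : 0 <= lam n ^+ k :> R by rewrite exprn_ge0 // lam_ge0.
have t3 : 1 <= 3 ^+ k :> R by rewrite exprn_ege1 // ler1n.
have e1 : n1 (BC n.+1 * a n.+1) <= lam n * (A * (3 ^+ k * lam n ^+ k)).
  rewrite n1CM ger0_norm ?Bc_ge0 // ler_pM ?Bc_ge0 ?n1_ge0 //.
  apply: le_trans (ga n.+1) _; rewrite ler_wpM2l // -exprMn.
  by rewrite lerXn2r ?nnegrE ?mulr_ge0 ?lam_ge0 // lamS.
have e2 : n1 (BC n * a n.-1) <= lam n * (A * (3 ^+ k * lam n ^+ k)).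
  rewrite n1CM ger0_norm ?Bc_ge0 // ler_pM ?Bc_ge0 ?n1_ge0 //.
  apply: le_trans (ga n.-1) _; rewrite ler_wpM2l //.
  apply: (@le_trans _ _ (lam n ^+ k)); last by rewrite ler_peMl.
  by rewrite lerXn2r ?nnegrE ?lam_ge0 // lam_le // leq_pred.
rewrite exprS; lra.
Qed.

Lemma growth_X k A a : 0 <= A -> growth k A a -> growth k.+1 (2 * 3 ^+ k * A) (XC a).
Proof. by move=> A0 ga n; apply: le_trans (n1D _ _) (growth_step _ A0 ga). Qed.

Lemma growth_D k A a : 0 <= A -> growth k A a -> growth k.+1 (2 * 3 ^+ k * A) (DC a).
Proof.
move=> A0 ga n; apply: le_trans (n1B _ _) _; rewrite addrC; exact: growth_step.
Qed.

(** Each of the four second-order terms is at most [12 A lam ^ 2], from two applications of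
    [growth_X] or [growth_D], and the first-order term at most [2 A lam]. *)
Lemma hamc_growth kappa iota t A a n : 0 <= A -> growth 0 A a ->
  n1 (hamc kappa iota t a n) <= (12 + 24 * `|kappa| + 4 * `|iota|) * A * lam n ^+ 2.
Proof.
move=> A0 ga.
have A2 : 0 <= 2 * 3 ^+ 0 * A by rewrite !mulr_ge0.
have gX := growth_X A0 ga; have gD := growth_D A0 ga.
have := growth_X A2 gX n; have := growth_X A2 gD n.
have := growth_D A2 gX n; have := growth_D A2 gD n.
have := gD n; rewrite expr0 !expr1.
set q := lam n ^+ 2; have q1 : lam n <= q :> R by rewrite /q expr2 ler_peMl ?lam_ge1 ?lam_ge0.
have l0 := @lam_ge0 R n.
set DD := DC (DC a) n; set DX := DC (XC a) n; set XD := XC (DC a) n; set XX := XC (XC a) n.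
set D1 := DC a n => hD hDD hDX hXD hXX.
have hD' : n1 D1 <= 2 * A * q.
  by apply: le_trans hD _; rewrite mulr1 ler_wpM2l // mulr_ge0.
have c1 := @cos_norm_le1 R t; have s1 := @sin_norm_le1 R t.
have sq1 (x : R) : `|x| <= 1 -> `|x ^+ 2| <= 1.
  by move=> x1; rewrite normrX exprn_ile1.
have c2 := sq1 _ c1; have s2 := sq1 _ s1.
have cs1 : `|cos t * sin t| <= 1 by rewrite normrM mulr_ile1.
have M1 (x : R) z : `|x| <= 1 -> n1 (x%:C * z) <= n1 z.
  by move=> x1; rewrite n1CM ler_piMl // n1_ge0.
have E2 (x : R) z : (2 : R[i]) * 'i * x%:C * z = 'i * ((2 * x)%:C * z).
  by rewrite rmorphM /= -[2 in RHS]/(2%:R) rmorph_nat; ring.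
rewrite /hamc E2.
apply: le_trans (n1B _ _) _.
have h3 : n1 ('i * ((2 * (iota * cos t))%:C * D1)) <= 4 * `|iota| * A * q.
  rewrite n1iM n1CM !normrM (@ger0_norm _ 2) //.
  have : `|iota| * `|cos t| <= `|iota| by rewrite ler_piMr.
  have := n1_ge0 D1; have := normr_ge0 iota => i0 d0 ic.
  apply: (@le_trans _ _ (2 * `|iota| * (2 * A * q))); last by lra.
  by rewrite ler_pM ?mulr_ge0 // ler_wpM2l.
have h1 : n1 ((2^-1)%:C * (- DD + XX)) <= 12 * A * q.
  have := n1D (- DD) XX; rewrite n1N n1CM ger0_norm //; lra.
have h2 : n1 ((kappa / 2)%:C * (- (cos t ^+ 2)%:C * XX
    + 'i * (cos t * sin t)%:C * (XD + DX) + (sin t ^+ 2)%:C * DD)) <= 24 * `|kappa| * A * q.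
  rewrite n1CM normrM (@ger0_norm _ 2^-1) //.
  set Z := (X in n1 X).
  have : n1 Z <= n1 XX + (n1 XD + n1 DX) + n1 DD.
    apply: le_trans (n1D _ _) _; rewrite lerD ?M1 //.
    apply: le_trans (n1D _ _) _; rewrite mulNr n1N lerD ?M1 //.
    rewrite -mulrA n1iM; apply: le_trans (M1 _ _ cs1) (n1D _ _).
  have k0 := normr_ge0 kappa; move=> hZ.
  apply: (@le_trans _ _ (`|kappa| / 2 * (48 * A * q))); last by lra.
  by rewrite ler_wpM2l ?divr_ge0 //; lra.
have := n1D ((2^-1)%:C * (- DD + XX)) ((kappa / 2)%:C * (- (cos t ^+ 2)%:C * XX
    + 'i * (cos t * sin t)%:C * (XD + DX) + (sin t ^+ 2)%:C * DD)).
lra.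
Qed.

Definition pc phi n : R := ip phi (hg 0 n).

Lemma pc_mulX phi n : schwartz phi -> pc (mulX phi) n = X (pc phi) n.
Proof. by move=> sp; rewrite /pc ip_mulX ip_mulX_hg0 //; exact: sqi_schwartz. Qed.

Lemma pc_derive1 phi n : schwartz phi -> pc (derive1 phi) n = - D (pc phi) n.
Proof.
move=> sp; rewrite /pc ip_derive1 //; last exact: schwartz_hg.
by rewrite ip_derive1_hg0 //; exact: sqi_schwartz.
Qed.

Lemma pc_bound phi n : schwartz phi -> `|pc phi n| <= 1 + ip phi phi.
Proof.
move=> /sqi_schwartz sp; have := hg_bessel 0 n.+1 sp.
rewrite big_ord_recr /= -/(pc phi n) => h.
have : pc phi n ^+ 2 <= ip phi phi.
  by apply: le_trans h; rewrite lerDr sumr_ge0 // => i _; rewrite sqr_ge0.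
rewrite -(real_normK (num_real (pc phi n))); set x := `|_|.
have := sqr_ge0 (x - 1); have : 0 <= x by exact: normr_ge0.
nra.
Qed.

Lemma lam_pc phi n : schwartz phi ->
  lam n * pc phi n = pc (mulX (mulX phi)) n - pc (derive1 (derive1 phi)) n.
Proof.
move=> sp; have sm := schwartz_mulX sp; have sd := schwartz_derive1 sp.
rewrite pc_mulX // pc_derive1 //.
have -> : pc (mulX phi) = X (pc phi) by apply/funext => m; rewrite pc_mulX.
have -> : pc (derive1 phi) = fun m => - D (pc phi) m by apply/funext => m; rewrite pc_derive1.
have := opXX_DD (fun m => (pc phi m)%:C) n.
move=> /(congr1 (@complex.Re R)); rewrite Re_add Re_opp Re_opX Re_opD Re_CM /= => <-.
have -> : (fun m => complex.Re (XC (fun m => (pc phi m)%:C) m)) = X (pc phi).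
  by apply/funext => m; rewrite Re_opX.
have -> : (fun m => complex.Re (DC (fun m => (pc phi m)%:C) m)) = D (pc phi).
  by apply/funext => m; rewrite Re_opD.
rewrite /opX /opD; ring.
Qed.

(** By [lam_pc] a factor [lam] on the coefficients is the harmonic oscillator on the function, which
    remains a Schwartz function. *)
Lemma pc_rapid k phi : schwartz phi -> exists C, 0 <= C /\
  forall n, lam n ^+ k * `|pc phi n| <= C.
Proof.
elim: k phi => [|k IH] phi sp.
  exists (1 + ip phi phi); split; first by rewrite addr_ge0 // ip_ge0.
  by move=> n; rewrite expr0 mul1r pc_bound.
have [C1 [C10 H1]] := IH _ (schwartz_mulX (schwartz_mulX sp)).
have [C2 [C20 H2]] := IH _ (schwartz_derive1 (schwartz_derive1 sp)).
exists (C1 + C2); split=> [|n]; first exact: addr_ge0.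
rewrite exprSr -mulrA -[lam n in X in _ * X]ger0_norm ?lam_ge0 // -normrM lam_pc //.
apply: le_trans (ler_wpM2l (lamX_ge0 _ _) (ler_normB _ _)) _.
by rewrite mulrDr lerD.
Qed.

Definition clim (S : nat -> R[i]) z :=
  complex.Re (S N) @[N --> \oo] --> complex.Re z /\ complex.Im (S N) @[N --> \oo] --> complex.Im z.

Lemma clim_eq S S' z z' : clim S z -> S =1 S' -> z = z' -> clim S' z'.
Proof. by move=> H /funext <- <-. Qed.

Lemma climD S S' z z' : clim S z -> clim S' z' -> clim (fun N => S N + S' N) (z + z').
Proof.
move=> [h1 h2] [h3 h4]; split.
  by rewrite Re_add; under eq_fun do rewrite Re_add; exact: cvgD.
by rewrite Im_add; under eq_fun do rewrite Im_add; exact: cvgD.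
Qed.

Lemma climZ c S z : clim S z -> clim (fun N => c * S N) (c * z).
Proof.
move=> [h1 h2]; split.
  rewrite Re_mul; under eq_fun do rewrite Re_mul.
  by apply: cvgB; apply: cvgM => //; exact: cvg_cst.
rewrite Im_mul; under eq_fun do rewrite Im_mul.
by apply: cvgD; apply: cvgM => //; exact: cvg_cst.
Qed.

(** Transfers a limit between partial sums that differ by the boundary terms of a summation by
    parts; the shift to [N.+1] matches those formulas, which concern nonempty sums. *)
Lemma clim_near S S' z C : (forall N, n1 (S' N.+1 - S N.+1) <= C * N.+1%:R^-1) ->
  clim S z -> clim S' z.
Proof.
move=> H [h1 h2].
have C0 (d : nat -> R) : (forall N, `|d N| <= C * N.+1%:R^-1) -> d N @[N --> \oo] --> (0 : R).
  move=> dC; apply/norm_cvg0P.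
  apply: (@le_cvg0 _ _ _ _ _ (fun N => C * N.+1%:R^-1)); first by move=> N; rewrite normr_ge0 dC.
  rewrite -(mulr0 C); apply: cvgM; [exact: cvg_cst|exact: cvg_harmonic].
split; rewrite -cvg_shiftS.
  have -> : (fun N => complex.Re (S' N.+1)) =
      fun N => complex.Re (S N.+1) + complex.Re (S' N.+1 - S N.+1).
    by apply/funext => N; rewrite Re_add Re_opp; ring.
  rewrite -[complex.Re z]addr0; apply: cvgD.
    by rewrite (cvg_shiftS (fun N => complex.Re (S N))).
  by apply: C0 => N; apply: le_trans (n1_Re _) (H N).
have -> : (fun N => complex.Im (S' N.+1)) =
    fun N => complex.Im (S N.+1) + complex.Im (S' N.+1 - S N.+1).
  by apply/funext => N; rewrite Im_add Im_opp; ring.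
rewrite -[complex.Im z]addr0; apply: cvgD.
  by rewrite (cvg_shiftS (fun N => complex.Im (S N))).
by apply: C0 => N; apply: le_trans (n1_Im _) (H N).
Qed.

Definition prs a phi N : R[i] := \sum_(n < N) a n * (pc phi n)%:C.

Lemma prs_hcoef u phi : csqi u -> schwartz phi -> clim (prs (hcoef u) phi) (pairing u phi).
Proof.
move=> [sr si] /sqi_schwartz sp; rewrite pairingE; split.
  under eq_fun do rewrite /prs Re_sum; under eq_fun do under eq_bigr do rewrite hcoefE Re_mul mulr0 subr0.
  exact: hg_parseval2.
under eq_fun do rewrite /prs Im_sum; under eq_fun do under eq_bigr do rewrite hcoefE Im_mul mulr0 add0r.
exact: hg_parseval2.
Qed.

Lemma sum_by_parts_X a v N : \sum_(n < N.+1) XC a n * v n - \sum_(n < N.+1) a n * XC v n =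
  BC N.+1 * (a N.+1 * v N - a N * v N.+1).
Proof.
elim: N => [|N IH]; first by rewrite !big_ord1 /opX /BC Bc0 /=; ring.
rewrite big_ord_recr [X in _ - X]big_ord_recr /= opprD addrACA IH /opX /=; ring.
Qed.

Lemma sum_by_parts_D a v N : \sum_(n < N.+1) DC a n * v n + \sum_(n < N.+1) a n * DC v n =
  - (BC N.+1 * (a N.+1 * v N + a N * v N.+1)).
Proof.
elim: N => [|N IH]; first by rewrite !big_ord1 /opD /BC Bc0 /=; ring.
rewrite big_ord_recr [X in _ + X]big_ord_recr /= addrACA IH /opD /=; ring.
Qed.

(** Of the [k + 2] powers of [lam] provided by [pc_rapid], [k] absorb the growth of [a], one absorbs
    [BC], and the last gives the decay. *)
Lemma boundary k A a phi : 0 <= A -> growth k A a -> schwartz phi ->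
  exists C, forall N, n1 (BC N.+1 * (a N.+1 * (pc phi N)%:C)) +
    n1 (BC N.+1 * (a N * (pc phi N.+1)%:C)) <= C * N.+1%:R^-1.
Proof.
move=> A0 ga sp; have [C [C0 HC]] := pc_rapid k.+2 sp.
exists (2 * (A * 3 ^+ k * C)) => N.
have l0 := @lam_gt0 R N; have L0 := @lam_gt0 R N.+1.
have [B1 _] := Bc_lam N; have ll : lam N <= lam N.+1 :> R by rewrite lam_le.
have h (j : nat) x : n1 x <= A * (3 ^+ k * lam N ^+ k) -> lam N <= lam j :> R ->
    n1 (BC N.+1 * (x * (pc phi j)%:C)) <= A * 3 ^+ k * C * N.+1%:R^-1.
  move=> hx lj; rewrite n1CM ger0_norm ?Bc_ge0 // (mulrC x) n1CM.
  rewrite ler_pdivlMr //.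
  have NL : N.+1%:R <= lam N :> R by rewrite /lam -natr1; have := ler0n R N; lra.
  apply: (@le_trans _ _ (lam N * (`|pc phi j| * (A * (3 ^+ k * lam N ^+ k))) * lam N)).
    rewrite ler_pM ?mulr_ge0 ?n1_ge0 ?Bc_ge0 // ler_pM ?mulr_ge0 ?n1_ge0 ?Bc_ge0 //.
    by rewrite ler_wpM2l.
  have -> : lam N * (`|pc phi j| * (A * (3 ^+ k * lam N ^+ k))) * lam N =
      A * 3 ^+ k * (lam N ^+ k.+2 * `|pc phi j|) by rewrite !exprSr; ring.
  rewrite ler_wpM2l ?mulr_ge0 ?exprn_ge0 //; apply: le_trans (HC j).
  by rewrite ler_wpM2r // lerXn2r ?nnegrE ?lam_ge0.
rewrite -mulrA mulr_natl mulr2n; apply: lerD; apply: h => //.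
  apply: le_trans (ga _) _; rewrite ler_wpM2l // -exprMn.
  by rewrite lerXn2r ?nnegrE ?mulr_ge0 ?lam_ge0 // lamS.
apply: le_trans (ga _) _; rewrite ler_wpM2l // ler_peMl ?lamX_ge0 //.
by rewrite exprn_ege1 // ler1n.
Qed.

Lemma clim_X k A a phi z : 0 <= A -> growth k A a -> schwartz phi ->
  clim (prs a (mulX phi)) z -> clim (prs (XC a) phi) z.
Proof.
move=> A0 ga sp; have [C HC] := boundary A0 ga sp.
apply: (@clim_near _ _ _ C) => N; apply: le_trans (HC N).
have -> : prs a (mulX phi) N.+1 = \sum_(n < N.+1) a n * XC (fun m => (pc phi m)%:C) n.
  apply: eq_bigr => n _; rewrite pc_mulX //; congr (_ * _).
  by apply: complex_eq; rewrite ?Re_opX ?Im_opX //= /opX !mulr0 addr0.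
by rewrite /prs sum_by_parts_X mulrBr n1B.
Qed.

Lemma clim_D k A a phi z : 0 <= A -> growth k A a -> schwartz phi ->
  clim (prs a (derive1 phi)) z -> clim (prs (DC a) phi) z.
Proof.
move=> A0 ga sp; have [C HC] := boundary A0 ga sp.
apply: (@clim_near _ _ _ C) => N; apply: le_trans (HC N).
have -> : prs a (derive1 phi) N.+1 = - \sum_(n < N.+1) a n * DC (fun m => (pc phi m)%:C) n.
  rewrite -sumrN; apply: eq_bigr => n _; rewrite pc_derive1 // rmorphN /= mulrN; congr (- (_ * _)).
  by apply: complex_eq; rewrite ?Re_opD ?Im_opD //= /opD !mulr0 subr0.
by rewrite opprK /prs sum_by_parts_D n1N mulrDr n1D.
Qed.

End SummationByParts.

(** * Construction of the solution from its coefficients *)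

Section Existence.
Context {R : realType}.
Variables (kappa iota : R).
Implicit Types (t : R) (a : nat -> R[i]) (u psi : R -> R[i]) (phi : R -> R) (n m N : nat).
Local Notation XC := (opX BC).
Local Notation DC := (opD BC).
Local Notation ham := (hamiltonian kappa iota Xdist Ddist).
Local Notation av := (av kappa iota).

Section Combination.
Variables c1 c2 c3 c4 c5 c6 : R[i].
(* [hamc] and the right-hand side of [hamiltonianE] both have this shape *)
Let comb (xDD xXX xXD xDX xD : R[i]) : R[i] :=
  c1 * (- xDD + xXX) + c2 * (- c3 * xXX + c4 * (xXD + xDX) + c5 * xDD) - c6 * xD.

Lemma prs_comb (b1 b2 b3 b4 b5 : nat -> R[i]) phi N :
  prs (fun n => comb (b1 n) (b2 n) (b3 n) (b4 n) (b5 n)) phi N =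
  comb (prs b1 phi N) (prs b2 phi N) (prs b3 phi N) (prs b4 phi N) (prs b5 phi N).
Proof.
rewrite /comb /prs; elim: N => [|N IH]; first by rewrite !big_ord0; ring.
by rewrite !big_ord_recr /= IH; ring.
Qed.

Lemma clim_comb (S1 S2 S3 S4 S5 : nat -> R[i]) (z1 z2 z3 z4 z5 : R[i]) :
  clim S1 z1 -> clim S2 z2 -> clim S3 z3 -> clim S4 z4 -> clim S5 z5 ->
  clim (fun N => comb (S1 N) (S2 N) (S3 N) (S4 N) (S5 N)) (comb z1 z2 z3 z4 z5).
Proof.
move=> h1 h2 h3 h4 h5.
have H := climD (climD (climZ (- c1 + c2 * c5) h1) (climZ (c1 - c2 * c3) h2))
  (climD (climZ (c2 * c4) (climD h3 h4)) (climZ (- c6) h5)).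
by apply: (clim_eq H) => [N|]; rewrite /comb; ring.
Qed.

End Combination.

(** The sequence [hamc] need not be square-summable, so Parseval does not apply to it. Its
    polynomial growth suffices against the rapid decay of [pc phi], and the operators are moved one
    at a time. *)
Lemma prs_ham t u phi A : csqi u -> schwartz phi -> 0 <= A -> growth 0 A (hcoef u) ->
  clim (prs (hamc kappa iota t (hcoef u)) phi) (ham t (regular_dist u) phi).
Proof.
move=> su sp A0; set a := hcoef u => ga; rewrite hamiltonianE /regular_dist.
have A2 : 0 <= 2 * 3 ^+ 0 * A by rewrite !mulr_ge0.
have gX := growth_X A0 ga; have gD := growth_D A0 ga.
have sm := schwartz_mulX sp; have sd := schwartz_derive1 sp.
have XX := clim_X A2 gX sp (clim_X A0 ga sm (prs_hcoef su (schwartz_mulX sm))).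
have XD := clim_X A2 gD sp (clim_D A0 ga sm (prs_hcoef su (schwartz_derive1 sm))).
have DX := clim_D A2 gX sp (clim_X A0 ga sd (prs_hcoef su (schwartz_mulX sd))).
have DD := clim_D A2 gD sp (clim_D A0 ga sd (prs_hcoef su (schwartz_derive1 sd))).
have D1 := clim_D A0 ga sp (prs_hcoef su sd).
exact: (clim_eq (clim_comb _ _ _ _ _ _ DD XX XD DX D1)
  (fun N => esym (prs_comb _ _ _ _ _ _ _ _ _ _ _ _ _)) erefl).
Qed.

(** Puts the summable bound [1 / lam ^ 2] into the telescoping form that [is_derive_series]
    expects. *)
Lemma lam_telescope n : (lam n ^+ 2)^-1 <= 2 * (n.+1%:R^-1 - n.+2%:R^-1) :> R.
Proof.
have n0 := ler0n R n; have l0 := @lam_gt0 R n.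
have -> : n.+1%:R^-1 - n.+2%:R^-1 = (n.+1%:R * n.+2%:R)^-1 :> R.
  have h (x : R) : 0 < x -> x^-1 - (x + 1)^-1 = (x * (x + 1))^-1.
    move=> x0; have p2 : x + 1 != 0 by rewrite gt_eqF // ltr_wpDr.
    by field; rewrite p2 gt_eqF.
  by rewrite -[n.+2%:R]natr1 h.
rewrite ler_pdivlMr ?mulr_gt0 // mulrC ler_pdivrMr ?exprn_gt0 //.
rewrite /lam -[n.+2%:R]natr1 -[n.+1%:R]natr1; nra.
Qed.

Lemma hcoef_sub psi psi' n : csqi psi -> csqi psi' ->
  hcoef (fun x => psi x - psi' x) n = hcoef psi n - hcoef psi' n.
Proof. by move=> s1 s2; rewrite -!(cw0 kappa iota) cwB. Qed.

Lemma av_bessel psi t N : csqi psi -> \sum_(n < N) sqn (av t psi n) <= nrm2 psi.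
Proof. by move=> sp; under eq_bigr do rewrite sqn_av; exact: cw_bessel. Qed.

Lemma av_growth psi t : csqi psi -> growth 0 (2 * (1 + nrm2 psi)) (av t psi).
Proof.
move=> sp n; have m0 := nrm2_ge0 psi; rewrite expr0 mulr1; apply: n1_sqn.
  by rewrite addr_ge0.
have := av_bessel t n.+1 sp; rewrite big_ord_recr /= => h.
have h0 : 0 <= \sum_(i < n) sqn (av t psi i) by apply: sumr_ge0 => i _; exact: sqn_ge0.
nra.
Qed.

Lemma av_continuous psi n t : csqi psi ->
  complex.Re (av r psi n) @[r --> t] --> complex.Re (av t psi n) /\
  complex.Im (av r psi n) @[r --> t] --> complex.Im (av t psi n).
Proof. by move=> sp; apply: (is_cderive_cvg _ (is_cderive_av kappa iota t n sp)). Qed.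

Lemma cvg_sumr (F : set_system R) {FF : Filter F} (f : nat -> R -> R) (l : nat -> R) N :
  (forall n, f n r @[r --> F] --> l n) -> \sum_(n < N) f n r @[r --> F] --> \sum_(n < N) l n.
Proof.
move=> H; elim: N => [|N IH].
  by rewrite big_ord0; under eq_fun do rewrite big_ord0; exact: cvg_cst.
by rewrite big_ord_recr; under eq_fun do rewrite big_ord_recr; exact: cvgD.
Qed.

Lemma sum_split_le (x y z : nat -> R) N M (S : R) : (N <= M)%N ->
  (forall n, z n <= 2 * x n + 2 * y n) ->
  \sum_(n < M) x n <= S -> \sum_(n < M) y n <= S ->
  \sum_(n < M) z n <= \sum_(n < N) z n + 2 * (S - \sum_(n < N) x n) + 2 * (S - \sum_(n < N) y n).
Proof.
move=> NM zxy; rewrite -(subnKC NM) !big_split_ord /= => hx hy.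
have : \sum_(i < M - N) z (N + i)%N <= \sum_(i < M - N) (2 * x (N + i)%N + 2 * y (N + i)%N).
  exact: ler_sum.
rewrite big_split /= -!mulr_sumr; lra.
Qed.

Lemma sqn_cvg (F : set_system R) {FF : Filter F} (f : R -> R[i]) (z : R[i]) :
  complex.Re (f r) @[r --> F] --> complex.Re z -> complex.Im (f r) @[r --> F] --> complex.Im z ->
  sqn (f r) @[r --> F] --> sqn z.
Proof.
move=> h1 h2; rewrite /sqn; under eq_fun do rewrite !expr2.
by rewrite !expr2; apply: cvgD; apply: cvgM.
Qed.

Lemma sqnB_cvg (F : set_system R) {FF : Filter F} (f : R -> R[i]) (z w : R[i]) :
  complex.Re (f r) @[r --> F] --> complex.Re z -> complex.Im (f r) @[r --> F] --> complex.Im z ->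
  sqn (f r - w) @[r --> F] --> sqn (z - w).
Proof.
move=> h1 h2; apply: sqn_cvg.
  by rewrite Re_add; under eq_fun do rewrite Re_add; apply: cvgD => //; exact: cvg_cst.
by rewrite Im_add; under eq_fun do rewrite Im_add; apply: cvgD => //; exact: cvg_cst.
Qed.

Lemma ae_complex psi psi' :
  {ae (@lebesgue_measure R), forall x, re psi x = re psi' x} ->
  {ae (@lebesgue_measure R), forall x, im psi x = im psi' x} ->
  {ae (@lebesgue_measure R), forall x, psi x = psi' x}.
Proof.
move=> [N1 [mN1 z1 h1]] [N2 [mN2 z2 h2]].
exists (N1 `|` N2); split; [exact: measurableU|exact: (etrans (measureU0 mN1 mN2 z2) z1)|].
move=> x /= H; apply: contrapT => nN; apply: H.
apply: complex_eq.
  by apply: contrapT => h; apply: nN; left; apply: h1 => /=; exact: h.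
by apply: contrapT => h; apply: nN; right; apply: h2 => /=; exact: h.
Qed.

Lemma is_cderive_series (f g : nat -> R -> R[i]) (p : nat -> R) (F : R -> R[i]) (G : R[i])
  (K t : R) : (forall n (r : R), is_cderive (f n) r (g n r)) ->
  (forall n r, n1 (g n r) * `|p n| <= K * (n.+1%:R^-1 - n.+2%:R^-1)) -> 0 <= K ->
  (forall r, clim (fun N => \sum_(n < N) f n r * (p n)%:C) (F r)) ->
  clim (fun N => \sum_(n < N) g n t * (p n)%:C) G ->
  is_cderive F t G.
Proof.
move=> df gK K0 P [Q1 Q2].
have RC (z : R[i]) x : complex.Re (z * x%:C) = complex.Re z * x by rewrite Re_mul /= mulr0 subr0.
have IC (z : R[i]) x : complex.Im (z * x%:C) = complex.Im z * x by rewrite Im_mul /= mulr0 add0r.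
split.
- apply: (@is_derive_series R (fun n r => complex.Re (f n r) * p n)
    (fun n r => complex.Re (g n r) * p n) _ _ K) => //.
  + move=> n r; have [d1 _] := df n r.
    by apply: is_derive_eq; rewrite /GRing.scale /=; ring.
  + by move=> n r; rewrite normrM; apply: le_trans (gK n r); rewrite ler_wpM2r // n1_Re.
  + move=> r; have [p1 _] := P r; apply: cvg_trans p1; apply: near_eq_cvg; apply: nearW => N.
    by rewrite Re_sum; apply: eq_bigr => n _; rewrite RC.
  apply: cvg_trans Q1; apply: near_eq_cvg; apply: nearW => N.
  by rewrite Re_sum; apply: eq_bigr => n _; rewrite RC.
- apply: (@is_derive_series R (fun n r => complex.Im (f n r) * p n)
    (fun n r => complex.Im (g n r) * p n) _ _ K) => //.
  + move=> n r; have [_ d1] := df n r.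
    by apply: is_derive_eq; rewrite /GRing.scale /=; ring.
  + by move=> n r; rewrite normrM; apply: le_trans (gK n r); rewrite ler_wpM2r // n1_Im.
  + move=> r; have [_ p1] := P r; apply: cvg_trans p1; apply: near_eq_cvg; apply: nearW => N.
    by rewrite Im_sum; apply: eq_bigr => n _; rewrite IC.
  apply: cvg_trans Q2; apply: near_eq_cvg; apply: nearW => N.
  by rewrite Im_sum; apply: eq_bigr => n _; rewrite IC.
Qed.

Section Family.
Variables (u0 : R -> R[i]) (u : R -> R -> R[i]).
Hypotheses (s0 : csqi u0) (su : forall t, csqi (u t)).
Hypothesis hu : forall t n, hcoef (u t) n = av t u0 n.
Let m := nrm2 u0.

(** Continuity of each coefficient and conservation of mass give strong continuity: beyond level [N]
    the difference is controlled by the mass missing from the first [N] coefficients, a finite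
    expression that is continuous in [t]. *)
Lemma family_bound t t0 N : nrm2 (fun x => u t x - u t0 x) <=
  \sum_(n < N) sqn (av t u0 n - av t0 u0 n) +
  2 * (m - \sum_(n < N) sqn (av t u0 n)) + 2 * (m - \sum_(n < N) sqn (av t0 u0 n)).
Proof.
have C := csqi_parseval (csqiB (su t) (su t0)).
apply: (cvgr_to_le C); near=> M.
have NM : (N <= M)%N by near: M; exact: nbhs_infty_ge.
under eq_bigr do rewrite hcoef_sub // !hu.
exact: (@sum_split_le (fun n => sqn (av t u0 n)) (fun n => sqn (av t0 u0 n))
  (fun n => sqn (av t u0 n - av t0 u0 n)) N M m NM (fun n => sqnB_le _ _)
  (av_bessel t M s0) (av_bessel t0 M s0)).
Unshelve. all: by end_near.
Qed.

Lemma family_continuous t0 : nrm2 (fun x => u t x - u t0 x) @[t --> t0] --> (0 : R).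
Proof.
apply/cvgrPdist_le => e e0.
(* As [t] tends to [t0], the bound of [family_bound] tends to four times this defect, at most
   [e / 2]. *)
have [N HN] : exists N, m - \sum_(n < N) sqn (av t0 u0 n) <= e / 8.
  have := cw_parseval kappa iota t0 s0 => /cvgrPdist_le/(_ (e / 8)).
  move=> /(_ (divr_gt0 e0 _))[] // N _ /(_ N (leqnn N)) /= h; exists N.
  under eq_bigr do rewrite sqn_av.
  exact: le_trans (ler_norm _) h.
pose q t := \sum_(n < N) sqn (av t u0 n - av t0 u0 n) +
  2 * (m - \sum_(n < N) sqn (av t u0 n)) + 2 * (m - \sum_(n < N) sqn (av t0 u0 n)).
have Q : q t @[t --> t0] --> \sum_(n < N) sqn (av t0 u0 n - av t0 u0 n) +
  2 * (m - \sum_(n < N) sqn (av t0 u0 n)) + 2 * (m - \sum_(n < N) sqn (av t0 u0 n)).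
  apply: cvgD; last exact: cvg_cst.
  apply: cvgD.
    apply: (@cvg_sumr _ _ (fun n r => sqn (av r u0 n - av t0 u0 n))
      (fun n => sqn (av t0 u0 n - av t0 u0 n))) => n.
    by have [h1 h2] := av_continuous n t0 s0; exact: sqnB_cvg.
  apply: cvgM; first exact: cvg_cst.
  apply: cvgB; first exact: cvg_cst.
  apply: (@cvg_sumr _ _ (fun n r => sqn (av r u0 n)) (fun n => sqn (av t0 u0 n))) => n.
  by have [h1 h2] := av_continuous n t0 s0; exact: sqn_cvg.
move/cvgrPdist_le : Q => /(_ (e / 2)); rewrite divr_gt0 // => /(_ isT).
apply: filterS => t /= h.
rewrite sub0r normrN ger0_norm ?nrm2_ge0 //; apply: le_trans (family_bound t t0 N) _.
rewrite -/(q t); move: h; rewrite distrC => h; have := le_trans (ler_norm _) h.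
rewrite big1; last by move=> i _; rewrite subrr sqn0.
lra.
Qed.

Lemma family_ae0 : {ae (@lebesgue_measure R), forall x, u 0 x = u0 x}.
Proof.
have E n : hcoef (u 0) n = hcoef u0 n by rewrite hu av0.
have [sr si] := s0; have [sr' si'] := su 0.
apply: ae_complex.
  apply: (@hexp_unique R 0) => // n; have := E n.
  by rewrite !hcoefE => /(congr1 (@complex.Re R)).
apply: (@hexp_unique R 0) => // n; have := E n.
by rewrite !hcoefE => /(congr1 (@complex.Im R)).
Qed.

Lemma family_weak t phi : schwartz phi ->
  is_cderive (fun r => pairing (u r) phi) t (- 'i * ham t (regular_dist (u t)) phi).
Proof.
move=> sp.
have hf r : hcoef (u r) = av r u0 by apply/funext => n; rewrite hu.
have m0 : 0 <= 2 * (1 + m) by rewrite mulr_ge0 // addr_ge0 // nrm2_ge0.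
have P r : clim (prs (av r u0) phi) (pairing (u r) phi) by rewrite -hf; exact: prs_hcoef.
have Q : clim (fun N => - 'i * prs (hamc kappa iota t (av t u0)) phi N)
    (- 'i * ham t (regular_dist (u t)) phi).
  apply: climZ; rewrite -hf; apply: (prs_ham t (su t) sp m0); rewrite hf; exact: av_growth.
(* Four powers: [hamc] costs [lam ^ 2], and a further [lam ^ 2] must remain in the denominator for
   [lam_telescope]. *)
have [C [C0 HC]] := pc_rapid 4 sp.
pose Kh := (12 + 24 * `|kappa| + 4 * `|iota|) * (2 * (1 + m)).
have Kh0 : 0 <= Kh by rewrite mulr_ge0 // !addr_ge0 // mulr_ge0.
have gK n r : n1 (- 'i * hamc kappa iota r (av r u0) n) * `|pc phi n| <=
    (2 * Kh * C) * (n.+1%:R^-1 - n.+2%:R^-1).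
  rewrite mulNr n1N n1iM.
  have h1 := hamc_growth kappa iota r n m0 (av_growth r s0); rewrite -/Kh in h1.
  have l2 : 0 < lam n ^+ 2 :> R by rewrite exprn_gt0 // lam_gt0.
  apply: (@le_trans _ _ (Kh * lam n ^+ 2 * (C * (lam n ^+ 2)^-1 * (lam n ^+ 2)^-1))).
    apply: ler_pM => //; first exact: n1_ge0.
    by rewrite !ler_pdivlMr // -mulrA -exprD mulrC; exact: HC.
  have -> : Kh * lam n ^+ 2 * (C * (lam n ^+ 2)^-1 * (lam n ^+ 2)^-1) = Kh * C * (lam n ^+ 2)^-1.
    by field; rewrite gt_eqF // lam_gt0.
  apply: le_trans (ler_wpM2l (mulr_ge0 Kh0 C0) (lam_telescope n)) _.
  by rewrite [leRHS]mulrC -!mulrA mulrCA; move: (_ - _) => d; rewrite le_eqVlt; apply/orP; left; apply/eqP; ring.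
have K0 : 0 <= 2 * Kh * C by apply: mulr_ge0 => //; exact: mulr_ge0.
apply: (@is_cderive_series (fun n r => av r u0 n) (fun n r => - 'i * hamc kappa iota r (av r u0) n)
  (pc phi) (fun r => pairing (u r) phi) _ _ t _ gK K0 P).
  by move=> n r; exact: is_cderive_av.
apply: (clim_eq Q) => // N; rewrite /prs mulr_sumr; apply: eq_bigr => n _; exact: mulrA.
Qed.

End Family.

Theorem solution_exists u0 : csqi u0 -> exists u : R -> R -> R[i], solution kappa iota u0 u.
Proof.
move=> s0.
(* [u t] is chosen separately at each time; its dependence on [t] is recovered from the coefficients
   alone. *)
have /choice[u Hu] : forall t : R, exists psi, csqi psi /\ forall n, hcoef psi n = av t u0 n.
  by move=> t; apply: (@hcoef_exists R _ (nrm2 u0)) => N; exact: av_bessel.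
have su t := (Hu t).1; have hu t := (Hu t).2.
exists u; split.
- by move=> t _; exact/L2_csqi.
- move=> t0 _; apply: (L2enorm_cvg0 _).2; first by move=> t; exact: csqiB.
  by apply: cvg_within_filter; exact: (family_continuous s0 su hu).
- exact: (family_ae0 s0 su hu).
move=> t phi _ sp; exists (- 'i * ham t (regular_dist (u t)) phi); split.
  exact: (family_weak s0 su hu).
by rewrite mulNr mulrN mulrA sqr_i mulN1r opprK.
Qed.

End Existence.

(** * The two-sided bound *)

Lemma nrm2_gt0 (R : realType) (psi : R -> R[i]) : csqi psi ->
  ~ {ae (@lebesgue_measure R), forall x, psi x = 0} -> 0 < nrm2 psi.
Proof.
move=> [sr si] nz; rewrite lt_neqAle nrm2_ge0 andbT eq_sym; apply/negP.
rewrite /nrm2 paddr_eq0 ?ip_ge0 // => /andP[/eqP zr /eqP zi]; apply: nz.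
by apply: (@ae_complex R psi (fun=> 0)); exact: ip_eq0_ae.
Qed.

Lemma powR_1D_le (R : realType) (x a : R) : 0 <= x -> 0 <= a ->
  (1 + x) `^ a <= 2 `^ a * (1 + x `^ a).
Proof.
move=> x0 a0; have p0 : 0 <= 2 `^ a :> R by exact: powR_ge0.
have [x1|/ltW x1] := leP x 1.
  apply: (@le_trans _ _ (2 `^ a)); first by rewrite ge0_ler_powR ?nnegrE ?addr_ge0 //; lra.
  by rewrite ler_peMr // lerDl powR_ge0.
apply: (@le_trans _ _ ((2 * x) `^ a)).
  by rewrite ge0_ler_powR ?nnegrE ?addr_ge0 ?mulr_ge0 //; lra.
by rewrite powRM // ler_wpM2l // lerDr.
Qed.

Theorem theorem1p3 (R : realType) (kappa iota : R)
    (hkappa : kappa != 0) (hiota : iota != 0)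
    (s : R) (hs : 0 <= s)
    (u0 : R -> R[i]) (hu0 : Hs s u0)
    (hu0nz : ~ {ae (@lebesgue_measure R), forall x, u0 x = 0}) :
  (exists u : R -> R -> R[i], solution kappa iota u0 u) /\
  exists c C : R, 0 < c /\ 0 < C /\
    forall u : R -> R -> R[i], solution kappa iota u0 u ->
    forall t : R, 0 <= t ->
      Hs s (u t) /\
      c * `|kappa * iota| `^ s * t `^ (2 * s) <= Hnorm s (u t) /\
      Hnorm s (u t) <= C * (1 + `|kappa * iota| `^ s * t `^ (2 * s)).
Proof.
have s0 : csqi u0 by apply/L2_csqi; case: hu0.
split; first exact: solution_exists.
have m0 := nrm2_gt0 s0 hu0nz.
have [c0 [c00 Hc]] := cw_lower hs hkappa hiota s0 m0.
have [C0 [C00 HC]] := cw_upper kappa iota hs.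
set k := `|kappa * iota| `^ s.
have k0 : 0 < k by rewrite powR_gt0 // normr_gt0 mulf_neq0.
pose S := Hnorm s u0 ^+ 2; have S0 : 0 <= S := sqr_ge0 _.
(* The factor [2 ^ (2 s)] comes from [powR_1D_le], which replaces [1 + t] by [t]. *)
pose B := Num.sqrt (C0 * S) * 2 `^ (2 * s).
have B0 : 0 <= B by rewrite mulr_ge0 ?sqrtr_ge0 ?powR_ge0.
have ki0 : 0 <= k^-1 by rewrite invr_ge0 ltW.
(* Dividing by [k] cancels the factor [|kappa iota| ^ s] of the lower bound. In the upper one,
   [1 + k^-1] pays for writing [t ^ (2 s)] as [k^-1 (k t ^ (2 s))], and the last 1 keeps the
   constant positive. *)
exists (Num.sqrt c0 / k), (B * (1 + k^-1) + 1); split; first by rewrite divr_gt0 // sqrtr_gt0.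
have BB : 0 <= B * (1 + k^-1) by rewrite mulr_ge0 // addr_ge0.
split; first by rewrite ltr_wpDl.
move=> u su t t0; have [uL _ _ _] := su.
have sut : csqi (u t) by apply/L2_csqi/uL.
have E n : sqn (hcoef (u t) n) = sqn (cw kappa iota t u0 n).
  by rewrite (solution_hcoef n s0 su t0) sqn_av.
have T J : \sum_(n < J) wt s n * sqn (hcoef (u t) n) <= C0 * (1 + t) `^ (4 * s) * S.
  under eq_bigr do rewrite E.
  by apply: HC => // Q; exact: Hnorm_ge.
have hst : Hs s (u t) := Hs_bounded sut T.
have N0 := Hnorm_ge0 hst.
have t2 : 0 <= t `^ (2 * s) by exact: powR_ge0.
have P4 (x : R) : 0 <= x -> x `^ (4 * s) = (x `^ (2 * s)) ^+ 2.
  by move=> x0; rewrite -powR_mulrn ?powR_ge0 // -powRrM; congr (_ `^ _); ring.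
have sq (x y : R) : 0 <= x -> 0 <= y -> x ^+ 2 <= y ^+ 2 -> x <= y.
  by move=> x0 y0; rewrite ler_pXn2r ?nnegrE.
have Hge J : \sum_(n < J) wt s n * sqn (cw kappa iota t u0 n) <= Hnorm s (u t) ^+ 2.
  by under eq_bigr do rewrite -E; exact: Hnorm_ge.
have Hle := Hnorm_le hst T.
split; first exact: hst.
move: (Hnorm s (u t)) N0 Hge Hle => h h0 Hge Hle; clear T; clearbody S; split.
  have -> : Num.sqrt c0 / k * k = Num.sqrt c0 by rewrite divfK // gt_eqF.
  have [J HJ] := Hc t t0.
  apply: sq => //; first by apply: mulr_ge0 => //; exact: sqrtr_ge0.
  rewrite exprMn sqr_sqrtr; last exact: ltW.
  rewrite -P4 //; exact: le_trans HJ (Hge J).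
have q0 : 0 <= (1 + t) `^ (2 * s) by exact: powR_ge0.
have H1 : h <= Num.sqrt (C0 * S) * (1 + t) `^ (2 * s).
  apply: sq => //; first by apply: mulr_ge0 => //; exact: sqrtr_ge0.
  rewrite exprMn sqr_sqrtr; last exact: mulr_ge0.
  rewrite -P4; last exact: addr_ge0.
  by rewrite mulrAC.
apply: (le_trans H1).
apply: (@le_trans _ _ (B * (1 + t `^ (2 * s)))).
  by rewrite /B -mulrA ler_wpM2l ?sqrtr_ge0 // powR_1D_le // mulr_ge0.
have kt : t `^ (2 * s) = k^-1 * (k * t `^ (2 * s)) by rewrite mulKf ?gt_eqF.
have kt0 : 0 <= k * t `^ (2 * s) by rewrite mulr_ge0 // ltW.
rewrite {1}kt; set y := k * t `^ (2 * s) in kt0 *.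
have h1 : 0 <= B * y by exact: mulr_ge0.
have h2 : 0 <= B * k^-1 by exact: mulr_ge0.
lra.
Qed.
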